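(* Let $E$ be a complex Banach space such that $E'$ has the approximation property. The following conditions are equivalent: (i) finite type polynomials are dense in $\mathcal P(E)$; (ii) for every open subset $U$ of $E$ we have $\overset{\vee}{U''}=\pi(M_b(U))$; (iii) for every open $H_b(E)$-convex subset $U$ of $E$ we have $\overset{\vee}{U''}=\pi(M_b(U))$. If the conditions do not hold, then there exists a proper open subset $U$ of $E$ which is $H_b(E)$-convex but which satisfies $\pi(M_b(U))\supset E$.
   Context: $\mathcal P(E)$ is the space of all continuous polynomials on $E$ (with uniform convergence on bounded sets, i.e. norm convergence). Finite type polynomials are the elements of the algebra generated by the constants and $E'$. $E$ is regarded as a subspace of $E''$. A set $A\subset U$ is $U$-bounded if it is bounded and has positive distance to $E\setminus U$ (no distance condition if $U=E$). $H_b(U)$ is the Fréchet algebra of holomorphic functions on $U$ bounded on every $U$-bounded set, with the topology of uniform convergence on $U$-bounded sets. $M_b(U)$ is the set of nonzero continuous linear multiplicative functionals on $H_b(U)$, and $\pi:M_b(U)\to E''$ is $\pi(\varphi)=\varphi|_{E'}$. $U$ is $H_b(E)$-convex if for every $U$-bounded set $A$ the set $\widehat A_{H_b(E)}=\{x\in E:|f(x)|\le\sup_A|f|\ \forall f\in H_b(E)\}$ is $U$-bounded. Aron-Berner extension: for a continuous $k$-homogeneous polynomial $P$ on $E$ with symmetric $k$-linear form $L$, $\overline P(z)=\overline L(z,\dots,z)$ for $z\in E''$, where $\overline L(z_1,\dots,z_k)=\lim_{\alpha_1}\cdots\lim_{\alpha_k}L(x_{\alpha_1},\dots,x_{\alpha_k})$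 with $(x_{\alpha_i})\subset E$ nets converging weak-star to $z_i$; for $f\in H_b(E)$ with Taylor series $\sum_kP_k$ at $0$, $\overline f=\sum_k\overline{P_k}$. Define $$\overset{\vee}{U''}=\{z\in E'':\ \text{there is }\varphi\in M_b(U)\text{ with }\varphi(f)=\overline f(z)\text{ for every }f\in H_b(E)\}.$$ *)

(* Defs.v *)
From HB Require Import structures.
From mathcomp Require Import all_boot all_order all_algebra.
From mathcomp Require Import all_classical all_reals all_analysis.
From mathcomp Require Import perm complex.

Set Implicit Arguments.
Unset Strict Implicit.
Unset Printing Implicit Defensive.

Import Order.TTheory GRing.Theory Num.Theory.
Import numFieldNormedType.Exports.

Local Open Scope complex_scope.
Local Open Scope classical_set_scope.
Local Open Scope ring_scope.

(* The norm of a complex normed space takes its values in the nonnegative part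
   of [R[i]]; [rnorm] is the same norm as an element of [R]. *)
Section RealNorm.
Context {R : realType} {V : normedModType R[i]}.

Definition rnorm (x : V) : R := complex.Re `|x|.

Lemma rnormE x : (rnorm x)%:C = `|x|.
Proof. by rewrite /rnorm RRe_real. Qed.

Lemma rnorm_ge0 x : 0 <= rnorm x.
Proof. rewrite -lecR rnormE; exact: normr_ge0. Qed.

Lemma ler_rnormD x y : rnorm (x + y) <= rnorm x + rnorm y.
Proof. by rewrite -lecR rmorphD/= !rnormE ler_normD. Qed.

Lemma rnorm_eq0 x : rnorm x = 0 -> x = 0.
Proof. by move=> x0; apply/eqP; rewrite -normr_eq0 -rnormE x0. Qed.

End RealNorm.

(* The scalars are written [R[i]^o] when they are a codomain: this is the copy
   of [R[i]] that carries the normed space structure over [R[i]]. *)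
Section Dual.
Context {R : realType} (E : normedModType R[i]).

Definition dual_pred : {pred E -> R[i]^o} :=
  fun f => `[< linear f /\ continuous f >].

Lemma dual_predP {f : E -> R[i]^o} :
  reflect (linear f /\ continuous f) (f \in dual_pred).
Proof. exact: asboolP. Qed.

Lemma dual_submod : submod_closed dual_pred.
Proof.
split; first by apply/dual_predP; split=> [a u v|x];
  [rewrite /= scaler0 addr0 | exact: cst_continuous].
move=> a f g /dual_predP[lf cf] /dual_predP[lg cg]; apply/dual_predP; split.
  move=> b u v; rewrite !fctE lf lg/=.
  by rewrite !scalerDr !scalerA (mulrC a b) addrACA.
move=> x; apply: cvgD; last exact: cg.
by apply: cvgZr; exact: cf.
Qed.

HB.instance Definition _ :=
  GRing.isSubmodClosed.Build R[i] (E -> R[i]^o) dual_pred dual_submod.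

Record Dual := MkDual {
  dual_fun :> E -> R[i]^o;
  _ : dual_fun \in dual_pred }.

HB.instance Definition _ := [isSub for dual_fun].
HB.instance Definition _ := [Choice of Dual by <:].
HB.instance Definition _ := [SubChoice_isSubLmodule of Dual by <:].

Lemma dual_linear (f : Dual) : linear f.
Proof. by case: f => f fP; exact: (dual_predP fP).1. Qed.

HB.instance Definition _ (f : Dual) :=
  GRing.isLinear.Build R[i] E R[i]^o *:%R (dual_fun f) (dual_linear f).

Lemma dual_continuous (f : Dual) : continuous f.
Proof. by case: f => f fP; exact: (dual_predP fP).2. Qed.

Definition dual_norm (f : Dual) : R :=
  sup [set rnorm (f x) | x in [set x : E | rnorm x <= 1]].

Lemma dual_bounded (f : Dual) : exists M, forall x, rnorm (f x) <= M * rnorm x.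
Proof.
have := (linear_bounded_continuous (f : {linear E -> R[i]^o})).2
  (@dual_continuous f).
move=> /linear_boundedP/pinfty_ex_gt0[M M0 fM].
exists (complex.Re M) => x.
rewrite -lecR rmorphM/= !rnormE RRe_real ?gtr0_real//; exact: fM.
Qed.

Lemma dual_has_sup (f : Dual) :
  has_sup [set rnorm (f x) | x in [set x : E | rnorm x <= 1]].
Proof.
split; first by exists (rnorm (f 0)), 0; rewrite //= /rnorm normr0.
have [M fM] := dual_bounded f; exists (Num.max M 0) => _ [x x1 <-].
rewrite (le_trans (fM x))// (@le_trans _ _ (Num.max M 0 * rnorm x))//.
  by rewrite ler_wpM2r ?rnorm_ge0// le_max lexx.
by rewrite ler_piMr// le_max lexx orbT.
Qed.

Lemma dual_normP (f : Dual) x : rnorm (f x) <= dual_norm f * rnorm x.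
Proof.
have [->|x0] := eqVneq x 0.
  by rewrite linear0 /rnorm !normr0/= mulr0.
have nx0 : 0 < rnorm x.
  rewrite lt_neqAle rnorm_ge0 andbT eq_sym; apply: contra x0 => /eqP.
  by move=> /rnorm_eq0 ->.
rewrite -ler_pdivrMr//; apply: sup_upper_bound; first exact: dual_has_sup.
exists (((rnorm x)^-1)%:C *: x).
  rewrite /= -lecR rnormE normrZ -(rnormE x) normc_def/=.
  rewrite expr0n/= addr0 sqrtr_sqr ger0_norm ?invr_ge0 ?rnorm_ge0//.
  by rewrite -rmorphM/= mulVf ?gt_eqF.
apply: complexI; rewrite rnormE linearZ normrZ -(rnormE (f x)) normc_def/=.
rewrite expr0n/= addr0 sqrtr_sqr ger0_norm ?invr_ge0 ?rnorm_ge0//.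
by rewrite -rmorphM/= mulrC.
Qed.

Lemma dual_norm_le (f : Dual) M : 0 <= M ->
  (forall x, rnorm (f x) <= M * rnorm x) -> dual_norm f <= M.
Proof.
move=> M0 fM; apply: ge_sup; first by have [] := dual_has_sup f.
by move=> _ [x x1 <-]; rewrite (le_trans (fM x))// ler_piMr.
Qed.

Lemma dual_norm_ge0 f : 0 <= dual_norm f.
Proof.
apply: sup_upper_bound; first exact: dual_has_sup.
by exists 0; rewrite /= ?linear0 /rnorm normr0.
Qed.

Lemma ler_dual_normD (f g : Dual) :
  (dual_norm (f + g))%:C <= (dual_norm f)%:C + (dual_norm g)%:C.
Proof.
rewrite -rmorphD lecR; apply: dual_norm_le.
  by rewrite addr_ge0 ?dual_norm_ge0.
move=> x; rewrite (le_trans (ler_rnormD _ _))// mulrDl.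
by rewrite lerD ?dual_normP.
Qed.

Lemma dual_norm_eq0 (f : Dual) : (dual_norm f)%:C = 0 -> f = 0.
Proof.
case=> f0; apply: val_inj; apply/funext => x; apply: rnorm_eq0.
by apply/le_anti; rewrite rnorm_ge0 (le_trans (dual_normP f x))// f0 mul0r.
Qed.

Lemma dual_normZ (l : R[i]) (f : Dual) :
  (dual_norm (l *: f))%:C = `|l| * (dual_norm f)%:C.
Proof.
have le (k : R[i]) (g : Dual) :
    dual_norm (k *: g) <= rnorm (k : R[i]^o) * dual_norm g.
  apply: dual_norm_le; first by rewrite mulr_ge0 ?rnorm_ge0 ?dual_norm_ge0.
  move=> x; rewrite -mulrA.
  have -> : rnorm ((k *: g) x) = rnorm (k : R[i]^o) * rnorm (g x).
    by apply: complexI; rewrite rmorphM/= !rnormE -normrM.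
  by rewrite ler_wpM2l ?rnorm_ge0 ?dual_normP.
have -> : `|l| = (rnorm (l : R[i]^o))%:C by rewrite rnormE.
rewrite -rmorphM; congr _%:C; apply/le_anti; rewrite le.
have [->|l0] := eqVneq l 0.
  by rewrite {1}/rnorm normr0/= mul0r dual_norm_ge0.
have := le l^-1 (l *: f); rewrite scalerA mulVf// scale1r => H.
have l0' : 0 < rnorm (l : R[i]^o).
  by rewrite -ltcR rnormE normr_gt0.
rewrite -ler_pdivlMl//; apply: (le_trans H).
have -> : rnorm (l^-1 : R[i]^o) = (rnorm (l : R[i]^o))^-1.
  by apply: complexI; rewrite rnormE fmorphV/= rnormE normfV.
by [].
Qed.

HB.instance Definition _ := Lmodule_isNormed.Build R[i] Dual
  ler_dual_normD dual_normZ dual_norm_eq0.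

Lemma ler_dual_norm (f : Dual) (x : E) : `|f x| <= `|f| * `|x|.
Proof.
by rewrite -(rnormE x) -(rnormE (f x)) -rmorphM lecR dual_normP.
Qed.

End Dual.

Section Bidual.
Context {R : realType} {E : normedModType R[i]}.

Lemma evaluation_dual (x : E) :
  (fun f : Dual E => f x : R[i]^o) \in @dual_pred R (Dual E).
Proof.
apply/dual_predP; split; first by move=> a f g.
move=> f; apply/(@cvgrPdist_lt _ _ _ (nbhs f)) => e e0.
have x0 : 0 < `|x| + 1 by rewrite ltr_wpDl.
near=> g.
have -> : f x - g x = (f - g) x by [].
apply: (le_lt_trans (ler_dual_norm _ _)).
apply: (@le_lt_trans _ _ (`|f - g| * (`|x| + 1))).
  by rewrite ler_wpM2l// lerDl.
rewrite -ltr_pdivlMr//; near: g.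
by apply: cvgr_dist_lt; rewrite ?divr_gt0.
Unshelve. all: by end_near. Qed.

Definition bidual_emb (x : E) : Dual (Dual E) := MkDual (evaluation_dual x).

End Bidual.

Section ApproximationProperty.
Context {R : realType} (X : normedModType R[i]).

Definition finite_rank (T : X -> X) :=
  exists n (v : 'I_n -> X),
    forall x, exists c : 'I_n -> R[i], T x = \sum_(i < n) c i *: v i.

Definition approximation_property :=
  forall K : set X, compact K -> forall e : R, 0 < e ->
  exists T : {linear X -> X},
    [/\ continuous T, finite_rank T & forall x, K x -> rnorm (T x - x) < e].

End ApproximationProperty.

Section Polynomials.
Context {R : realType} (E : normedModType R[i]).

Definition multilinear k (L : ('I_k -> E) -> R[i]^o) :=
  forall (v : 'I_k -> E) (i : 'I_k),
    linear (fun x : E => L (fun j => if j == i then x else v j) : R[i]^o).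

Definition symmetric_form k (L : ('I_k -> E) -> R[i]^o) :=
  forall (s : 'S_k) (v : 'I_k -> E), L (v \o s) = L v.

Definition cont_sym_form k : set (('I_k -> E) -> R[i]^o) :=
  [set L | [/\ multilinear L, symmetric_form L
             & continuous (L : {ptws 'I_k -> E} -> R[i]^o)]].

Definition diagonal k (L : ('I_k -> E) -> R[i]^o) (x : E) : R[i]^o :=
  L (fun=> x).

Definition homogeneous_polynomial k : set (E -> R[i]^o) :=
  [set diagonal L | L in @cont_sym_form k].

Definition continuous_polynomial : set (E -> R[i]^o) :=
  [set P | exists n (Q : nat -> E -> R[i]^o),
    (forall k, homogeneous_polynomial k (Q k)) /\
    P = (fun x => \sum_(k < n) Q k x)].

Inductive finite_type_polynomial : (E -> R[i]^o) -> Prop :=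
| finite_type_cst (c : R[i]) : finite_type_polynomial (fun=> c)
| finite_type_dual (g : Dual E) : finite_type_polynomial g
| finite_type_add P Q : finite_type_polynomial P -> finite_type_polynomial Q ->
    finite_type_polynomial (fun x => P x + Q x)
| finite_type_mul P Q : finite_type_polynomial P -> finite_type_polynomial Q ->
    finite_type_polynomial (fun x => P x * Q x).

Definition finite_type_polynomials_dense :=
  (continuous_polynomial : set {family bounded_set, E -> R[i]^o}) `<=`
  closure (finite_type_polynomial : set {family bounded_set, E -> R[i]^o}).

End Polynomials.

Section BoundedType.
Context {R : realType} {E : normedModType R[i]}.
Implicit Types (U A : set E).

(* When [U] is the whole space the last condition is void. *)
Definition U_bounded U : set (set E) :=
  [set A | [/\ A `<=` U, bounded_set A
    & exists2 r : R, 0 < r &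
        forall a y, A a -> ~ U y -> r <= rnorm (a - y)]].

(* A function on the open set [U] is represented by any total function that
   extends it: only the values on [U] matter. *)
Definition Hb U : set (E -> R[i]^o) :=
  [set f | (forall x, U x -> differentiable f x) /\
           (forall A, U_bounded U A -> [bounded f x | x in A])].

(* [M_b(U)]. The topology used on [Hb U] does not separate functions that agree
   on [U], so continuity makes [phi f] depend on the restriction of [f] to [U]
   only. *)
Definition Mb U : set ((E -> R[i]^o) -> R[i]^o) :=
  [set phi | [/\
     forall (c : R[i]) f g, Hb U f -> Hb U g ->
       phi (fun x => c * f x + g x) = c * phi f + phi g,
     forall f g, Hb U f -> Hb U g -> phi (fun x => f x * g x) = phi f * phi g,
     exists2 f, Hb U f & phi f != 0
   & {within (Hb U : set {family U_bounded U, E -> R[i]^o}),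
       continuous (phi : {family U_bounded U, E -> R[i]^o} -> R[i]^o)}]].

(* [pi(M_b(U))], where [pi(phi)] is the restriction of [phi] to the dual. *)
Definition pi_Mb U : set (Dual (Dual E)) :=
  [set z | exists2 phi, Mb U phi & forall g : Dual E, z g = phi g].

Definition Hb_hull A : set E :=
  [set x | forall f, Hb setT f ->
    rnorm (f x) <= sup [set rnorm (f a) | a in A]].

Definition Hb_convex U := forall A, U_bounded U A -> U_bounded U (Hb_hull A).

End BoundedType.

Section AronBerner.
Context {R : realType} {E : normedModType R[i]}.
Implicit Type z : Dual (Dual E).

(* A net in [E] converges weak-star to [z] in the bidual exactly when its filter
   of tails is finer than this filter, the trace on [E] of the weak-star
   neighbourhoods of [z]. *)
Definition weak_star_nbhs z : set_system E :=
  filter_from (nbhs ((z : Dual E -> R[i]^o) : {ptws Dual E -> R[i]^o}))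
    (fun B => [set x | B (bidual_emb x : Dual E -> R[i]^o)]).

(* [iterated_lim F [:: z1; ...; zk]] is the limit as [x1] tends to [z1] of ...
   of the limit as [xk] tends to [zk] of [F [:: x1; ...; xk]]. *)
Fixpoint iterated_lim (F : seq E -> R[i]^o) (zs : seq (Dual (Dual E))) :
    R[i]^o :=
  if zs is z :: zs' then
    lim ((fun x => iterated_lim (fun s => F (x :: s)) zs') @ weak_star_nbhs z)
  else F [::].

Definition bidual_form k (L : ('I_k -> E) -> R[i]^o)
    (z : 'I_k -> Dual (Dual E)) : R[i]^o :=
  iterated_lim (fun s => L (fun i => nth 0 s i)) [seq z i | i <- enum 'I_k].

(* [L k] is the symmetric form of the [k]-th term of the Taylor series of [f]
   at 0. *)
Definition taylor_forms (f : E -> R[i]^o)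
    (L : forall k, ('I_k -> E) -> R[i]^o) :=
  (forall k, cont_sym_form (L k)) /\
  exists2 r : R, 0 < r &
    {uniform [set x : E | rnorm x < r],
      (fun n (x : E) => \sum_(k < n) diagonal (L k) x) @ \oo --> f}.

(* The Aron-Berner extension of [f] takes the value [w] at [z]. *)
Definition aron_berner_value (f : E -> R[i]^o) z (w : R[i]^o) :=
  exists2 L : forall k, ('I_k -> E) -> R[i]^o, taylor_forms f L &
    series (fun k => bidual_form (L k) (fun=> z)) @ \oo --> w.

Definition U_check (U : set E) : set (Dual (Dual E)) :=
  [set z | exists2 phi, Mb U phi &
    forall f, Hb setT f -> aron_berner_value f z (phi f)].

End AronBerner.

(* Main.v *)
Require Import Defs.
From HB Require Import structures.
From mathcomp Require Import all_boot all_order all_algebra.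
From mathcomp Require Import all_classical all_reals all_analysis.
From mathcomp Require Import complex perm ring lra.
Set Implicit Arguments.
Unset Strict Implicit.
Unset Printing Implicit Defensive.
Import Order.TTheory GRing.Theory Num.Theory.
Import numFieldNormedType.Exports.
Local Open Scope complex_scope.
Local Open Scope classical_set_scope.
Local Open Scope ring_scope.

(**
Let [phi] be a continuous homomorphism on [Hb U] and [z] its restriction to the
dual. If finite type polynomials are dense, [phi] agrees on every continuous
homogeneous polynomial with the Aron-Berner extension at [z], since both are
continuous in the polynomial and multiplicative on products of functionals
([Mb_form]). Summing Taylor series, which converge uniformly on bounded sets,
gives the same for all functions of bounded type on [E], so that [z] belongs to
[U_check U] ([pi_Mb_sub_U_check]). The opposite inclusion holds for every [U],
because the extension of a functional [g] takes the value [z g] at [z]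
([U_check_sub_pi_Mb]).

Suppose that finite type polynomials are not dense. Then some continuous
homogeneous polynomial is not weakly continuous at the origin on bounded sets.
Otherwise every symmetric form [F] would be small as soon as one of its
arguments is weakly small and the others stay bounded ([unif_all]), so that the
functionals [F (., s)] with [s] in a ball would lie in a compact set of the dual
([equi_compact]). An operator of finite rank that moves this set only a little
replaces [F] by a sum of products of functionals with forms of lower degree, and
induction on the degree makes all polynomials approximable ([dense_of_wsc]).

Let [P] be such a polynomial of minimal degree [n]. The set [U] on which the
modulus of [P] is smaller than [1] is proper, open and [Hb]-convex
([sublevel_convex]). There is an ultrafilter along which [w] stays bounded and
tends weakly to [0] while [P w] tends to some [p] different from [0]. For a
point [x] of [E] take [t] with [t ^+ n = - P x / p]. In the expansion of
[P (x + t w)] the terms of intermediate degree tend to [0] by minimality of [n],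
so [P (x + t w)] tends to [P x + t ^+ n * p = 0]. Hence [x + t w] eventually
stays in a [U]-bounded set, and the limit of [f (x + t w)] along the ultrafilter
is a homomorphism on [Hb U] that lies over [x] ([sublevel_all]). This is the last
assertion. It contradicts the third condition, because [U_check U] meets [E] in
[U] only: if [phi f = f x] for all [f] of bounded type on [E], then [x] is in the
hull of the [U]-bounded set that controls [phi] ([U_check_emb]).

The analysis behind this is one-dimensional. Integrals along segments are limits
of dyadic Riemann sums; Goursat's theorem for parallelograms, applied to
functions composed with the exponential, yields Taylor expansions with Cauchy
estimates ([goursat], [taylor_disc]). On a normed space it suffices to look at
complex lines: directional derivatives and Taylor terms are coefficients of the
restrictions to lines, they are again of bounded type ([gol_ccoef]), and
iterating directional derivatives produces the symmetric forms of the Taylor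
terms ([taylor_term_form]).
*)

(** * Moduli and norms with values in the real numbers *)
Notation modc z := (@rnorm _ (_[i]^o) z).

Section Modulus.
Context {R : realType}.
Implicit Types (z w : R[i]) (x y : R).

Lemma modcE z : (modc z)%:C = `|z|.
Proof. exact: (@rnormE R R[i]^o). Qed.

Lemma modcM z w : modc (z * w) = modc z * modc w.
Proof. by apply: complexI; rewrite rmorphM !modcE normrM. Qed.

Lemma modc1 : modc (1 : R[i]) = 1.
Proof. by apply: complexI; rewrite modcE normr1. Qed.

Lemma modcX z n : modc (z ^+ n) = modc z ^+ n.
Proof. by apply: complexI; rewrite rmorphXn modcE normrX -modcE. Qed.

Lemma modcV z : modc z^-1 = (modc z)^-1.
Proof. by apply: complexI; rewrite fmorphV !modcE normfV. Qed.

Lemma modc_div z w : modc (z / w) = modc z / modc w.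
Proof. by rewrite modcM modcV. Qed.

Lemma modcR x : modc (x%:C) = `|x|.
Proof.
by apply: complexI; rewrite modcE normc_def/= expr0n/= addr0 sqrtr_sqr.
Qed.

Lemma modc_nat n : modc (n%:R : R[i]) = n%:R.
Proof. by rewrite -(rmorph_nat (real_complex R)) modcR ger0_norm. Qed.

Lemma Re_le_modc z : `|complex.Re z| <= modc z.
Proof. by rewrite -lecR modcE normc_ge_Re. Qed.

Lemma modc_sqr z : modc z ^+ 2 = complex.Re z ^+ 2 + complex.Im z ^+ 2.
Proof. by apply: complexI; rewrite rmorphXn/= modcE add_Re2_Im2. Qed.

Lemma Im_le_modc z : `|complex.Im z| <= modc z.
Proof.
rewrite -ler_sqr ?nnegrE ?rnorm_ge0// real_normK ?num_real// modc_sqr.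
by rewrite lerDr sqr_ge0.
Qed.

Lemma modc_le z : modc z <= `|complex.Re z| + `|complex.Im z|.
Proof.
rewrite -ler_sqr ?nnegrE ?rnorm_ge0 ?addr_ge0// modc_sqr.
rewrite sqrrD !real_normK ?num_real//.
by rewrite lerD2r lerDl mulrn_wge0// mulr_ge0.
Qed.
End Modulus.

Section RNorm.
Context {R : realType} {V : normedModType R[i]}.
Implicit Types (u v : V).

Lemma rnorm0 : rnorm (0 : V) = 0.
Proof. by rewrite /rnorm normr0. Qed.

Lemma rnormN u : rnorm (- u) = rnorm u.
Proof. by rewrite /rnorm normrN. Qed.

Lemma rnormBC u v : rnorm (u - v) = rnorm (v - u).
Proof. by rewrite /rnorm distrC. Qed.

Lemma rnormZ (a : R[i]) u : rnorm (a *: u) = modc a * rnorm u.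
Proof. by apply: complexI; rewrite rmorphM/= !rnormE normrZ. Qed.

Lemma ler_rnormB u v : rnorm (u - v) <= rnorm u + rnorm v.
Proof. by rewrite -[leRHS](congr1 (+%R _) (rnormN v)) ler_rnormD. Qed.

Lemma ler_rnorm_dist u v : rnorm u <= rnorm v + rnorm (u - v).
Proof. by rewrite -{1}(subrK v u) addrC ler_rnormD. Qed.

Lemma ler_rnorm_distD w u v : rnorm (u - v) <= rnorm (u - w) + rnorm (w - v).
Proof. by rewrite (_ : u - v = (u - w) + (w - v)) ?ler_rnormD// addrA subrK. Qed.

Lemma ler_rnorm_sum I (r : seq I) (P : pred I) (f : I -> V) :
  rnorm (\sum_(i <- r | P i) f i) <= \sum_(i <- r | P i) rnorm (f i).
Proof.
elim/big_ind2: _ => //; first by rewrite rnorm0.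
by move=> x1 x2 y1 y2 h1 h2; rewrite (le_trans (ler_rnormD _ _))// lerD.
Qed.

Lemma rnorm_gt0 u : (0 < rnorm u) = (u != 0).
Proof.
rewrite lt_neqAle rnorm_ge0 andbT eq_sym; congr (~~ _).
by apply/eqP/eqP => [/rnorm_eq0|->] //; rewrite rnorm0.
Qed.

(** Neighbourhood filters are indexed by positive elements of the ordered field
    of scalars; since these are real, real radii suffice. *)
Lemma cvg_rnormP (F : set_system V) (FF : Filter F) (l : V) :
  F --> l <-> forall e : R, 0 < e -> \forall x \near F, rnorm (l - x) < e.
Proof.
split=> [/(@cvgrPdist_lt _ _ _ F FF) Fl e e0|Fl].
  have := Fl e%:C; rewrite ltcR => /(_ e0); apply: filterS => x.
  by rewrite -rnormE ltcR.
apply/(@cvgrPdist_lt _ _ _ F FF) => e e0.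
have er : (complex.Re e)%:C = e by rewrite RRe_real ?gtr0_real.
have := Fl (complex.Re e); rewrite -ltcR er => /(_ e0).
by apply: filterS => x; rewrite -rnormE -er ltcR.
Qed.

Lemma nbhs_rnormP (x : V) (B : set V) :
  nbhs x B <-> exists2 e : R, 0 < e & forall y, rnorm (x - y) < e -> B y.
Proof.
split=> [/nbhs_ballP[e/= e0 eB]|[e e0 eB]].
  have er : (complex.Re e)%:C = e by rewrite RRe_real ?gtr0_real.
  exists (complex.Re e); first by rewrite -ltcR er.
  by move=> y xy; apply: eB; rewrite -ball_normE/= -rnormE -er ltcR.
apply/nbhs_ballP; exists e%:C; first by rewrite /= ltcR.
by move=> y; rewrite -ball_normE/= -rnormE ltcR => /eB.
Qed.
End RNorm.

Section ModulusNorm.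
Context {R : realType}.
Implicit Types (z w : R[i]).

Lemma modc0 : modc (0 : R[i]) = 0.
Proof. exact: (@rnorm0 R R[i]^o). Qed.

Lemma modcN z : modc (- z) = modc z.
Proof. exact: (@rnormN R R[i]^o). Qed.

Lemma modcBC z w : modc (z - w) = modc (w - z).
Proof. exact: (@rnormBC R R[i]^o). Qed.

Lemma ler_modcD z w : modc (z + w) <= modc z + modc w.
Proof. exact: (@ler_rnormD R R[i]^o). Qed.

Lemma ler_modcB z w : modc (z - w) <= modc z + modc w.
Proof. exact: (@ler_rnormB R R[i]^o). Qed.

Lemma ler_modc_dist z w : modc z <= modc w + modc (z - w).
Proof. exact: (@ler_rnorm_dist R R[i]^o). Qed.

Lemma ler_modc_distD t z w : modc (z - w) <= modc (z - t) + modc (t - w).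
Proof. exact: (@ler_rnorm_distD R R[i]^o). Qed.

Lemma ler_modc_sum I (r : seq I) (P : pred I) (f : I -> R[i]) :
  modc (\sum_(i <- r | P i) f i) <= \sum_(i <- r | P i) modc (f i).
Proof. exact: (@ler_rnorm_sum R R[i]^o). Qed.

Lemma modc_ge0 z : 0 <= modc z.
Proof. exact: (@rnorm_ge0 R R[i]^o). Qed.

Lemma modc_gt0 z : (0 < modc z) = (z != 0).
Proof. exact: (@rnorm_gt0 R R[i]^o). Qed.

Lemma modc_eq0 z : modc z = 0 -> z = 0.
Proof. exact: (@rnorm_eq0 R R[i]^o). Qed.

End ModulusNorm.

(** * Limits along ultrafilters *)
Section UltraLimits.
Context {R : realType}.

(** Compactness of bounded sets of scalars; ultrafilters serve below wherever a
    convergent subsequence or subnet has to be chosen. *)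
Lemma ultra_lim_real T (G : set_system T) (GU : UltraFilter G) (f : T -> R) M :
  G [set t | `|f t| <= M] ->
  exists l, forall e, 0 < e -> G [set t | `|f t - l| < e].
Proof.
move=> GM; have GP : ProperFilter G by exact: ultra_proper.
have FP : ProperFilter (f @ G) by exact: fmap_proper_filter.
have [|l [_ cl]] := @segment_compact R (- M) M _ FP.
  by apply: filterS GM => t h; rewrite /= in_itv/= -ler_norml; exact: h.
exists l => e e0.
have [//|Gn] := in_ultra_setVsetC [set t | `|f t - l| < e] GU.
have := cl [set y | ~ (`|y - l| < e)] (ball l e) Gn (nbhsx_ballx _ _ e0).
by case=> y [/= + yl]; rewrite distrC.
Qed.

Lemma ultra_lim T (G : set_system T) (GU : UltraFilter G) (f : T -> R[i]) M :
  G [set t | modc (f t) <= M] ->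
  exists l, forall e, 0 < e -> G [set t | modc (f t - l) < e].
Proof.
move=> GM; have GP : ProperFilter G by exact: ultra_proper.
have [|a aP] := @ultra_lim_real _ _ GU (fun t => complex.Re (f t)) M.
  by apply: filterS GM => t /=; exact: le_trans (Re_le_modc _).
have [|b bP] := @ultra_lim_real _ _ GU (fun t => complex.Im (f t)) M.
  by apply: filterS GM => t /=; exact: le_trans (Im_le_modc _).
exists (a +i* b) => e e0; have e2 : 0 < e / 2 by rewrite divr_gt0.
apply: filterS (filterI (aP _ e2) (bP _ e2)) => t /= [].
case: (f t) => x y /= xa yb; rewrite (le_lt_trans (modc_le _))//=.
by rewrite [e]splitr ltrD.
Qed.

End UltraLimits.

(** * Continuous and differentiable functions of a complex variable *)
Section ComplexVariable.
Context {R : realType}.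
Local Notation C := R[i].
Implicit Types (f g : C -> C) (z w p u v : C).

Definition ccont f := forall z (e : R), 0 < e ->
  exists2 d : R, 0 < d & forall w, modc (w - z) < d -> modc (f w - f z) < e.

Definition cdiff f z := exists c : C, forall e : R, 0 < e ->
  exists2 d : R, 0 < d & forall h, modc h < d ->
    modc (f (z + h) - f z - c * h) <= e * modc h.

Lemma ccontD f g : ccont f -> ccont g -> ccont (fun z => f z + g z).
Proof.
move=> cf cg z e e0; have e2 : 0 < e / 2 by rewrite divr_gt0.
have [d d0 df] := cf z _ e2; have [d' d'0 dg] := cg z _ e2.
exists (Num.min d d'); first by rewrite lt_min d0.
move=> w; rewrite lt_min => /andP[/df h1 /dg h2].
rewrite opprD addrACA (le_lt_trans (ler_modcD _ _))//.
by rewrite [e]splitr ltrD.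
Qed.

Lemma ccont_cst z0 : ccont (fun=> z0).
Proof. by move=> z e e0; exists 1 => // w _; rewrite subrr modc0. Qed.

Lemma ccont_id : ccont id.
Proof. by move=> z e e0; exists e. Qed.

Lemma ccontM f g : ccont f -> ccont g -> ccont (fun z => f z * g z).
Proof.
move=> cf cg z e e0.
pose M : R := modc (f z) + modc (g z) + 1.
have M0 : 0 < M by rewrite ltr_wpDl ?addr_ge0 ?modc_ge0.
have e2 : 0 < e / (2 * M) by rewrite divr_gt0 ?mulr_gt0.
have [d d0 df] := cf z _ e2; have [d' d'0 dg] := cg z _ e2.
have [d1 d10 dg1] := cg z _ ltr01.
exists (Num.min d (Num.min d' d1)); first by rewrite !lt_min d0 d'0.
move=> w; rewrite !lt_min => /and3P[/df h1 /dg h2 /dg1 h3].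
have -> : f w * g w - f z * g z = (f w - f z) * g w + f z * (g w - g z) by ring.
rewrite (le_lt_trans (ler_modcD _ _))// !modcM.
have gw : modc (g w) <= M.
  rewrite (le_trans (ler_modc_dist _ (g z)))// /M.
  have := modc_ge0 (f z); move: (ltW h3); lra.
have fz : modc (f z) <= M.
  by rewrite /M -addrA lerDl addr_ge0 ?modc_ge0.
have -> : e = e / (2 * M) * M + M * (e / (2 * M)) by field; rewrite gt_eqF.
apply: ltr_leD.
  apply: (le_lt_trans (ler_wpM2l (modc_ge0 _) gw)).
  by rewrite ltr_pM2r.
by apply: ler_pM; rewrite ?modc_ge0//; exact: ltW.
Qed.

Lemma ccontZ (a : C) f : ccont f -> ccont (fun z => a * f z).
Proof. by move=> cf; apply: ccontM => //; exact: ccont_cst. Qed.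

Lemma ccont_comp f g : ccont f -> ccont g -> ccont (f \o g).
Proof.
move=> cf cg z e e0; have [d d0 df] := cf (g z) _ e0.
by have [d' d'0 dg] := cg z _ d0; exists d' => // w /dg/df.
Qed.

Lemma ccontX f n : ccont f -> ccont (fun z => f z ^+ n).
Proof.
move=> cf; elim: n => [|n ih].
  by under eq_fun do rewrite expr0; exact: ccont_cst.
by under eq_fun do rewrite exprS; exact: ccontM.
Qed.

Lemma cdiff_ccont f : (forall z, cdiff f z) -> ccont f.
Proof.
move=> df z e e0; have [c cP] := df z.
have [d d0 dP] := cP _ ltr01.
have M0 : 0 < modc c + 1 by rewrite ltr_wpDl ?modc_ge0.
exists (Num.min d (e / (modc c + 1))); first by rewrite lt_min d0 divr_gt0.
move=> w; rewrite lt_min ltr_pdivlMr// => /andP[/dP].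
rewrite (addrC z) subrK mul1r => h1 h2.
have -> : f w - f z = (f w - f z - c * (w - z)) + c * (w - z) by rewrite subrK.
apply: le_lt_trans h2; rewrite (le_trans (ler_modcD _ _))// modcM.
by rewrite [leRHS]mulrDr mulr1 [leRHS]addrC lerD// mulrC.
Qed.

(** Continuous functions are uniformly continuous on discs: a sequence of
    counterexamples would have a limit along an ultrafilter. *)
Lemma ccont_uniform f M e : ccont f -> 0 < e -> exists2 d : R, 0 < d &
  forall z w, modc z <= M -> modc w <= M -> modc (z - w) < d ->
    modc (f z - f w) < e.
Proof.
move=> cf e0; apply: contrapT => nd.
have ex (n : nat) : exists q : C * C, [/\ modc q.1 <= M, modc q.2 <= M,
    modc (q.1 - q.2) < n.+1%:R^-1 & e <= modc (f q.1 - f q.2)].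
  apply: contrapT => nq; apply: nd; exists n.+1%:R^-1; first by rewrite invr_gt0.
  move=> z w zM wM zw; rewrite ltNge; apply/negP => he.
  by apply: nq; exists (z, w).
have [q qP] := choice ex.
have [G [GU sG]] := ultraFilterLemma (@eventually_filter).
have GP : ProperFilter G by exact: ultra_proper.
have [|l lP] := @ultra_lim _ _ _ GU (fun n => (q n).1) M.
  by apply: filterE => n /=; have [] := qP n.
have e2 : 0 < e / 2 by rewrite divr_gt0.
have [d d0 dP] := cf l _ e2.
have d2 : 0 < d / 2 by rewrite divr_gt0.
have Gn : G [set n : nat | n.+1%:R^-1 < d / 2].
  apply: sG; exists (Num.truncn (d / 2)^-1) => // n /= dn.
  rewrite -[ltRHS]invrK ltf_pV2 ?posrE ?invr_gt0//.
  by rewrite (lt_le_trans (Num.Theory.truncnS_gt _))// ler_nat ltnS.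
have [n [/= h1 h2]] := filter_ex (filterI (lP _ d2) Gn).
have [_ _ h3 h4] := qP n.
have h5 : modc ((q n).1 - l) < d by rewrite (lt_le_trans h1)// ler_pdivrMr// ler_pMr// ler1n.
have h6 : modc ((q n).2 - l) < d.
  rewrite (le_lt_trans (ler_modc_distD (q n).1 _ _))// [d]splitr ltrD//.
  by rewrite modcBC (lt_trans h3).
have := dP _ h5; have := dP _ h6 => h7 h8.
have : modc (f (q n).1 - f (q n).2) < e.
  rewrite (le_lt_trans (ler_modc_distD (f l) _ _))// [e]splitr ltrD//.
  by rewrite modcBC.
by rewrite ltNge h4.
Qed.

Lemma ccont_bounded f M : ccont f ->
  exists K : R, forall z, modc z <= M -> modc (f z) <= K.
Proof.
move=> cf; apply: contrapT => nK.
have ex (n : nat) : exists z, modc z <= M /\ n%:R < modc (f z).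
  apply: contrapT => nz; apply: nK; exists n%:R => z zM.
  by rewrite leNgt; apply/negP => h; apply: nz; exists z.
have [z zP] := choice ex.
have [G [GU sG]] := ultraFilterLemma (@eventually_filter).
have GP : ProperFilter G by exact: ultra_proper.
have [|l lP] := @ultra_lim _ _ _ GU z M.
  by apply: filterE => n /=; have [] := zP n.
have [d d0 dP] := cf l _ ltr01.
have Gn : G [set n : nat | modc (f l) + 1 < n%:R].
  apply: sG; exists (Num.truncn (modc (f l) + 1)).+1 => // n /= dn.
  by rewrite (lt_le_trans (truncnS_gt _))// ler_nat.
have [n [/= /dP h1 h2]] := filter_ex (filterI (lP _ d0) Gn).
have [_ h3] := zP n; have := ler_modc_dist (f (z n)) (f l).
lra.
Qed.

End ComplexVariable.

(** * Mean values over segments *)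
Section SegmentMean.
Context {R : realType}.
Local Notation C := R[i].
Implicit Types (f g : C -> C) (z w p u v : C).

Lemma ex_pow2_lt (M e : R) : 0 < e -> exists n, M / 2 ^+ n < e.
Proof.
move=> e0; exists (Num.truncn (M / e)).
rewrite ltr_pdivrMr ?exprn_gt0// mulrC -ltr_pdivrMr//.
rewrite (lt_le_trans (truncnS_gt _))// -natrX ler_nat.
exact: ltn_expl.
Qed.

(** Riemann sums over the dyadic subdivisions of the segment from [p] to
    [p + u]. The recursive form makes them additive under bisection of the
    segment, which is all that Goursat's theorem asks of an integral. *)
Fixpoint ravg n f p u : C :=
  if n is m.+1 then (ravg m f p (u / 2) + ravg m f (p + u / 2) (u / 2)) / 2
  else f p.

Definition avg f p u : C := lim ((fun n => ravg n f p u : R[i]^o) @ \oo).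

Lemma ravgD n f g p u :
  ravg n (fun z => f z + g z) p u = ravg n f p u + ravg n g p u.
Proof.
elim: n p u => //= n ih p u; rewrite !ih; field.
by rewrite ?pnatr_eq0.
Qed.

Lemma ravgZ n a f p u : ravg n (fun z => a * f z) p u = a * ravg n f p u.
Proof.
elim: n p u => //= n ih p u; rewrite !ih; field.
by rewrite ?pnatr_eq0.
Qed.

Lemma ravg_cst n a p u : ravg n (fun=> a) p u = a.
Proof.
elim: n p u => //= n ih p u; rewrite !ih; field.
by rewrite ?pnatr_eq0.
Qed.

Lemma ravg_shift n f p u v : ravg n f (p + v) u = ravg n (fun z => f (z + v)) p u.
Proof. by elim: n p u => //= n ih p u; rewrite -!ih addrAC. Qed.

Lemma modc2 : modc (2 : C) = 2. Proof. exact: modc_nat. Qed.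

Lemma half_bound a b (M : R) : modc a <= M -> modc b <= M -> modc ((a + b) / 2) <= M.
Proof.
move=> aM bM; rewrite modc_div modc2 ler_pdivrMr// mulr_natr mulr2n.
by rewrite (le_trans (ler_modcD _ _))// lerD.
Qed.

Lemma seg_left (P : C -> Prop) p u :
  (forall t : R, 0 <= t <= 1 -> P (p + t%:C * u)) ->
  (forall t : R, 0 <= t <= 1 -> P (p + t%:C * (u / 2))).
Proof.
move=> h t /andP[t0 t1].
have -> : t%:C * (u / 2) = (t / 2)%:C * u.
  by rewrite rmorphM fmorphV rmorph_nat/=; ring.
by apply: h; rewrite divr_ge0//= ler_pdivrMr// mul1r (le_trans t1)// ler1n.
Qed.

Lemma seg_right (P : C -> Prop) p u :
  (forall t : R, 0 <= t <= 1 -> P (p + t%:C * u)) ->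
  (forall t : R, 0 <= t <= 1 -> P ((p + u / 2) + t%:C * (u / 2))).
Proof.
move=> h t /andP[t0 t1].
have -> : p + u / 2 + t%:C * (u / 2) = p + ((1 + t) / 2)%:C * u.
  by rewrite rmorphM fmorphV rmorph_nat/= rmorphD/= rmorph1; ring.
apply: h; rewrite divr_ge0 ?addr_ge0//= ler_pdivrMr// mul1r.
by rewrite -[leRHS]/(1 + 1) lerD2l.
Qed.

Lemma ravg_bound n f p u (M : R) :
  (forall t : R, 0 <= t <= 1 -> modc (f (p + t%:C * u)) <= M) ->
  modc (ravg n f p u) <= M.
Proof.
elim: n p u => [|n ih] p u h /=.
  by have := h 0; rewrite mul0r addr0; apply; rewrite lexx ler01.
apply: half_bound; apply: ih.
  exact: (@seg_left (fun z => modc (f z) <= M)).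
exact: (@seg_right (fun z => modc (f z) <= M)).
Qed.

(** Each term of the finer sum is compared with the value at the left end of the
    piece of length [modc u / 2 ^+ n] to which it belongs. *)
Lemma ravg_cauchy f M e n m p u :
  (forall z w, modc z <= M -> modc w <= M -> modc (z - w) <= modc u / 2 ^+ n ->
     modc (f z - f w) <= e) ->
  modc p + modc u <= M ->
  modc (ravg (n + m) f p u - ravg n f p u) <= e.
Proof.
elim: n p u => [|n ih] p u h pu.
  have -> : ravg (0 + m) f p u - ravg 0 f p u = ravg m (fun z => f z - f p) p u.
    by rewrite (ravgD m f (fun=> - f p)) (ravg_cst _ (- f p)) add0n.
  apply: ravg_bound => t /andP[t0 t1]; apply: h.
  - rewrite (le_trans (ler_modcD _ _))// (le_trans _ pu)// lerD2l modcM modcR.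
    by rewrite ger0_norm// ler_piMl ?modc_ge0.
  - by rewrite (le_trans _ pu)// lerDl modc_ge0.
  - rewrite [p + _]addrC addrK expr0 divr1 modcM modcR.
    by rewrite ger0_norm// ler_piMl ?modc_ge0.
rewrite addSn /=.
have -> : forall a b c d : C, (a + b) / 2 - (c + d) / 2 = ((a - c) + (b - d)) / 2.
  by move=> a b c d; field; rewrite ?pnatr_eq0.
have u2 : modc (u / 2) = modc u / 2 by rewrite modc_div modc2.
have h' z w : modc z <= M -> modc w <= M ->
    modc (z - w) <= modc (u / 2) / 2 ^+ n -> modc (f z - f w) <= e.
  by rewrite u2 => zM wM hz; apply: h => //; rewrite exprS invfM mulrA.
apply: half_bound; apply: ih => //; rewrite u2.
  rewrite (le_trans _ pu)// lerD2l ler_pdivrMr// ler_peMr ?modc_ge0//.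
  by rewrite ler1n.
rewrite (le_trans _ pu)// [leRHS](_ : _ = modc p + modc u / 2 + modc u / 2).
  by rewrite lerD2r (le_trans (ler_modcD _ _))// u2.
by rewrite -addrA -splitr.
Qed.

Lemma avg_cvg f p u : ccont f ->
  ((fun n => ravg n f p u : R[i]^o) @ \oo) --> (avg f p u : R[i]^o).
Proof.
move=> cf; pose M := modc p + modc u.
have cau (e : R) : 0 < e -> exists n, forall m,
    modc (ravg (n + m) f p u - ravg n f p u) <= e.
  move=> e0; have [d d0 dP] := ccont_uniform M cf e0.
  have [n nP] := ex_pow2_lt (modc u) d0; exists n => m.
  apply: (@ravg_cauchy _ M) => // z w zM wM zw.
  by apply: ltW; apply: dP => //; apply: le_lt_trans nP.
have [G [GU sG]] := ultraFilterLemma (@eventually_filter).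
have GP : ProperFilter G by exact: ultra_proper.
have [n0 n0P] := cau 1 ltr01.
have [|l lP] := @ultra_lim _ _ _ GU (fun n => ravg n f p u) (modc (ravg n0 f p u) + 1).
  apply: sG; exists n0 => // n /= nn.
  rewrite (le_trans (ler_modc_dist _ (ravg n0 f p u)))// lerD2l.
  by rewrite -(subnKC nn).
have : ((fun n => ravg n f p u : R[i]^o) @ \oo) --> (l : R[i]^o).
  apply/(@cvg_rnormP R R[i]^o) => e e0.
  have e3 : 0 < e / 3 by rewrite divr_gt0.
  have [n nP] := cau _ e3.
  have [k [/= kl kn]] := filter_ex (filterI (lP _ e3) (sG _ (nbhs_infty_ge n))).
  exists n => // m /= nm.
  apply: (le_lt_trans (ler_modc_distD (ravg k f p u) _ _)).
  have h1 : modc (ravg k f p u - ravg m f p u) <= e / 3 + e / 3.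
    apply: (le_trans (ler_modc_distD (ravg n f p u) _ _)); apply: lerD.
      by rewrite -(subnKC kn).
    by rewrite modcBC -(subnKC nm).
  rewrite modcBC (lt_le_trans (ltr_leD kl h1))//; lra.
by move=> /cvgP.
Qed.

Lemma avg_lim f p u l : ccont f ->
  ((fun n => ravg n f p u : R[i]^o) @ \oo) --> (l : R[i]^o) -> avg f p u = l.
Proof. by move=> cf; apply: cvg_unique => //; exact: avg_cvg. Qed.

Lemma avgD f g p u : ccont f -> ccont g ->
  avg (fun z => f z + g z) p u = avg f p u + avg g p u.
Proof.
move=> cf cg; apply: avg_lim; first exact: ccontD.
under eq_fun do rewrite ravgD.
by apply: (@cvgD _ R[i]^o); exact: avg_cvg.
Qed.

Lemma avgZ a f p u : ccont f -> avg (fun z => a * f z) p u = a * avg f p u.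
Proof.
move=> cf; apply: avg_lim; first exact: ccontZ.
under eq_fun do rewrite ravgZ.
by apply: (@cvgZr _ R[i]^o); exact: avg_cvg.
Qed.

Lemma avg_cst a p u : avg (fun=> a) p u = a.
Proof.
apply: avg_lim; first exact: ccont_cst.
by under eq_fun do rewrite ravg_cst; exact: cvg_cst.
Qed.

Lemma avg_shift f p u v : avg f (p + v) u = avg (fun z => f (z + v)) p u.
Proof. by rewrite /avg; under eq_fun do rewrite ravg_shift. Qed.

Lemma avg_split f p u : ccont f ->
  avg f p u = (avg f p (u / 2) + avg f (p + u / 2) (u / 2)) / 2.
Proof.
move=> cf; rewrite [RHS]mulrC; apply: avg_lim => //.
rewrite -(cvg_shiftS (fun n => ravg n f p u : R[i]^o)) /=.
under eq_fun do rewrite mulrC.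
apply: (@cvgZr _ R[i]^o); apply: (@cvgD _ R[i]^o); exact: avg_cvg.
Qed.

Lemma avg_bound f p u (M : R) : ccont f ->
  (forall t : R, 0 <= t <= 1 -> modc (f (p + t%:C * u)) <= M) ->
  modc (avg f p u) <= M.
Proof.
move=> cf h; apply/ler_addgt0Pr => e e0.
have /(@cvg_rnormP R R[i]^o) /(_ e e0) [n _ /(_ n (leqnn n))/= nP] := @avg_cvg f p u cf.
rewrite (le_trans (ler_modc_dist _ (ravg n f p u)))// lerD ?ravg_bound//.
exact: ltW.
Qed.

End SegmentMean.

(** * Goursat's theorem for parallelograms *)
Section Goursat.
Context {R : realType}.
Local Notation C := R[i].
Implicit Types (f g : C -> C) (z w p u v : C).

(** The integral of [f] along the boundary of the parallelogram with corner [p]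
    and sides [u] and [v]. *)
Definition par f p u v : C :=
  u * avg f p u + v * avg f (p + u) v - u * avg f (p + v) u - v * avg f p v.

Lemma par_split f p u v : ccont f -> par f p u v =
  par f p (u / 2) (v / 2) + par f (p + u / 2) (u / 2) (v / 2) +
  par f (p + v / 2) (u / 2) (v / 2) +
  par f (p + u / 2 + v / 2) (u / 2) (v / 2).
Proof.
move=> cf; rewrite /par !(avg_split _ u cf, avg_split _ v cf).
have h z : z / 2 + z / 2 = z by field; rewrite ?pnatr_eq0.
have -> : p + u / 2 + u / 2 = p + u by rewrite -addrA h.
have -> : p + v / 2 + v / 2 = p + v by rewrite -addrA h.
have -> : p + v / 2 + u / 2 = p + u / 2 + v / 2 by rewrite addrAC.
have -> : p + u / 2 + v / 2 + u / 2 = p + u + v / 2.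
  by rewrite [LHS]addrAC -(addrA p) h.
have -> : p + u / 2 + v / 2 + v / 2 = p + v + u / 2.
  by rewrite -(addrA _ (v / 2)) h addrAC.
by field; rewrite ?pnatr_eq0.
Qed.

(** The two sides in direction [u] differ by the constant [b v], those in
    direction [v] by [b u]; the contributions cancel. *)
Lemma par_affine p u v (a b : C) : par (fun z => a + b * z) p u v = 0.
Proof.
have E q w : avg (fun z => a + b * z) q w = a + b * avg id q w.
  rewrite (avgD _ _ (ccont_cst a) (ccontZ b ccont_id)) avg_cst.
  by rewrite (avgZ _ _ _ ccont_id).
rewrite /par !E.
have S q w : avg id (p + q) w = avg id p w + q.
  by rewrite avg_shift (avgD _ _ ccont_id (ccont_cst q)) avg_cst.
rewrite !S; ring.
Qed.

Lemma parD f g p u v : ccont f -> ccont g ->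
  par (fun z => f z + g z) p u v = par f p u v + par g p u v.
Proof. by move=> cf cg; rewrite /par !avgD//; ring. Qed.

Lemma par_bound f p u v (M : R) : ccont f ->
  (forall s t : R, 0 <= s <= 1 -> 0 <= t <= 1 ->
    modc (f (p + s%:C * u + t%:C * v)) <= M) ->
  modc (par f p u v) <= 2 * (modc u + modc v) * M.
Proof.
move=> cf h; rewrite /par.
have i0 : 0 <= (0 : R) <= 1 by rewrite lexx ler01.
have i1 : 0 <= (1 : R) <= 1 by rewrite lexx ler01.
have b1 : modc (avg f p u) <= M.
  by apply: avg_bound => // t ti; have := h t 0 ti i0; rewrite mul0r addr0.
have b2 : modc (avg f (p + u) v) <= M.
  by apply: avg_bound => // t ti; have := h 1 t i1 ti; rewrite rmorph1 mul1r.
have b3 : modc (avg f (p + v) u) <= M.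
  apply: avg_bound => // t ti; have := h t 1 ti i1; rewrite rmorph1 mul1r.
  by rewrite addrAC.
have b4 : modc (avg f p v) <= M.
  by apply: avg_bound => // t ti; have := h 0 t i0 ti; rewrite mul0r addr0.
have B a b : modc b <= M -> modc (a * b) <= modc a * M.
  by move=> bM; rewrite modcM ler_wpM2l ?modc_ge0.
move: (B u _ b1) (B v _ b2) (B u _ b3) (B v _ b4).
move=> {B}c1 c2 c3 c4.
apply: (le_trans (ler_modcB _ _)).
have := ler_modcB (u * avg f p u + v * avg f (p + u) v) (u * avg f (p + v) u).
have := ler_modcD (u * avg f p u) (v * avg f (p + u) v).
have -> : 2 * (modc u + modc v) * M =
  modc u * M + modc v * M + modc u * M + modc v * M by ring.
lra.
Qed.

(** One of the four halves of a parallelogram carries a quarter of the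
    integral. *)
Lemma par_bisect f u v (e : R) (s t : R) (n : nat) p : ccont f ->
  e / 4 ^+ n <=
    modc (par f (p + s%:C * u + t%:C * v) (u / 2 ^+ n) (v / 2 ^+ n)) ->
  exists a b : bool, e / 4 ^+ n.+1 <=
    modc (par f (p + (s + (a%:R : R) / 2 ^+ n.+1)%:C * u
                   + (t + (b%:R : R) / 2 ^+ n.+1)%:C * v)
            (u / 2 ^+ n.+1) (v / 2 ^+ n.+1)).
Proof.
move=> cf; rewrite (par_split _ _ _ cf).
have hw w : w / 2 ^+ n / 2 = w / 2 ^+ n.+1 by rewrite exprSr invfM mulrA.
rewrite !hw => H; apply: contrapT => nab.
have {}nab (a b : bool) :
    modc (par f (p + (s + (a%:R : R) / 2 ^+ n.+1)%:C * u
                   + (t + (b%:R : R) / 2 ^+ n.+1)%:C * v)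
            (u / 2 ^+ n.+1) (v / 2 ^+ n.+1)) < e / 4 ^+ n.+1.
  by rewrite ltNge; apply/negP => ab; apply: nab; exists a, b.
have c0 : ((0 : R) / 2 ^+ n.+1)%:C = 0 :> C by rewrite mul0r.
have c1 : ((1 : R) / 2 ^+ n.+1)%:C = 1 / 2 ^+ n.+1 :> C.
  by rewrite rmorphM fmorphV rmorphXn rmorph1 rmorph_nat.
have P (a b : bool) :
    p + (s + (a%:R : R) / 2 ^+ n.+1)%:C * u + (t + (b%:R : R) / 2 ^+ n.+1)%:C * v =
    p + s%:C * u + t%:C * v + (a%:R : C) * (u / 2 ^+ n.+1) +
       (b%:R : C) * (v / 2 ^+ n.+1).
  rewrite !rmorphD/= !rmorphM/= !fmorphV/= !rmorphXn/= !rmorph_nat; ring.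
have h00 := nab false false; have h10 := nab true false.
have h01 := nab false true; have h11 := nab true true.
move: h00 h10 h01 h11; rewrite !P !mul0r !mul1r !addr0.
set q := p + s%:C * u + t%:C * v.
have e4 : e / 4 ^+ n = e / 4 ^+ n.+1 + e / 4 ^+ n.+1 + e / 4 ^+ n.+1 + e / 4 ^+ n.+1.
  by rewrite exprSr invfM mulrA; field; rewrite ?expf_neq0 ?pnatr_eq0.
move: H; rewrite e4.
set A := par f q _ _; set B := par f (q + u / _) _ _.
set D := par f (q + v / _) _ _; set E := par f (q + _ + _) _ _.
have := ler_modcD (A + B + D) E; have := ler_modcD (A + B) D.
have := ler_modcD A B; lra.
Qed.

(** Quartering the parallelogram repeatedly leads to a point at which [f] is
    affine up to an error that is small compared with the size of the piece;
    affine functions integrate to [0], and the error is too small for a piece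
    that carries its share of the integral. *)
Lemma goursat f p u v : ccont f ->
  (forall s t : R, 0 <= s <= 1 -> 0 <= t <= 1 -> cdiff f (p + s%:C * u + t%:C * v)) ->
  par f p u v = 0.
Proof.
move=> cf df; apply: contrapT => par0.
pose e := modc (par f p u v).
have e0 : 0 < e by rewrite /e modc_gt0; exact/eqP.
(* corners are given by their coordinates with respect to [u] and [v]; at each
   step these gain one binary digit, so they converge *)
pose st := (R * R)%type.
pose good n (x : st) := e / 4 ^+ n <=
  modc (par f (p + x.1%:C * u + x.2%:C * v) (u / 2 ^+ n) (v / 2 ^+ n)).
have step (nx : nat * st) : exists y : st, good nx.1 nx.2 ->
   [/\ good nx.1.+1 y, exists a : bool, y.1 = nx.2.1 + a%:R / 2 ^+ nx.1.+1
    & exists b : bool, y.2 = nx.2.2 + b%:R / 2 ^+ nx.1.+1].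
  have [g|] := pselect (good nx.1 nx.2); last by exists nx.2.
  have [a [b ab]] := par_bisect cf g.
  exists (nx.2.1 + a%:R / 2 ^+ nx.1.+1, nx.2.2 + b%:R / 2 ^+ nx.1.+1) => _.
  by split => //; [exists a|exists b].
have [F FP] := choice step.
pose X := fix X n : st := if n is m.+1 then F (m, X m) else (0, 0).
have gX n : good n (X n).
  elim: n => [|n ih]; last by have [] := FP (n, X n) ih.
  by rewrite /good /= !mul0r !addr0 !expr0 !divr1.
have X1 n : exists a : bool, (X n.+1).1 = (X n).1 + a%:R / 2 ^+ n.+1.
  by have [] := FP (n, X n) (gX n).
have X2 n : exists a : bool, (X n.+1).2 = (X n).2 + a%:R / 2 ^+ n.+1.
  by have [] := FP (n, X n) (gX n).
have lim_ex (x : nat -> R) : x 0%N = 0 ->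
    (forall n, exists a : bool, x n.+1 = x n + a%:R / 2 ^+ n.+1) ->
    exists l, forall n, [/\ 0 <= x n, x n <= l, l <= x n + (2 ^+ n)^-1
       & x n + (2 ^+ n)^-1 <= 1].
  move=> x0 xS.
  have pw n : 0 < (2 ^+ n.+1)^-1 :> R by rewrite invr_gt0 exprn_gt0.
  have h2 n : (2 ^+ n)^-1 = (2 ^+ n.+1)^-1 + (2 ^+ n.+1)^-1 :> R.
    by rewrite exprS invfM; field; rewrite ?expf_neq0 ?pnatr_eq0.
  have inc n : x n <= x n.+1.
    by have [a ->] := xS n; rewrite lerDl divr_ge0 ?ler0n ?exprn_ge0.
  have dec n : x n.+1 + (2 ^+ n.+1)^-1 <= x n + (2 ^+ n)^-1.
    have [a ->] := xS n; rewrite (h2 n) addrA lerD2r lerD2l ler_piMl ?(ltW (pw n))//.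
    by case: a.
  have inc' n k : x n <= x (n + k)%N.
    by elim: k => [|k ih]; rewrite ?addn0// addnS (le_trans ih).
  have dec' n k : x (n + k)%N + (2 ^+ (n + k))^-1 <= x n + (2 ^+ n)^-1.
    by elim: k => [|k ih]; rewrite ?addn0// addnS (le_trans (dec _)).
  have ub n m : x m <= x n + (2 ^+ n)^-1.
    have pw' k : 0 <= (2 ^+ k)^-1 :> R by rewrite invr_ge0 exprn_ge0.
    have := leq_total n m; case/orP => nm.
      by have := dec' n (m - n)%N; rewrite subnKC//; have := pw' m; lra.
    by have := inc' m (n - m)%N; rewrite subnKC//; have := pw' n; lra.
  have hs : has_sup (range x).
    by split; [exists (x 0%N), 0%N | exists (x 0%N + (2 ^+ 0)^-1) => _ [m _ <-]].
  exists (sup (range x)) => n; split.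
  - by have := inc' 0%N n; rewrite x0 add0n.
  - by apply: sup_upper_bound => //; exists n.
  - by apply: ge_sup; [exists (x 0%N), 0%N | move=> _ [m _ <-]].
  - by have := dec' 0%N n; rewrite x0 add0n expr0 invr1 add0r.
have [l1 l1P] := lim_ex (fun n => (X n).1) erefl X1.
have [l2 l2P] := lim_ex (fun n => (X n).2) erefl X2.
have l01 l (x : nat -> R) : (forall n, [/\ 0 <= x n, x n <= l, l <= x n + (2 ^+ n)^-1
       & x n + (2 ^+ n)^-1 <= 1]) -> 0 <= l <= 1.
  by move=> /(_ 0%N)[]; lra.
have [c cP] := df l1 l2 (l01 _ _ l1P) (l01 _ _ l2P).
set q := p + l1%:C * u + l2%:C * v in cP.
pose K := modc u + modc v.
have K0 : 0 < K.
  rewrite lt_neqAle addr_ge0 ?modc_ge0// andbT eq_sym; apply/negP.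
  rewrite /K paddr_eq0 ?modc_ge0// => /andP[/eqP/modc_eq0 u0 /eqP/modc_eq0 v0].
  by apply: par0; rewrite /par u0 v0 !mul0r; ring.
(* with this tolerance the error on the [n]-th piece is [e / 2 / 4 ^+ n] *)
have e'0 : 0 < e / (4 * K ^+ 2) by rewrite divr_gt0// mulr_gt0// exprn_gt0.
have [d d0 dP] := cP _ e'0.
have [n nK] := ex_pow2_lt K d0.
pose r z := f z - (f q - c * q + c * z).
have cA : ccont (fun z => f q - c * q + c * z).
  by apply: ccontD; [exact: ccont_cst | apply: ccontZ; exact: ccont_id].
have cr : ccont r.
  have -> : r = (fun z => f z + -1 * (f q - c * q + c * z)).
    by apply/funext => z; rewrite /r mulN1r.
  by apply: ccontD => //; exact: ccontZ.
have fE : f = (fun z => r z + (f q - c * q + c * z)).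
  by apply/funext => z; rewrite /r subrK.
have := gX n; rewrite /good.
set p' := p + _ + _.
rewrite {1}fE (parD _ _ _ cr cA) par_affine addr0.
have p2 : 0 < 2 ^+ n :> R by rewrite exprn_gt0.
have wn w : modc (w / 2 ^+ n) = modc w / 2 ^+ n.
  by rewrite modc_div modcX modc2.
have := @par_bound r p' (u / 2 ^+ n) (v / 2 ^+ n)
  (e / (4 * K ^+ 2) * (K / 2 ^+ n)) cr.
rewrite !wn -mulrDl -/K => H1 H2.
have : e / 4 ^+ n <= 2 * (K / 2 ^+ n) * (e / (4 * K ^+ 2) * (K / 2 ^+ n)).
  apply: (le_trans H2); apply: H1 => s t /andP[s0 s1] /andP[t0 t1].
  set z := p' + _ + _.
  pose h := z - q.
  have hE : h = ((X n).1 + s / 2 ^+ n - l1)%:C * u + ((X n).2 + t / 2 ^+ n - l2)%:C * v.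
    rewrite /h /z /p' /q !rmorphB !rmorphD !rmorphM !fmorphV.
    by rewrite !rmorphXn !rmorph_nat; ring.
  have b (x : nat -> R) (l w : R) : 0 <= w -> w <= 1 -> (forall n, [/\ 0 <= x n, x n <= l, l <= x n + (2 ^+ n)^-1
       & x n + (2 ^+ n)^-1 <= 1]) -> `|x n + w / 2 ^+ n - l| <= (2 ^+ n)^-1.
    move=> w0 w1 /(_ n)[_ h1 h2 _].
    have w3 : 0 <= w / 2 ^+ n by rewrite divr_ge0// ltW.
    have w4 : w / 2 ^+ n <= (2 ^+ n)^-1 by rewrite ler_piMl// invr_ge0 ltW.
    rewrite ler_norml; apply/andP; split; lra.
  have hK : modc h <= K / 2 ^+ n.
    rewrite hE (le_trans (ler_modcD _ _))// !modcM !modcR /K mulrDl.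
    by rewrite lerD// mulrC ler_wpM2l ?modc_ge0//; apply: (b _ _ _ _ _ l1P) || apply: (b _ _ _ _ _ l2P).
  have := dP h (le_lt_trans hK nK).
  have -> : f (q + h) - f q - c * h = r z.
    by rewrite /r {1}/h [q + _]addrC subrK /h; ring.
  move=> /le_trans; apply; rewrite ler_wpM2l//.
  exact: ltW.
have -> : 2 * (K / 2 ^+ n) * (e / (4 * K ^+ 2) * (K / 2 ^+ n)) = e / 2 / 4 ^+ n.
  have -> : 4 = 2 ^+ 2 :> R by rewrite expr2 -natrM.
  by rewrite exprAC; field; rewrite !gt_eqF ?expf_neq0 ?pnatr_eq0.
rewrite ler_pM2r ?invr_gt0 ?exprn_gt0//; lra.
Qed.

End Goursat.

(** * The complex exponential *)
Section ComplexExponential.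
Context {R : realType}.
Local Notation C := R[i].
Implicit Types (f g : C -> C) (z w p u v s : C).

(** Both ways of differentiating a function of a complex variable agree; the
    first one is what Goursat's theorem uses, the second one comes with the
    usual rules of calculus. *)
Lemma cdiffP f z :
  cdiff f z <-> differentiable (f : R[i]^o -> R[i]^o) (z : R[i]^o).
Proof.
rewrite -derivable1_diffP; split.
  move=> [c cP]; apply/cvg_ex; exists (c : R[i]^o).
  apply/cvg_rnormP => e e0.
  have e2 : 0 < e / 2 by rewrite divr_gt0.
  have [d d0 dP] := cP _ e2.
  apply/nbhs_rnormP; exists d => // h; rewrite sub0r rnormN => hd /eqP h0 /=.
  have hn : 0 < modc h by rewrite modc_gt0; exact/eqP.
  have -> : c - h^-1 *: (f (h *: (1 : R[i]^o) + z) - f z) =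
      - (h^-1 * (f (z + h) - f z - c * h)).
    have -> : h *: (1 : R[i]^o) = h by exact: mulr1.
    rewrite [h + z]addrC -[_ *: _]/(_ * _).
    by field; exact/eqP.
  rewrite rnormN modcM modcV mulrC ltr_pdivrMr// (le_lt_trans (dP h hd))//.
  by rewrite ltr_pM2r// ltr_pdivrMr// ltr_pMr// ltr1n.
move=> /cvg_ex[c /cvg_rnormP cP]; exists c => e e0.
have /nbhs_rnormP[d d0 dP] := cP _ e0; exists d => // h hd.
have [->|h0] := eqVneq h 0.
  by rewrite addr0 subrr mulr0 subr0 modc0 mulr0.
have := dP h; rewrite sub0r rnormN => /(_ hd h0)/=.
have hn : 0 < modc h by rewrite modc_gt0.
have -> : h *: (1 : R[i]^o) = h by exact: mulr1.
rewrite [h + z]addrC -[_ *: _]/(_ * _) => /ltW.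
rewrite -(ler_pM2r hn) -modcM.
have -> : (c - h^-1 * (f (z + h) - f z)) * h = - (f (z + h) - f z - c * h).
  by field.
by rewrite modcN.
Qed.

Lemma real_deriv (f : R -> R) (x d : R) : is_derive x 1 f d ->
  forall e, 0 < e -> exists2 r, 0 < r & forall h, `|h| < r ->
    `|f (x + h) - f x - d * h| <= e * `|h|.
Proof.
move=> fd e e0.
have : (fun h => h^-1 *: ((f \o shift x) (h *: 1) - f x)) @ 0^' --> d.
  by have := @ex_derive _ _ _ _ _ _ _ fd; rewrite -[in X in _ -> X](@derive_val _ _ _ _ _ _ _ fd).
move=> /cvgrPdist_lt/(_ _ e0)/nbhs_ballP[r /= r0 rP]; exists r => // h hr.
have [->|h0] := eqVneq h 0; first by rewrite addr0 subrr mulr0 subr0 normr0 mulr0.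
have := rP h; rewrite -ball_normE/= sub0r normrN => /(_ hr h0).
rewrite -[h *: 1]/(h * 1) mulr1 [h + x]addrC -[_ *: _]/(_ * _) => /ltW.
rewrite -(ler_pM2r (_ : 0 < `|h|)) ?normr_gt0// -normrM.
have -> : (d - h^-1 * (f (x + h) - f x)) * h = - (f (x + h) - f x - d * h).
  by field.
by rewrite normrN.
Qed.

Definition cexp s : C := (expR (complex.Re s))%:C *
  (cos (complex.Im s) +i* sin (complex.Im s)).

Lemma cexpD s z : cexp (s + z) = cexp s * cexp z.
Proof.
case: s z => a b [c d]; rewrite /cexp /= expRD cosD sinD rmorphM/= mulrACA.
by congr (_ * _); simpc; congr (_ +i* _); rewrite // addrC mulrC.
Qed.

Lemma cexp0 : cexp 0 = 1.
Proof. by rewrite /cexp /= expR0 cos0 sin0 mul1r. Qed.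

Lemma modc_cexp s : modc (cexp s) = expR (complex.Re s).
Proof.
rewrite /cexp modcM modcR ger0_norm ?expR_ge0//.
suff -> : modc (cos (complex.Im s) +i* sin (complex.Im s)) = 1 by rewrite mulr1.
apply/eqP; rewrite -sqrp_eq1 ?modc_ge0//; apply/eqP.
by rewrite modc_sqr /= cos2Dsin2.
Qed.

Lemma cexp_neq0 s : cexp s != 0.
Proof. by rewrite -modc_gt0 modc_cexp expR_gt0. Qed.

Lemma cexpNK s : cexp s * cexp (- s) = 1.
Proof. by rewrite -cexpD subrr cexp0. Qed.

(** The period of the exponential. *)
Definition ctau : C := 0 +i* (pi *+ 2).

Lemma cexp_periodic s : cexp (s + ctau) = cexp s.
Proof.
rewrite cexpD [cexp ctau](_ : _ = 1) ?mulr1//.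
by rewrite /cexp /= expR0 cos2pi sin2pi mul1r.
Qed.

Lemma ctau_neq0 : ctau != 0.
Proof.
by apply/eqP => -[/eqP]; rewrite mulrn_eq0/= gt_eqF ?pi_gt0.
Qed.

(** The derivative at the origin, put together from those of the real
    exponential, the cosine and the sine. *)
Lemma cexp_small (e : R) : 0 < e -> exists2 r : R, 0 < r & forall h,
  modc h < r -> modc (cexp h - 1 - h) <= e * modc h.
Proof.
move=> e0; pose e' := Num.min (e / 6) 1.
have e'0 : 0 < e' by rewrite lt_min divr_gt0//=.
have e'e : e' <= e / 6 by rewrite ge_min lexx.
have e'1 : e' <= 1 by rewrite ge_min lexx orbT.
have [r1 r10 r1P] := real_deriv (is_derive_expR 0) e'0.
have [r2 r20 r2P] := real_deriv (is_derive_cos 0) e'0.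
have [r3 r30 r3P] := real_deriv (is_derive_sin 0) e'0.
exists (Num.min (Num.min r1 (e' / 2)) (Num.min r2 r3)).
  by rewrite !lt_min r10 r20 r30 divr_gt0.
move=> [a b]; set h := a +i* b.
rewrite !lt_min => /andP[/andP[h1 h4] /andP[h2 h3]].
have ah : `|a| <= modc h by exact: (Re_le_modc h).
have bh : `|b| <= modc h by exact: (Im_le_modc h).
have := r1P _ (le_lt_trans ah h1); have := r2P _ (le_lt_trans bh h2).
have := r3P _ (le_lt_trans bh h3).
rewrite !add0r expR0 cos0 sin0 oppr0 !mul0r !mul1r !subr0 => es ec eX.
pose X : C := (expR a)%:C; pose Y : C := cos b +i* sin b.
have -> : cexp h - 1 - h = X * (Y - 1 - 0 +i* b) + (X - 1 - a%:C) + (X - 1) * (0 +i* b).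
  rewrite (_ : h = a%:C + (0 +i* b)); last by rewrite /h; simpc.
  rewrite (_ : cexp _ = X * Y); first by ring.
  by rewrite /cexp /= addr0 add0r.
have hX : modc (X - 1 - a%:C) <= e' * modc h.
  rewrite /X -(rmorph1 (real_complex R)) -!rmorphB modcR (le_trans eX)//.
  by rewrite ler_wpM2l// ltW.
have hY : modc (Y - 1 - 0 +i* b) <= 2 * e' * modc h.
  apply: (le_trans (modc_le _)) => /=; rewrite !subr0.
  apply: (@le_trans _ _ (e' * `|b| + e' * `|b|)); first by rewrite addr0 in es; rewrite lerD.
  have := ler_wpM2l (ltW e'0) bh; lra.
have hX1 : modc (X - 1) <= e'.
  have -> : X - 1 = (X - 1 - a%:C) + a%:C by rewrite subrK.
  rewrite (le_trans (ler_modcD _ _))// modcR.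
  have : modc h <= e' / 2 by exact: ltW.
  have := ler_piMl (modc_ge0 h) e'1; lra.
have hX2 : modc X <= 2.
  have := ler_modc_dist X 1; rewrite modc1; lra.
have hb : modc (0 +i* b) <= modc h.
  by rewrite (le_trans (modc_le _))//= normr0 add0r.
apply: (@le_trans _ _ (2 * (2 * e' * modc h) + e' * modc h + e' * modc h)).
  apply: (le_trans (ler_modcD _ _)); apply: lerD; last first.
    by rewrite modcM ler_pM ?modc_ge0.
  apply: (le_trans (ler_modcD _ _)); apply: lerD => //.
  by rewrite modcM ler_pM ?modc_ge0.
have -> : 2 * (2 * e' * modc h) + e' * modc h + e' * modc h = 6 * e' * modc h by ring.
by rewrite ler_wpM2r ?modc_ge0// -ler_pdivlMl// mulrC.
Qed.

Lemma cdiff_cexp s : cdiff cexp s.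
Proof.
exists (cexp s) => e e0.
have c0 : 0 < modc (cexp s) by rewrite modc_gt0 cexp_neq0.
have [r r0 rP] := cexp_small (divr_gt0 e0 c0); exists r => // h /rP H.
have -> : cexp (s + h) - cexp s - cexp s * h = cexp s * (cexp h - 1 - h).
  by rewrite cexpD; ring.
rewrite modcM (le_trans (ler_wpM2l (ltW c0) H))// mulrA [_ * (e / _)]mulrC.
by rewrite divfK// gt_eqF.
Qed.

Lemma cexp_surj z : z != 0 -> exists s, z = cexp s.
Proof.
case: z => x y z0; set z := x +i* y in z0 *.
have m0 : 0 < modc z by rewrite modc_gt0.
pose c := x / modc z; pose d := y / modc z.
have cd : c ^+ 2 + d ^+ 2 = 1.
  rewrite /c /d !expr_div_n -mulrDl -[x]/(complex.Re z) -[y]/(complex.Im z).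
  by rewrite -modc_sqr divff// expf_neq0// gt_eqF.
have c1 : -1 <= c <= 1.
  rewrite -ler_norml -(@ler_sqr R) ?nnegrE// real_normK ?num_real// expr1n.
  by rewrite -cd lerDl sqr_ge0.
have sc : sin (acos c) = `|d|.
  by rewrite sin_acos// -cd addrC addKr sqrtr_sqr.
have [t tc ts] : exists2 t, cos t = c & sin t = d.
  have cK : cos (acos c) = c by apply: acosK; rewrite in_itv.
  have [d0|d0] := leP 0 d; first by exists (acos c); rewrite // sc ger0_norm.
  by exists (- acos c); rewrite ?cosN// sinN sc ltr0_norm// opprK.
exists (ln (modc z) +i* t); rewrite /cexp /= lnK ?posrE// tc ts.
rewrite (_ : (modc z)%:C * (c +i* d) = (modc z * c) +i* (modc z * d)); last by simpc.
by rewrite /c /d !mulrA ![modc z * _]mulrC !mulfK// gt_eqF.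
Qed.

End ComplexExponential.

(** * Taylor coefficients of an entire function *)
Section TaylorCoefficients.
Context {R : realType}.
Local Notation C := R[i].
Local Notation tau := (@ctau R).
Implicit Types (f g : C -> C) (z w p u v s : C).

Lemma cdiffM f g z : cdiff f z -> cdiff g z -> cdiff (fun w => f w * g w) z.
Proof.
rewrite !cdiffP => df dg.
exact: (@differentiableM _ R[i]^o (f : R[i]^o -> R[i]^o) (g : R[i]^o -> R[i]^o)).
Qed.

Lemma cdiff_comp f g z : cdiff f z -> cdiff g (f z) -> cdiff (g \o f) z.
Proof.
rewrite !cdiffP => df dg.
exact: (@differentiable_comp _ R[i]^o R[i]^o R[i]^o
  (f : R[i]^o -> R[i]^o) (g : R[i]^o -> R[i]^o)).
Qed.

Lemma cdiff_cst (a : C) z : cdiff (fun=> a) z.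
Proof.
by exists 0 => e e0; exists 1 => // h _;
  rewrite mul0r subrr subr0 modc0 mulr_ge0 ?modc_ge0// ltW.
Qed.

Lemma cdiff_lin (a b : C) z : cdiff (fun w => a + b * w) z.
Proof.
exists b => e e0; exists 1 => // h _.
rewrite (_ : _ - _ = 0); first by rewrite modc0 mulr_ge0 ?modc_ge0// ltW.
by ring.
Qed.

Lemma cdiffX f n z : cdiff f z -> cdiff (fun w => f w ^+ n) z.
Proof.
move=> df; elim: n => [|n ih].
  by under eq_fun do rewrite expr0; exact: cdiff_cst.
by under eq_fun do rewrite exprS; exact: cdiffM.
Qed.

Lemma cdiff_near f g z (r : R) : 0 < r ->
  (forall w, modc (w - z) < r -> f w = g w) -> cdiff f z -> cdiff g z.
Proof.
move=> r0 fg [c cP]; exists c => e e0; have [d d0 dP] := cP _ e0.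
exists (Num.min d r); first by rewrite lt_min d0.
move=> h; rewrite lt_min => /andP[hd hr]; rewrite -!fg ?subrr ?modc0//.
  exact: dP.
by rewrite [z + h]addrC addrK.
Qed.

(** The integral over a period does not depend on where the period starts,
    because the two other sides of the parallelogram cancel. *)
Lemma avg_period f p u : ccont f -> (forall s, f (s + tau) = f s) ->
  (forall s t : R, 0 <= s <= 1 -> 0 <= t <= 1 ->
    cdiff f (p + s%:C * u + t%:C * tau)) ->
  avg f (p + u) tau = avg f p tau.
Proof.
move=> cf per df; have := goursat cf df; rewrite /par.
rewrite (avg_shift f p u tau).
have -> : (fun z => f (z + tau)) = f by apply/funext.
move=> /eqP; rewrite -addrA -addrA.
have -> : u * avg f p u + (tau * avg f (p + u) tau + (- (u * avg f p u) - tau * avg f p tau)) =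
  tau * (avg f (p + u) tau - avg f p tau) by ring.
by rewrite mulf_eq0 (negbTE ctau_neq0)/= subr_eq0 => /eqP.
Qed.

Definition circ k g s : C := g (cexp s) * cexp (- s) ^+ k.

(** The integral of [g] times the [k]-th power of the inverse over the unit
    circle: the [k]-th Taylor coefficient of [g] at the origin. *)
Definition ccoef k g : C := avg (circ k g) 0 tau.

Lemma ccont_cexp : ccont (@cexp R).
Proof. by apply: cdiff_ccont => z; exact: cdiff_cexp. Qed.

Lemma ccont_opp : ccont (fun z => - z : C).
Proof.
by have := ccontZ (-1) (@ccont_id R); under eq_fun do rewrite mulN1r.
Qed.

Lemma ccont_cexpN k : ccont (fun s => cexp (- s) ^+ k : C).
Proof.
apply: ccontX; exact: (@ccont_comp _ (@cexp R) -%R ccont_cexp ccont_opp).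
Qed.

Lemma ccont_circ k g : ccont g -> ccont (circ k g).
Proof.
move=> cg; apply: (ccontM _ (@ccont_cexpN k)).
exact: (ccont_comp cg ccont_cexp).
Qed.

Lemma cdiff_cexpN k s : cdiff (fun s => cexp (- s) ^+ k : C) s.
Proof.
apply: cdiffX; apply: (@cdiff_comp -%R (@cexp R)); last exact: cdiff_cexp.
have := cdiff_lin 0 (-1) s; by under eq_fun do rewrite add0r mulN1r.
Qed.

Lemma cdiff_circ k g : (forall z, cdiff g z) -> forall s, cdiff (circ k g) s.
Proof.
move=> dg s; apply: (cdiffM _ (cdiff_cexpN _ _)).
by apply: (@cdiff_comp (@cexp R)) => //; exact: cdiff_cexp.
Qed.

Lemma cexpN_periodic s : cexp (- (s + tau)) = cexp (- s).
Proof. by rewrite opprD -[LHS]cexp_periodic subrK. Qed.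

Lemma circ_periodic k g s : circ k g (s + tau) = circ k g s.
Proof. by rewrite /circ cexp_periodic cexpN_periodic. Qed.

Lemma ccoef_indep k g p : (forall z, cdiff g z) -> avg (circ k g) p tau = ccoef k g.
Proof.
move=> dg; rewrite -[p]add0r; apply: avg_period.
- by apply: ccont_circ; exact: cdiff_ccont.
- exact: circ_periodic.
- by move=> *; exact: cdiff_circ.
Qed.

Lemma ccoefD k f g : ccont f -> ccont g ->
  ccoef k (fun z => f z + g z) = ccoef k f + ccoef k g.
Proof.
move=> cf cg; rewrite /ccoef -avgD; do ?exact: ccont_circ.
by congr avg; apply/funext => s; rewrite /circ mulrDl.
Qed.

Lemma ccoefZ k a f : ccont f -> ccoef k (fun z => a * f z) = a * ccoef k f.
Proof.
move=> cf; rewrite /ccoef -avgZ; do ?exact: ccont_circ.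
by congr avg; apply/funext => s; rewrite /circ mulrA.
Qed.

Lemma modc_circle (t : R) : modc (cexp (t%:C * tau)) = 1.
Proof. by rewrite modc_cexp /ctau /= mul0r mulr0 subr0 expR0. Qed.

Lemma modc_circleN (t : R) : modc (cexp (- (t%:C * tau))) = 1.
Proof. by rewrite -mulNr -rmorphN modc_circle. Qed.

Lemma ccoef_bound k f (M : R) : ccont f ->
  (forall z, modc z = 1 -> modc (f z) <= M) -> modc (ccoef k f) <= M.
Proof.
move=> cf fM; apply: avg_bound; first exact: ccont_circ.
move=> t _; rewrite add0r /circ modcM modcX modc_circleN expr1n mulr1.
by rewrite fM// modc_circle.
Qed.

(** Rescaling the variable by [cexp s] moves the path of integration by [s],
    which the integral does not notice. *)
Lemma ccoef_scale_cexp k g s : (forall z, cdiff g z) ->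
  ccoef k (fun z => g (cexp s * z)) = cexp s ^+ k * ccoef k g.
Proof.
move=> dg; have cg := cdiff_ccont dg.
rewrite -(ccoef_indep k (0 + s) dg) avg_shift -avgZ; last first.
  apply: (ccont_comp (ccont_circ k cg)) => //.
  exact: ccontD (@ccont_id R) (ccont_cst s).
have E : cexp s ^+ k * cexp (- s) ^+ k = 1 by rewrite -exprMn cexpNK expr1n.
congr avg; apply/funext => t; rewrite /circ (addrC t) opprD !cexpD.
by rewrite (exprMn _ (cexp (- s)) (cexp (- t))) -[LHS]mul1r -E; ring.
Qed.

(** A constant is not changed by rescaling the variable, but its coefficient is
    multiplied by a number of modulus different from [1]. *)
Lemma ccoef_cst a k : ccoef k.+1 (fun=> a) = 0.
Proof.
have d z : cdiff (fun=> a) z by exact: cdiff_cst.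
have := ccoef_scale_cexp k.+1 1 d => /eqP.
rewrite -subr_eq0 -{1}[ccoef _ _]mul1r -mulrBl mulf_eq0 subr_eq0.
case/orP => [|/eqP//].
move=> /eqP/(congr1 (fun z => modc z)).
rewrite modc1 modcX modc_cexp /= => /esym/eqP.
by rewrite pexpr_eq1 ?expR_ge0//= gt_eqF// expR_gt1.
Qed.

Lemma ccoef0_cst a : ccoef 0 (fun=> a) = a.
Proof.
rewrite /ccoef /circ; under eq_fun do rewrite expr0 mulr1; exact: avg_cst.
Qed.

(** The difference quotient of [g] at [w]. The value [c] at [w] is left open;
    the derivative of [g] makes the function continuous. *)
Definition dquot g w (c : C) z := if z == w then c else (g z - g w) / (z - w).

Lemma dquotE g w c z : dquot g w c z * (z - w) = g z - g w.
Proof.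
rewrite /dquot; case: eqVneq => [->|zw]; first by rewrite !subrr mulr0.
by rewrite divfK// subr_eq0.
Qed.

Lemma dquot_cdiff g w c z : (forall z, cdiff g z) -> z != w ->
  cdiff (dquot g w c) z.
Proof.
move=> dg zw; have zw0 : 0 < modc (z - w) by rewrite modc_gt0 subr_eq0.
apply: (@cdiff_near (fun z => (g z - g w) / (z - w)) _ _ _ zw0) => [t tz|].
  rewrite /dquot; case: eqVneq => // tw; move: tz.
  by rewrite tw modcBC ltxx.
apply: cdiffM.
  by have := cdiff_comp (dg z) (cdiff_lin (- g w) 1 (g z));
    rewrite /comp; under eq_fun do rewrite mul1r addrC.
have d1 := cdiff_lin (- w) 1 z.
have {}d1 : cdiff (fun t => t - w) z.
  by move: d1; under eq_fun do rewrite mul1r addrC.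
apply/cdiffP; apply: (@differentiableV _ R[i]^o); first exact/cdiffP.
by rewrite subr_eq0.
Qed.

Lemma dquot_ccont g w : (forall z, cdiff g z) -> exists c, ccont (dquot g w c).
Proof.
move=> dg; have [c cP] := dg w; exists c => z e e0.
have [->|zw] := eqVneq z w.
  have e2 : 0 < e / 2 by rewrite divr_gt0.
  have [d d0 dP] := cP _ e2; exists d => // t tw.
  rewrite /dquot eqxx; case: eqVneq => [_|tw']; first by rewrite subrr modc0.
  have := dP _ tw; rewrite [w + _]addrC subrK => H.
  have m0 : 0 < modc (t - w) by rewrite modc_gt0 subr_eq0.
  have -> : (g t - g w) / (t - w) - c = (g t - g w - c * (t - w)) / (t - w).
    by field; rewrite subr_eq0.
  rewrite modc_div ltr_pdivrMr// (le_lt_trans H)// ltr_pM2r//.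
  by rewrite ltr_pdivrMr// ltr_pMr// ltr1n.
have [d dP] := dquot_cdiff c dg zw.
have M0 : 0 < modc d + 1 by rewrite ltr_wpDl ?modc_ge0.
have [r r0 rP] := dP _ ltr01.
exists (Num.min r (e / (modc d + 1))); first by rewrite lt_min r0 divr_gt0.
move=> t; rewrite lt_min ltr_pdivlMr// => /andP[/rP].
rewrite [z + _]addrC subrK mul1r => h1 h2.
have -> : dquot g w c t - dquot g w c z =
    (dquot g w c t - dquot g w c z - d * (t - z)) + d * (t - z) by rewrite subrK.
apply: le_lt_trans h2; rewrite (le_trans (ler_modcD _ _))// modcM.
by rewrite [leRHS]mulrDr mulr1 [leRHS]addrC lerD// mulrC.
Qed.

(** The integral of the difference quotient at [w] over a circle around the
    origin is constant in the radius as long as the circle does not meet [w],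
    by [avg_period], and continuous in the radius everywhere, so it is constant;
    it tends to [0] with the radius. *)
Lemma avg_dquot g w c : (forall z, cdiff g z) -> ccont (dquot g w c) ->
  modc w < 1 -> avg (fun s => dquot g w c (cexp s) * cexp s) 0 tau = 0.
Proof.
move=> dg cq w1; pose H s : C := dquot g w c (cexp s) * cexp s.
have cH : ccont H.
  by apply: ccontM ccont_cexp; exact: (ccont_comp cq ccont_cexp).
have Hper s : H (s + tau) = H s by rewrite /H cexp_periodic.
(* the integral over the circle of radius [expR a] *)
pose J (a : R) := avg H a%:C tau.
have Jc (a b : R) : a <= b -> (b < ln (modc w) \/ expR a > modc w) ->
    J b = J a.
  move=> ab abw; rewrite /J.
  have -> : b%:C = a%:C + (b - a)%:C by rewrite rmorphB/= addrC subrK.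
  apply: avg_period => // s t /andP[s0 s1] /andP[t0 t1].
  apply: cdiffM; last exact: cdiff_cexp.
  apply: (@cdiff_comp (@cexp R)); first exact: cdiff_cexp.
  apply: dquot_cdiff => //; apply/eqP => /(congr1 (fun z => modc z)).
  rewrite modc_cexp.
  have -> : complex.Re (a%:C + s%:C * (b - a)%:C + t%:C * tau) = a + s * (b - a).
    by rewrite /ctau /=; ring.
  have h1 : a <= a + s * (b - a) by rewrite lerDl mulr_ge0// subr_ge0.
  have h2 : a + s * (b - a) <= b.
    have : s * (b - a) <= b - a by rewrite ler_piMl// subr_ge0.
    lra.
  case: abw => [bw|aw] E.
    have w0 : 0 < modc w by rewrite -E expR_gt0.
    by move: (le_lt_trans h2 bw); rewrite -E expRK ltxx.
  move: aw; rewrite -E ltNge ler_expR.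
  by rewrite h1.
have Jcont (a : R) e : 0 < e -> exists2 d : R, 0 < d & forall b, `|b - a| < d -> modc (J b - J a) <= e.
  move=> e0; have [d d0 dP] := ccont_uniform (`|a| + 1 + modc tau) cH e0.
  exists (Num.min d 1); first by rewrite lt_min d0 ltr01.
  move=> b; rewrite lt_min => /andP[bd b1].
  have b1' : `|b| <= `|a| + 1.
    rewrite -(subrK a b).
    by rewrite (le_trans (ler_normD _ _))// addrC lerD2l ltW.
  have mt (t : R) : 0 <= t <= 1 -> modc (t%:C * tau) <= modc tau.
    by move=> /andP[t0 t1]; rewrite modcM modcR ger0_norm// ler_piMl ?modc_ge0.
  have E (x : R) : J x = avg (fun z => H (z + x%:C)) 0 tau.
    by rewrite /J -[x%:C]add0r avg_shift add0r.
  have cHx (x : R) : ccont (fun z => H (z + x%:C)).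
    exact: (ccont_comp cH (ccontD (@ccont_id R) (ccont_cst x%:C))).
  have -> : J b - J a = avg (fun z => H (z + b%:C) + -1 * H (z + a%:C)) 0 tau.
    rewrite avgD//; last exact: ccontZ.
    by rewrite avgZ// -!E mulN1r.
  apply: avg_bound; first by apply: ccontD => //; exact: ccontZ.
  move=> t /mt ht; rewrite add0r mulN1r; apply: ltW; apply: dP.
  - by rewrite (le_trans (ler_modcD _ _))// addrC lerD// modcR.
  - rewrite (le_trans (ler_modcD _ _))// addrC lerD// modcR lerDl//.
  - by rewrite addrAC opprD addrA subrr sub0r addrC -rmorphB modcR.
have [M MP] := ccont_bounded 1 cq.
have M0 : 0 <= M by apply: le_trans (MP 0 _); rewrite ?modc_ge0 ?modc0.
have Jsmall (a : R) : a <= 0 -> modc (J a) <= M * expR a.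
  move=> a0; apply: avg_bound => // t _; rewrite /H modcM.
  have -> : modc (cexp (a%:C + t%:C * tau)) = expR a.
    by rewrite cexpD modcM modc_circle mulr1 modc_cexp.
  rewrite ler_wpM2r ?expR_ge0//; apply: MP.
  rewrite cexpD modcM modc_circle mulr1 modc_cexp /=.
  by rewrite -expR0 ler_expR.
have small_exp (a e : R) : 0 < e -> exists2 b, b < a & M * expR b <= e.
  move=> e0; have M1 : 0 < M + 1 by rewrite ltr_wpDl.
  exists (Num.min (a - 1) (ln (e / (M + 1)))).
    by rewrite gt_min ltrBlDr ltrDl ltr01.
  apply: (@le_trans _ _ (M * expR (ln (e / (M + 1))))).
    by rewrite ler_wpM2l// ler_expR ge_min lexx orbT.
  rewrite lnK ?posrE ?divr_gt0// mulrA ler_pdivrMr// mulrC ler_wpM2l//.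
    exact: ltW.
  by rewrite lerDl.
have J0 : J 0 = 0.
  apply: modc_eq0; apply/eqP; rewrite eq_le modc_ge0 andbT.
  apply/ler_addgt0Pr => e e0; rewrite add0r.
  have [w0|w0] := eqVneq w 0.
    have [b b0 bP] := small_exp 0 _ e0.
    rewrite (Jc b 0 (ltW b0)) ?(le_trans _ bP) ?Jsmall//; first exact: ltW.
    by right; rewrite w0 modc0 expR_gt0.
  have mw : 0 < modc w by rewrite modc_gt0.
  pose l := ln (modc w).
  have l0 : l < 0 by rewrite /l ln_lt0// mw.
  have e3 : 0 < e / 3 by rewrite divr_gt0.
  have [d d0 dP] := Jcont l _ e3.
  pose d' := Num.min (d / 2) (- l).
  have d'0 : 0 < d' by rewrite lt_min divr_gt0//= oppr_gt0.
  have d'd : d' < d.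
    by rewrite gt_min ltr_pdivrMr// ltr_pMr// ltr1n.
  have h1 : modc (J (l + d') - J l) <= e / 3.
    by apply: dP; rewrite addrC addKr ger0_norm// ltW.
  have h2 : modc (J (l - d') - J l) <= e / 3.
    by apply: dP; rewrite addrC addKr normrN ger0_norm// ltW.
  have h3 : J 0 = J (l + d').
    apply: Jc.
      have : d' <= - l by rewrite ge_min lexx orbT.
      lra.
    by right; rewrite -[X in X < _](@lnK _ (modc w)) ?posrE// ltr_expR -/l ltrDl.
  have [b bl bP] := small_exp (l - d') _ e3.
  have h4 : J (l - d') = J b.
    by apply: Jc; [exact: ltW|left; rewrite -/l ltrBlDr ltrDl].
  have h5 : modc (J b) <= e / 3.
    by apply: le_trans bP; apply: Jsmall; lra.
  rewrite h3.
  have := ler_modc_dist (J (l + d')) (J l).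
  have := ler_modc_dist (J l) (J (l - d')).
  rewrite (modcBC (J l) (J (l - d'))); rewrite -h4 in h5; lra.
exact: J0.
Qed.

(** Cauchy's formula: the integral of [(g z - g w) / (z - w)] vanishes. Expanding
    the integrand as in a finite geometric series leaves the remainder, an
    integral that is estimated on the circle, where [z - w] has modulus at least
    [1 / 2]. *)
Lemma taylor_unit g w (M : R) n : (forall z, cdiff g z) ->
  (forall z, modc z <= 1 -> modc (g z) <= M) -> modc w <= 1 / 2 ->
  modc (g w - \sum_(k < n) ccoef k g * w ^+ k) <= 4 * M * modc w ^+ n.
Proof.
move=> dg gM w2; have cg := cdiff_ccont dg.
have [c cq] := dquot_ccont w dg.
have w1 : modc w < 1 by lra.
have A0 := avg_dquot dg cq w1.
pose H s : C := dquot g w c (cexp s) * cexp s.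
have cH : ccont H.
  by apply: ccontM ccont_cexp; exact: (ccont_comp cq ccont_cexp).
have cHn k : ccont (fun s => H s * cexp (- s) ^+ k).
  by apply: ccontM => //; exact: ccont_cexpN.
(* the integrals of the difference quotient against negative powers; [A 0] is
   [0], and [AS] expresses [A k] by [A k.+1] and a coefficient of [g] *)
pose A k := avg (fun s => H s * cexp (- s) ^+ k) 0 tau.
have AS k : A k = ccoef k (fun z => g z + - g w) + w * A k.+1.
  rewrite /A /ccoef -avgZ// -avgD; last 2 first.
  - by apply: ccont_circ; apply: ccontD => //; exact: ccont_cst.
  - exact: ccontZ.
  congr avg; apply/funext => s; rewrite /circ -(dquotE g w c) exprS /H.
  set q := dquot _ _ _ _.
  have -> : w * (q * cexp s * (cexp (- s) * cexp (- s) ^+ k)) =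
     w * (q * (cexp s * cexp (- s)) * cexp (- s) ^+ k) by ring.
  by rewrite cexpNK; ring.
have cE k : ccoef k (fun z => g z + - g w) = ccoef k g - (if k == 0%N then g w else 0).
  rewrite ccoefD//; last exact: ccont_cst.
  by case: k => [|k]; rewrite ?ccoef0_cst ?ccoef_cst ?oppr0.
have AE m : 0 = (\sum_(k < m) ccoef k g * w ^+ k) - (if m == 0%N then 0 else g w) + w ^+ m * A m.
  elim: m => [|m ih].
    by rewrite big_ord0 subr0 expr0 mul1r add0r -[LHS]A0 /A; under [in RHS]eq_fun do rewrite expr0 mulr1.
  rewrite {1}ih AS cE big_ord_recr /= exprSr.
  by case: (m) => [|j] /=; ring.
case: n => [|n].
  rewrite big_ord0 subr0 expr0 mulr1.
  have gw := gM w (ltW w1); have := modc_ge0 (g w); lra.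
have -> : g w - \sum_(k < n.+1) ccoef k g * w ^+ k = w ^+ n.+1 * A n.+1.
  by have := AE n.+1; rewrite /= => /eqP; rewrite addrAC eq_sym subr_eq0 => /eqP <-; ring.
rewrite modcM modcX mulrC ler_wpM2r ?exprn_ge0 ?modc_ge0//.
apply: avg_bound => // t _; rewrite add0r modcM modcX modc_circleN expr1n mulr1.
rewrite /H modcM modc_circle mulr1.
set z := cexp _; have z1 : modc z = 1 by exact: modc_circle.
have zw : 1 / 2 <= modc (z - w).
  have := ler_modc_dist z w; rewrite z1; lra.
have : modc (dquot g w c z) * modc (z - w) <= 2 * M.
  rewrite -modcM dquotE (le_trans (ler_modcB _ _))//.
  have := gM z; have := gM w (ltW w1); rewrite z1 lexx => ? /(_ isT); lra.
have := modc_ge0 (dquot g w c z); nra.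
Qed.

Lemma ccoef_scale k g m : (forall z, cdiff g z) ->
  ccoef k (fun z => g (m * z)) = m ^+ k * ccoef k g.
Proof.
move=> dg; have [->|m0] := eqVneq m 0; last first.
  by have [s ->] := cexp_surj m0; exact: ccoef_scale_cexp.
under eq_fun do rewrite mul0r.
case: k => [|k]; last by rewrite ccoef_cst expr0n mul0r.
rewrite ccoef0_cst expr0 mul1r.
have [M MP] := ccont_bounded 1 (cdiff_ccont dg).
have := @taylor_unit g 0 M 1 dg MP; rewrite modc0 => /(_ _)/wrap[|].
  by rewrite divr_ge0.
rewrite big_ord1 !expr0 mulr1 expr1 mulr0 => h; apply/eqP; rewrite -subr_eq0.
by apply/eqP/modc_eq0/eqP; rewrite eq_le modc_ge0 h.
Qed.

Lemma cdiff_scale g (m z0 : C) : (forall z, cdiff g z) ->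
  forall z, cdiff (fun z => g (z0 + m * z)) z.
Proof.
move=> dg z; apply: (@cdiff_comp (fun z => z0 + m * z) g) => //.
exact: cdiff_lin.
Qed.

Lemma taylor_disc g w (M r : R) n : 0 < r -> (forall z, cdiff g z) ->
  (forall z, modc z <= r -> modc (g z) <= M) -> modc w <= r / 2 ->
  modc (g w - \sum_(k < n) ccoef k g * w ^+ k) <= 4 * M * (modc w / r) ^+ n.
Proof.
move=> r0 dg gM wr.
have rC : r%:C != 0 :> C by rewrite -modc_gt0 modcR normr_gt0 gt_eqF.
have mr : modc (r%:C : C) = r by rewrite modcR ger0_norm// ltW.
have dg' z : cdiff (fun z => g (r%:C * z)) z.
  by have := cdiff_scale r%:C 0 dg z; under eq_fun do rewrite add0r.
have := @taylor_unit (fun z => g (r%:C * z)) (w / r%:C) M n dg'.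
have -> : \sum_(k < n) ccoef k (fun z => g (r%:C * z)) * (w / r%:C) ^+ k =
    \sum_(k < n) ccoef k g * w ^+ k.
  apply: eq_bigr => k _; rewrite ccoef_scale// mulrAC -exprMn mulrC.
  by rewrite [_ * (w / _)]mulrC divfK.
rewrite [_ * (w / _)]mulrC divfK// modc_div mr; apply.
  by move=> z z1; apply: gM; rewrite modcM mr ler_piMr// ltW.
by rewrite ler_pdivrMr// mulrC mulrA mulr1.
Qed.

Lemma ccoef0 g : (forall z, cdiff g z) -> ccoef 0 g = g 0.
Proof.
move=> dg; have := ccoef_scale 0 0 dg; under eq_fun do rewrite mul0r.
by rewrite ccoef0_cst expr0 mul1r.
Qed.

End TaylorCoefficients.

(** * Holomorphic functions of bounded type on a normed space *)
Section BoundedTypeFunctions.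
Context {R : realType} {E : normedModType R[i]}.
Local Notation C := R[i].
Implicit Types (f g P : E -> C) (x y v : E) (k n : nat).

Lemma ccoef_shift k (g : C -> C) : ccoef k.+1 (fun z => z * g z) = ccoef k g.
Proof.
rewrite /ccoef; congr avg; apply/funext => s; rewrite /circ exprS.
by rewrite -[RHS]mul1r -(cexpNK s); ring.
Qed.

Definition line f x y (l : C) : C := f (x + l *: y).

(** Entire along every complex line and bounded on bounded sets. Unlike Frechet
    differentiability this is easily inherited by integrals over a parameter. *)
Definition gol f := (forall x y l, cdiff (line f x y) l) /\
  forall r : R, exists M : R, forall x, rnorm x <= r -> modc (f x) <= M.

Lemma gol_line f x y : gol f -> forall l, cdiff (line f x y) l.
Proof. by move=> [df _]; exact: df. Qed.

Lemma gol_ccont f x y : gol f -> ccont (line f x y).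
Proof. by move=> gf; apply: cdiff_ccont; exact: gol_line. Qed.

Lemma gol_bound f : gol f -> forall r : R, exists2 M : R, 0 <= M &
  forall x, rnorm x <= r -> modc (f x) <= M.
Proof.
move=> [_ bf] r; have [M MP] := bf r; exists (Num.max M 0).
  by rewrite le_max lexx orbT.
by move=> x /MP h; rewrite le_max h.
Qed.

(** Cauchy's estimate on the line through [x] and [x + h], whose disc of radius
    [2 / rnorm h] stays in the ball of radius [r + 2]. *)
Lemma gol_lip f : gol f -> forall r : R, exists2 K : R, 0 <= K &
  forall x h, rnorm x <= r -> rnorm h <= 1 -> modc (f (x + h) - f x) <= K * rnorm h.
Proof.
move=> gf r; have [M M0 MP] := gol_bound gf (r + 2); exists (2 * M) => [|x h xr h1].
  by rewrite mulr_ge0.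
have [->|h0] := eqVneq h 0; first by rewrite addr0 subrr modc0 rnorm0 mulr0.
have hp : 0 < rnorm h by rewrite rnorm_gt0.
have := @taylor_disc _ (line f x h) 1 M (2 / rnorm h) 1.
rewrite divr_gt0// => /(_ isT (gol_line x h gf)).
rewrite big_ord1 expr0 mulr1 ccoef0; last exact: gol_line.
rewrite /line scale0r addr0 scale1r modc1 expr1 => H.
have -> : 2 * M * rnorm h = 4 * M * (1 / (2 / rnorm h)).
  by field; rewrite gt_eqF.
apply: H; last by rewrite mulrAC divff ?mul1r ?pnatr_eq0// invf_ge1.
move=> z zr; apply: MP; rewrite (le_trans (ler_rnormD _ _))// lerD//.
by rewrite rnormZ -ler_pdivlMr.
Qed.

(** The derivative of [f] at [x] in the direction [y]. As an integral over a
    circle it inherits estimates and dependence on parameters from [f]. *)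
Definition dir f x y : C := ccoef 1 (line f x y).

Lemma gol_deriv f : gol f -> forall r : R, exists2 K : R, 0 <= K &
  forall x v (h : C), rnorm x <= r -> rnorm v <= r -> modc h <= 1 / 2 ->
    modc (f (x + h *: v) - f x - h * dir f x v) <= K * modc h ^+ 2.
Proof.
move=> gf r; have [M M0 MP] := gol_bound gf (r + r); exists (4 * M) => [|x v h xr vr h2].
  by rewrite mulr_ge0.
have := @taylor_disc _ (line f x v) h M 1 2 ltr01 (gol_line x v gf).
rewrite !big_ord_recr big_ord0/= add0r expr0 expr1 mulr1 ccoef0; last exact: gol_line.
rewrite divr1 -/(dir f x v) opprD addrA [dir f x v * h]mulrC.
rewrite /line scale0r addr0; apply => // z z1; apply: MP.
rewrite (le_trans (ler_rnormD _ _))// lerD// rnormZ.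
by rewrite (le_trans _ vr)// ler_piMl ?rnorm_ge0.
Qed.

Lemma dir_bound f x y (M : R) : gol f ->
  (forall h, rnorm h <= rnorm y -> modc (f (x + h)) <= M) -> modc (dir f x y) <= M.
Proof.
move=> gf fM; apply: ccoef_bound => [|z z1]; first exact: gol_ccont.
by apply: fM; rewrite rnormZ z1 mul1r.
Qed.

Lemma dir_ccont f (u0 u1 v0 v1 : E) : gol f ->
  ccont (fun l : C => dir f (u0 + l *: u1) (v0 + l *: v1)).
Proof.
move=> gf z e e0.
pose a l := u0 + l *: u1; pose b l := v0 + l *: v1.
have [K K0 KP] := gol_lip gf (rnorm (a z) + rnorm (b z)).
pose N := rnorm u1 + rnorm v1 + 1.
have N0 : 0 < N by rewrite ltr_wpDl ?addr_ge0 ?rnorm_ge0.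
have K1 : 0 < K + 1 by rewrite ltr_wpDl.
exists (Num.min N^-1 (e / ((K + 1) * N))).
  by rewrite lt_min invr_gt0 N0 divr_gt0// mulr_gt0.
move=> w; rewrite lt_min ltr_pdivlMr ?mulr_gt0// => /andP[wz1 wz2].
rewrite -[X in modc X < _](_ : dir f (a w) (b w) - dir f (a z) (b z) = _)//.
have cl x y : ccont (line f x y) by exact: gol_ccont.
have -> : dir f (a w) (b w) - dir f (a z) (b z) =
    ccoef 1 (fun l => line f (a w) (b w) l + -1 * line f (a z) (b z) l).
  by rewrite ccoefD ?ccoefZ ?mulN1r//; exact: ccontZ.
apply: (@le_lt_trans _ _ (K * (modc (w - z) * N))); last first.
  apply: le_lt_trans wz2; rewrite mulrCA ler_wpM2l ?modc_ge0//.
  by rewrite ler_wpM2r ?(ltW N0)// lerDl.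
apply: ccoef_bound => [|l l1]; first by apply: ccontD => //; exact: ccontZ.
rewrite mulN1r /line.
have -> : a w + l *: b w = (a z + l *: b z) + ((w - z) *: u1 + (l * (w - z)) *: v1).
  have sh (p q : E) : p + w *: q = (p + z *: q) + (w - z) *: q.
    by rewrite -addrA -scalerDl (addrC z) subrK.
  by rewrite /a /b (sh u0) (sh v0) scalerDr scalerA addrACA.
have hN : rnorm ((w - z) *: u1 + (l * (w - z)) *: v1) <= modc (w - z) * N.
  rewrite (le_trans (ler_rnormD _ _))// (rnormZ _ u1) (rnormZ _ v1) modcM l1 mul1r -mulrDr.
  by rewrite ler_wpM2l ?modc_ge0// lerDl.
apply: (@le_trans _ _ (K * rnorm ((w - z) *: u1 + (l * (w - z)) *: v1))).
  apply: KP.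
    by rewrite (le_trans (ler_rnormD _ _))// rnormZ l1 mul1r.
  by rewrite (le_trans hN)// -ler_pdivlMr// div1r ltW.
by rewrite ler_wpM2l.
Qed.

(** Integrating over the circle [|l| = 1] the functions
    [x |-> f ((c + d l) x + l y)] of bounded type gives such a function again;
    the cases [c = 1, d = 0] and [c = 0, d = 1, y = 0] are the directional
    derivatives of [f] and the terms of its Taylor series. *)
Lemma gol_ccoef f k (c d : C) y : gol f ->
  gol (fun x => ccoef k (line f (c *: x) (d *: x + y))).
Proof.
move=> gf; split; last first.
  move=> r; have [M M0 MP] := gol_bound gf (modc c * r + (modc d * r + rnorm y)).
  exists M => x xr; apply: ccoef_bound => [|z z1]; first exact: gol_ccont.
  apply: MP; rewrite (le_trans (ler_rnormD _ _))// !rnormZ z1 mul1r lerD//.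
    by rewrite ler_wpM2l ?modc_ge0.
  by rewrite (le_trans (ler_rnormD _ _))// lerD2r rnormZ ler_wpM2l ?modc_ge0.
move=> x z l0; pose x0 := x + l0 *: z.
(* the value at [x0] of the map and the direction in which the argument moves *)
pose A l := c *: x0 + l *: (d *: x0 + y); pose B l := c *: z + l *: (d *: z).
exists (ccoef k (fun l => dir f (A l) (B l))) => e e0.
pose r := modc c * rnorm x0 + rnorm (d *: x0 + y) + (modc c * rnorm z + rnorm (d *: z)).
have [K K0 KP] := gol_deriv gf r.
have K1 : 0 < K + 1 by rewrite ltr_wpDl.
exists (Num.min (1 / 2) (e / (K + 1))); first by rewrite lt_min !divr_gt0.
move=> h; rewrite lt_min (ltr_pdivlMr _ _ K1) => /andP[h2 he].
have cl a b : ccont (line f a b) by exact: gol_ccont.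
have cd : ccont (fun l => dir f (A l) (B l)) by exact: dir_ccont.
have cm : ccont (fun l => -1 * (h * dir f (A l) (B l))) by do 2 apply: ccontZ.
have -> : line (fun x => ccoef k (line f (c *: x) (d *: x + y))) x z (l0 + h) =
    ccoef k (line f (c *: (x0 + h *: z)) (d *: (x0 + h *: z) + y)).
  by rewrite {1}/line scalerDl addrA.
have -> : line (fun x => ccoef k (line f (c *: x) (d *: x + y))) x z l0 =
    ccoef k (line f (c *: x0) (d *: x0 + y)) by [].
set g1 := line f _ _; set g2 := line f _ _; set g3 := fun l => dir f _ _.
have c1 : ccont g1 by exact: cl.
have c2 : ccont (fun l => -1 * g2 l) by apply: ccontZ; exact: cl.
have c3 : ccont (fun l => -1 * (h * g3 l)) by exact: cm.
have c12 := ccontD c1 c2.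
have -> : ccoef k g1 - ccoef k g2 - ccoef k g3 * h =
    ccoef k (fun l => g1 l + -1 * g2 l + -1 * (h * g3 l)).
  rewrite (ccoefD _ c12 c3) (ccoefD _ c1 c2).
  rewrite (ccoefZ k (-1) (cl _ _)) (ccoefZ k (-1) (ccontZ h cd)) (ccoefZ k h cd).
  by rewrite !mulN1r (mulrC h).
apply: (@le_trans _ _ (K * modc h ^+ 2)); last first.
  rewrite expr2 mulrA ler_wpM2r ?modc_ge0// (le_trans _ (ltW he))// mulrC.
  by rewrite ler_wpM2l ?modc_ge0// lerDl.
apply: ccoef_bound => [|l l1].
  exact: ccontD.
rewrite !mulN1r /g1 /g2 /g3 /line.
have -> : c *: (x0 + h *: z) + l *: (d *: (x0 + h *: z) + y) = A l + h *: B l.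
  have ac (p q s t u : E) : p + q + (s + t + u) = p + (s + u) + (q + t).
    by rewrite [s + t + u]addrAC addrACA.
  rewrite /A /B !scalerDr !scalerA ac; congr (_ + (_ *: _ + _ *: _)).
    exact: mulrC.
  by rewrite mulrC mulrA.
have xr : rnorm (A l) <= r.
  rewrite (le_trans (ler_rnormD _ _))// !(rnormZ _ (_ + y), rnormZ c) l1 mul1r.
  by rewrite /r lerDl addr_ge0 ?mulr_ge0 ?modc_ge0 ?rnorm_ge0.
have zr : rnorm (B l) <= r.
  rewrite (le_trans (ler_rnormD _ _))// (rnormZ l) l1 mul1r (rnormZ c).
  by rewrite /r lerDr addr_ge0 ?mulr_ge0 ?modc_ge0 ?rnorm_ge0.
exact: KP xr zr (ltW h2).
Qed.

Lemma gol_dir f y : gol f -> gol (fun x => dir f x y).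
Proof.
move=> gf; have := gol_ccoef 1 1 0 y gf.
by under eq_fun do rewrite scale1r scale0r add0r.
Qed.

(** The [k]-th term of the Taylor series at the origin. *)
Definition taylor_term f k x : C := ccoef k (line f 0 x).

Lemma gol_taylor_term f k : gol f -> gol (taylor_term f k).
Proof.
move=> gf; have := gol_ccoef k 0 1 0 gf.
by under eq_fun do rewrite scale0r scale1r addr0.
Qed.

Lemma golD f g : gol f -> gol g -> gol (fun x => f x + g x).
Proof.
move=> gf gg; split.
  move=> x y l; have := gol_line x y gf l; have := gol_line x y gg l.
  rewrite !cdiffP => d1 d2.
  exact: (@differentiableD _ R[i]^o R[i]^o (line f x y) (line g x y)).
move=> r; have [M M0 MP] := gol_bound gf r; have [N N0 NP] := gol_bound gg r.
by exists (M + N) => x xr; rewrite (le_trans (ler_modcD _ _))// lerD ?MP ?NP.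
Qed.

Lemma golZ (a : C) f : gol f -> gol (fun x => a * f x).
Proof.
move=> gf; split.
  move=> x y l; apply: cdiffM; [exact: cdiff_cst | exact: gol_line].
move=> r; have [M M0 MP] := gol_bound gf r.
by exists (modc a * M) => x xr; rewrite modcM ler_wpM2l ?modc_ge0 ?MP.
Qed.

Lemma dirD f g x y : gol f -> gol g ->
  dir (fun x => f x + g x) x y = dir f x y + dir g x y.
Proof. by move=> gf gg; rewrite /dir -ccoefD//; exact: gol_ccont. Qed.

Lemma dirZ (a : C) f x y : gol f -> dir (fun x => a * f x) x y = a * dir f x y.
Proof. by move=> gf; rewrite /dir -ccoefZ//; exact: gol_ccont. Qed.

Lemma dir_scale f x (a : C) y : gol f -> dir f x (a *: y) = a * dir f x y.
Proof.
move=> gf; rewrite /dir -[a in RHS]expr1 -ccoef_scale; last exact: gol_line.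
by congr ccoef; apply/funext => l; rewrite /line scalerA mulrC.
Qed.

(** Going from [x] to [x + h (v + w)] directly or by way of [x + h v] differs
    only to second order in [h], because the derivative in direction [w] is
    continuous along the line through [x] and [x + v]. *)
Lemma dir_add f x v w : gol f -> dir f x (v + w) = dir f x v + dir f x w.
Proof.
move=> gf; apply/eqP; rewrite -subr_eq0; apply/eqP/modc_eq0/eqP.
rewrite eq_le modc_ge0 andbT; apply/ler_addgt0Pr => e e0; rewrite add0r.
set D := _ - _.
pose r := rnorm x + rnorm v + rnorm w.
have v0 := rnorm_ge0 v; have w0 := rnorm_ge0 w; have x0 := rnorm_ge0 x.
have [K K0 KP] := gol_deriv gf r.
have e3 : 0 < e / 2 by rewrite divr_gt0.
have cd : ccont (fun l : C => dir f (x + l *: v) w).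
  by have := @dir_ccont f x v w 0 gf; under eq_fun do rewrite scaler0 addr0.
have [d d0 dP] := cd 0 _ e3.
have K1 : 0 < 6 * (K + 1) by rewrite mulr_gt0// ltr_wpDl.
pose t := Num.min (1 / 2) (Num.min (d / 2) (e / (6 * (K + 1)))).
have t0 : 0 < t by rewrite !lt_min !divr_gt0.
have t2 : t <= 1 / 2 by rewrite ge_min lexx.
have td : t < d.
  have : t <= d / 2 by rewrite !ge_min lexx orbT.
  lra.
have te : K * t <= e / 6.
  have : t <= e / (6 * (K + 1)) by rewrite !ge_min lexx !orbT.
  rewrite ler_pdivlMr//; nra.
pose h : C := t%:C; have mh : modc h = t by rewrite modcR ger0_norm// ltW.
have h2 : modc h <= 1 / 2 by rewrite mh.
have xvr : rnorm (x + h *: v) <= r.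
  rewrite (le_trans (ler_rnormD _ _))// rnormZ mh /r.
  have : t * rnorm v <= rnorm v by rewrite ler_piMl// (le_trans t2)//; lra.
  lra.
have n1 : rnorm (v + w) <= r.
  by rewrite (le_trans (ler_rnormD _ _))// /r; lra.
have n2 : rnorm x <= r by rewrite /r; lra.
have n3 : rnorm v <= r by rewrite /r; lra.
have n4 : rnorm w <= r by rewrite /r; lra.
have b1 := KP x (v + w) h n2 n1 h2.
have b2 := KP x v h n2 n3 h2.
have b3 := KP (x + h *: v) w h xvr n4 h2.
have := dP h; rewrite subr0 mh => /(_ td); rewrite scale0r addr0 => b4.
rewrite -(addrA x) -scalerDr in b3.
rewrite -(ler_pM2l t0) -{1}mh -modcM.
have -> : h * D = (f (x + h *: (v + w)) - f (x + h *: v) - h * dir f (x + h *: v) w)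
    + (f (x + h *: v) - f x - h * dir f x v)
    + h * (dir f (x + h *: v) w - dir f x w)
    - (f (x + h *: (v + w)) - f x - h * dir f x (v + w)).
  by rewrite /D; ring.
set a1 := _ - h * dir f (x + h *: v) w; set a2 := _ - h * dir f x v.
set a3 := h * _; set a4 := _ - h * dir f x (v + w).
have b4' : modc a3 <= t * (e / 2).
  by rewrite /a3 modcM mh ler_wpM2l// ltW.
have := ler_modcB (a1 + a2 + a3) a4; have := ler_modcD (a1 + a2) a3.
have := ler_modcD a1 a2.
move: b1 b2 b3; rewrite -/a1 -/a2 -/a4 mh => b1 b2 b3.
have : K * t ^+ 2 <= t * (e / 6) by rewrite expr2 mulrA mulrC ler_wpM2l// ltW.
lra.
Qed.

(** The scalar [0] is left out: for [k = 0] it would say that [P] is constant,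
    which comes from continuity only ([homog0_const]). *)
Definition homog k P := forall (l : C) x, l != 0 -> P (l *: x) = l ^+ k * P x.

Lemma homog_dir k P y : gol P -> homog k.+1 P -> homog k (fun x => dir P x y).
Proof.
move=> gP hP l x l0; rewrite /dir.
have -> : line P (l *: x) y = fun z => l ^+ k.+1 * line P x y (l^-1 * z).
  apply/funext => z; rewrite /line -hP//; congr (P _).
  by rewrite scalerDr scalerA mulrA mulfV// mul1r.
rewrite ccoefZ; last first.
  have := ccont_comp (gol_ccont x y gP) (ccontZ l^-1 (@ccont_id R)).
  exact.
rewrite ccoef_scale; last exact: gol_line.
by rewrite expr1 mulrA exprSr mulfK.
Qed.

Lemma ccoef1_binom k (a : C) : ccoef 1 (fun l => (1 + l) ^+ k * a) = k%:R * a.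
Proof.
have d n z : cdiff (fun l : C => (1 + l) ^+ n * a) z.
  apply: cdiffM; last exact: cdiff_cst.
  apply: cdiffX; have := cdiff_lin 1 1 z.
  by under eq_fun do rewrite mul1r.
elim: k => [|k ih].
  by under eq_fun do rewrite expr0; rewrite ccoef_cst mul0r.
have -> : (fun l : C => (1 + l) ^+ k.+1 * a) =
    (fun l => (1 + l) ^+ k * a + l * ((1 + l) ^+ k * a)).
  by apply/funext => l; rewrite exprS; ring.
have c := cdiff_ccont (d k).
rewrite ccoefD//; last by apply: ccontM => //; exact: ccont_id.
rewrite ih ccoef_shift ccoef0// addr0 expr1n mul1r -natr1.
by rewrite mulrDl mul1r.
Qed.

Lemma ccont_eq_off (f g : C -> C) z0 : ccont f -> ccont g ->
  (forall z, z != z0 -> f z = g z) -> f z0 = g z0.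
Proof.
move=> cf cg fg; apply/eqP; rewrite -subr_eq0; apply/eqP/modc_eq0/eqP.
rewrite eq_le modc_ge0 andbT; apply/ler_addgt0Pr => e e0; rewrite add0r.
have e2 : 0 < e / 2 by rewrite divr_gt0.
have [d1 d10 dP1] := cf z0 _ e2; have [d2 d20 dP2] := cg z0 _ e2.
pose t := Num.min d1 d2 / 2.
have m0 : 0 < Num.min d1 d2 by rewrite lt_min d10.
have t0 : 0 < t by rewrite divr_gt0.
have tm : t < Num.min d1 d2 by rewrite ltr_pdivrMr// ltr_pMr// ltr1n.
pose z : C := z0 + t%:C.
have zt : modc (z - z0) = t by rewrite /z [z0 + _]addrC addrK modcR ger0_norm// ltW.
have zz : z != z0 by rewrite -subr_eq0 -modc_gt0 zt.
have h1 : modc (f z - f z0) < e / 2 by apply: dP1; rewrite zt (lt_le_trans tm)// ge_min lexx.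
have h2 : modc (g z - g z0) < e / 2 by apply: dP2; rewrite zt (lt_le_trans tm)// ge_min lexx orbT.
have := ler_modc_distD (f z) (f z0) (g z0).
rewrite (modcBC (f z0) (f z)) => h3; move: h1; rewrite (fg _ zz) in h3 *; lra.
Qed.

(** Euler's identity for homogeneous functions. *)
Lemma homog_euler k P x : homog k P -> gol P -> dir P x x = k%:R * P x.
Proof.
move=> hP gP; rewrite -ccoef1_binom /dir.
have c1 := gol_ccont x x gP.
have c2 : ccont (fun l : C => (1 + l) ^+ k * P x).
  apply: ccontM; last exact: ccont_cst.
  by apply: ccontX; apply: ccontD; [exact: ccont_cst | exact: ccont_id].
have off l : l != -1 -> line P x x l = (1 + l) ^+ k * P x.
  move=> l1; rewrite /line -{1}[x]scale1r -scalerDl hP//.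
  by rewrite addrC -[1]opprK subr_eq0.
congr ccoef; apply/funext => l.
have [->|] := eqVneq l (-1); last exact: off.
exact: (ccont_eq_off c1 c2 off).
Qed.

Lemma homog0_const P x : homog 0 P -> gol P -> P x = P 0.
Proof.
move=> hP gP.
have := @ccont_eq_off (line P 0 x) (fun=> P x) 0 (gol_ccont 0 x gP) (ccont_cst _).
rewrite /line scale0r add0r => <- // z z0.
by rewrite add0r hP// expr0 mul1r.
Qed.

(** Iterated directional derivatives. At the origin they give, up to a factor,
    the symmetric form of a homogeneous polynomial. *)
Fixpoint dirs (s : seq E) P : E -> C :=
  if s is y :: s' then fun x => dir (dirs s' P) x y else P.

Lemma gol_dirs s P : gol P -> gol (dirs s P).
Proof. by move=> gP; elim: s => //= y s ih; exact: gol_dir. Qed.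

Lemma dirs_cat s t P : dirs (s ++ t) P = dirs s (dirs t P).
Proof. by elim: s => //= y s ->. Qed.

Lemma dirs_lin s (a : C) P Q : gol P -> gol Q ->
  dirs s (fun x => a * P x + Q x) = (fun x => a * dirs s P x + dirs s Q x).
Proof.
move=> gP gQ; elim: s => //= y s ->; apply/funext => x.
rewrite dirD ?dirZ//; try apply: golZ; exact: gol_dirs.
Qed.

Lemma dirs_slot s t (a : C) x y P z : gol P ->
  dirs (s ++ (a *: x + y) :: t) P z =
  a * dirs (s ++ x :: t) P z + dirs (s ++ y :: t) P z.
Proof.
move=> gP; rewrite !dirs_cat /=.
have gt := gol_dirs t gP.
have -> : (fun w => dir (dirs t P) w (a *: x + y)) =
    (fun w => a * dir (dirs t P) w x + dir (dirs t P) w y).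
  by apply/funext => w; rewrite dir_add// dir_scale.
by rewrite dirs_lin//; exact: gol_dir.
Qed.

Lemma dirs_bound n P : gol P -> exists M : R, forall s, size s = n ->
  (forall y, y \in s -> rnorm y <= 1) -> modc (dirs s P 0) <= M.
Proof.
move=> gP; have [M M0 MP] := gol_bound gP n%:R; exists M => s sn s1.
suff H t x : (forall y, y \in t -> rnorm y <= 1) ->
    rnorm x + (size t)%:R <= n%:R -> modc (dirs t P x) <= M.
  by apply: H => //; rewrite rnorm0 add0r sn.
elim: t x => [|y t ih] x t1 xt /=; first by rewrite addr0 in xt; exact: MP.
apply: dir_bound => [|h hy]; first exact: gol_dirs.
apply: ih => [z zt|]; first by apply: t1; rewrite inE zt orbT.
have y1 : rnorm y <= 1 by apply: t1; rewrite inE eqxx.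
have := ler_rnormD x h; move: xt; rewrite /= -natr1; lra.
Qed.

(** By Euler's identity the successive derivatives in direction [x] at the point
    [x] multiply by [k], [k - 1], ...; the last derivative is homogeneous of
    degree [0], hence constant, and may be taken at the origin. *)
Lemma dirs_diag k P x : gol P -> homog k P ->
  dirs (nseq k x) P 0 = k`!%:R * P x.
Proof.
move=> gP hP.
have H j : (j <= k)%N -> homog (k - j) (dirs (nseq j x) P) /\
    dirs (nseq j x) P x = (k ^_ j)%:R * P x.
  elim: j => [|j ih] jk /=; first by rewrite subn0 ffactn0 mul1r.
  have [h1 h2] := ih (ltnW jk).
  have gj := gol_dirs (nseq j x) gP.
  split; first by apply: homog_dir => //; rewrite subnSK.
  by rewrite (homog_euler _ h1 gj) h2 ffactnSr mulrA -natrM mulnC.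
have [h1 h2] := H _ (leqnn k); rewrite subnn in h1.
by rewrite -(homog0_const x h1 (gol_dirs _ gP)) h2 ffactnn.
Qed.

Lemma homog_taylor_term f k : gol f -> homog k (taylor_term f k).
Proof.
move=> gf l x l0; rewrite /taylor_term -ccoef_scale; last exact: gol_line.
by congr ccoef; apply/funext => z; rewrite /line scalerA mulrC.
Qed.

Lemma taylor_term_cvg f : gol f -> forall r : R, exists2 M : R, 0 <= M &
  forall x n, rnorm x <= r ->
    modc (f x - \sum_(k < n) taylor_term f k x) <= M / 2 ^+ n.
Proof.
move=> gf r; have [M M0 MP] := gol_bound gf (2 * r); exists (4 * M) => [|x n xr].
  by rewrite mulr_ge0.
have := @taylor_disc _ (line f 0 x) 1 M 2 n.
rewrite ltr0n => /(_ isT (gol_line 0 x gf)); rewrite modc1.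
rewrite {2}/line add0r scale1r div1r exprVn.
under eq_bigr do rewrite expr1n mulr1.
apply; last by rewrite divff.
move=> z z2; apply: MP; rewrite add0r rnormZ.
by rewrite ler_pM ?modc_ge0 ?rnorm_ge0.
Qed.

End BoundedTypeFunctions.

(** * Multilinear forms *)
Lemma ptws_cvgP (U : Type) (V : ptopologicalType) (F : set_system (U -> V))
    (f : U -> V) : Filter F ->
  F --> (f : {ptws U -> V}) <-> forall i, (fun g => g i) @ F --> f i.
Proof.
move=> FF; rewrite cvg_sup; split => [+ i|+ i] => [/(_ i)|/(_ i) Fi].
  rewrite cvg_image; last by rewrite eqEsubset; split=> v // _; exists (cst v).
  apply: cvg_trans => W /=; rewrite ?nbhs_simpl /fmap /= => [[W' + <-]].
  by apply: filterS => g W'g /=; exists g.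
rewrite cvg_image; last by rewrite eqEsubset; split=> v // _; exists (cst v).
move: Fi => + W //=; rewrite ?nbhs_simpl => Q => /Q Q'; exists (@^~ i @^-1` W) => //.
by rewrite eqEsubset; split => [j [? + <-//]|j Wj]; exists (fun _ => j).
Qed.

Section Forms.
Context {R : realType} {E : normedModType R[i]}.
Local Notation C := R[i].
Implicit Types (F G : seq E -> C) (s t : seq E) (x y : E) (n : nat).

(** A form in [n] variables is a function of lists of length [n]: this makes it
    easy to freeze the first argument, and symmetry is invariance under
    permutation of lists. *)
Definition slotlin n F := forall s t (c : C) x y, (size s + size t).+1 = n ->
  F (s ++ (c *: x + y) :: t) = c * F (s ++ x :: t) + F (s ++ y :: t).

Definition bdd n F (M : R) := forall s, size s = n ->
  modc (F s) <= M * \prod_(x <- s) rnorm x.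

Definition mlf n F := slotlin n F /\ exists2 M : R, 0 <= M & bdd n F M.

Definition smf n F := mlf n F /\
  forall s t, size s = n -> perm_eq s t -> F s = F t.

Lemma slotlin_cons n F x : slotlin n.+1 F -> slotlin n (fun s => F (x :: s)).
Proof. by move=> lF s t c y z st; rewrite -!cat_cons lF//= -st. Qed.

Lemma slotlinZ n F (c : C) x s : slotlin n.+1 F -> size s = n ->
  F (c *: x :: s) = c * F (x :: s).
Proof.
move=> lF sn; have lin y z a := lF [::] s a y z (congr1 S sn).
have F0 : F (0 :: s) = 0.
  by have := lin 0 0 1; rewrite scale1r addr0 mul1r => /eqP; rewrite -subr_eq0 opprD addrA subrr sub0r oppr_eq0 => /eqP.
by rewrite -[c *: x]addr0 lin F0 addr0.
Qed.

Lemma slotlinD n F x y s : slotlin n.+1 F -> size s = n ->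
  F (x + y :: s) = F (x :: s) + F (y :: s).
Proof.
move=> lF sn; have := lF [::] s 1 x y (congr1 S sn).
by rewrite scale1r mul1r.
Qed.

Lemma slotlin0 n F s : slotlin n.+1 F -> size s = n -> F (0 :: s) = 0.
Proof. by move=> lF sn; rewrite -(scale0r 0) (slotlinZ _ _ lF)// mul0r. Qed.

Lemma mlf_cons n F x : mlf n.+1 F -> mlf n (fun s => F (x :: s)).
Proof.
move=> [lF [M M0 bF]]; split; first exact: slotlin_cons.
exists (M * rnorm x) => [|s sn]; first by rewrite mulr_ge0 ?rnorm_ge0.
by rewrite -mulrA -(big_cons _ _ _ _ xpredT) bF//= sn.
Qed.

Lemma smf_cons n F x : smf n.+1 F -> smf n (fun s => F (x :: s)).
Proof.
move=> [mF sF]; split; first exact: mlf_cons.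
by move=> s t sn st; apply: sF; rewrite /= ?sn ?perm_cons.
Qed.

(** By homogeneity in each argument. *)
Lemma bdd_ball n F (d M : R) : 0 < d -> slotlin n F ->
  (forall s, size s = n -> (forall x, x \in s -> rnorm x <= d) -> modc (F s) <= M) ->
  bdd n F (M / d ^+ n).
Proof.
move=> d0; elim: n F M => [|n ih] F M lF FM s sn.
  move/size0nil: sn => ->; rewrite expr0 divr1 big_nil mulr1.
  by apply: FM.
case: s sn => // x s [sn].
have [->|x0] := eqVneq x 0.
  by rewrite (slotlin0 lF sn) modc0 big_cons rnorm0 mul0r mulr0.
have xp : 0 < rnorm x by rewrite rnorm_gt0.
pose a : C := (d / rnorm x)%:C.
have ma : modc a = d / rnorm x by rewrite modcR ger0_norm// divr_ge0 ?ltW.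
have := ih (fun s => F (a *: x :: s)) M (slotlin_cons _ lF) _ s sn.
move=> /(_ _)/wrap[t tn td|].
  apply: FM => /=; first by rewrite tn.
  move=> y; rewrite inE => /orP[/eqP->|]; last exact: td.
  by rewrite rnormZ ma divfK ?gt_eqF.
rewrite (slotlinZ _ _ lF)// modcM ma big_cons exprS.
have dx : 0 < d / rnorm x by rewrite divr_gt0.
rewrite mulrC -ler_pdivlMr// => /le_trans; apply.
rewrite le_eqVlt; apply/orP; left; apply/eqP.
by field; rewrite !gt_eqF ?exprn_gt0.
Qed.

Lemma bdd_max n F (M r : R) s : 0 <= M -> bdd n F M -> size s = n ->
  (forall x, x \in s -> rnorm x <= r) -> modc (F s) <= M * r ^+ n.
Proof.
move=> M0 bF sn sr; rewrite (le_trans (bF s sn))// ler_wpM2l// -sn.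
elim: s {sn} sr => [|x s ih] sr; first by rewrite big_nil expr0.
rewrite big_cons exprS ler_pM ?rnorm_ge0//.
- by apply: prodr_ge0 => *; exact: rnorm_ge0.
- by apply: sr; rewrite inE eqxx.
- by apply: ih => y ys; apply: sr; rewrite inE ys orbT.
Qed.

Lemma prod_rnorm_near n s t : size s = n -> size t = n ->
  (forall i, (i < n)%N -> rnorm (nth 0 s i - nth 0 t i) < 1) ->
  \prod_(y <- t) rnorm y <= \prod_(y <- s) (rnorm y + 1).
Proof.
elim: n s t => [|n ih] s t.
  by move=> /size0nil-> /size0nil-> _; rewrite !big_nil.
case: s => // x s [sn]; case: t => // y t [tn] st; rewrite !big_cons.
apply: ler_pM; rewrite ?rnorm_ge0//.
- by apply: prodr_ge0 => *; exact: rnorm_ge0.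
- have := st 0%N isT; rewrite /= rnormBC => h.
  by rewrite (le_trans (ler_rnorm_dist _ x))// lerD2l ltW.
- by apply: ih => // i iN; have := st i.+1 iN.
Qed.

Lemma mlf_cont n F : mlf n F -> forall s, size s = n -> forall e : R, 0 < e ->
  exists2 d : R, 0 < d & forall t, size t = n ->
    (forall i, (i < n)%N -> rnorm (nth 0 s i - nth 0 t i) < d) ->
    modc (F s - F t) < e.
Proof.
elim: n F => [|n ih] F mF s sn e e0.
  by exists 1 => // t /size0nil -> _; move/size0nil: sn => ->; rewrite subrr modc0.
case: s sn => // x s [sn].
have e2 : 0 < e / 2 by rewrite divr_gt0.
have [d d0 dP] := ih _ (mlf_cons x mF) s sn _ e2.
have [lF [M M0 bF]] := mF.
pose K := M * \prod_(y <- s) (rnorm y + 1) + 1.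
have K0 : 0 < K.
  rewrite ltr_wpDl// mulr_ge0// prodr_ge0// => y _.
  by rewrite addr_ge0 ?rnorm_ge0.
exists (Num.min (Num.min d 1) (e / (2 * K))).
  by rewrite !lt_min d0 ltr01 divr_gt0// mulr_gt0.
move=> [//|y t] [tn] st.
have stn i : (i < n)%N -> rnorm (nth 0 s i - nth 0 t i) < Num.min d 1.
  by move=> iN; have := st i.+1 iN; rewrite /= lt_min => /andP[].
have xy : rnorm (x - y) * K < e / 2.
  have := st 0%N isT; rewrite /= lt_min => /andP[_].
  by rewrite -(ltr_pM2r K0) => /lt_le_trans; apply; rewrite invfM mulrA divfK ?gt_eqF.
have -> : F (x :: s) - F (y :: t) = (F (x :: s) - F (x :: t)) + F (x - y :: t).
  rewrite (slotlinD _ _ lF tn) -(scaleN1r y) (slotlinZ _ _ lF tn) mulN1r.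
  by rewrite addrA subrK.
rewrite (le_lt_trans (ler_modcD _ _))// [e]splitr ltrD//.
  by apply: dP => // i /stn; rewrite lt_min => /andP[].
apply: le_lt_trans xy; apply: (le_trans (bF (x - y :: t) (congr1 S tn))) => /=.
rewrite big_cons mulrCA ler_wpM2l ?rnorm_ge0//.
rewrite /K ler_wpDr// ler_wpM2l//.
have {stn} : forall i, (i < n)%N -> rnorm (nth 0 s i - nth 0 t i) < 1.
  by move=> i /stn; rewrite lt_min => /andP[].
exact: prod_rnorm_near.
Qed.

(** ** Forms on lists and forms on families *)
Definition form_seq k (L : ('I_k -> E) -> R[i]^o) s : C :=
  L (fun i => nth 0 s i).

Definition seq_form k F : ('I_k -> E) -> R[i]^o :=
  fun v => F [seq v i | i <- enum 'I_k].

Arguments seq_form : clear implicits.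

Lemma nth_enum_map k (v : 'I_k -> E) (i : 'I_k) :
  nth 0 [seq v j | j <- enum 'I_k] i = v i.
Proof. by rewrite (nth_map i) ?size_enum_ord// nth_ord_enum. Qed.

Lemma form_seqK k L : seq_form k (form_seq L) = L.
Proof.
apply/funext => v; rewrite /seq_form /form_seq; congr L; apply/funext => i.
exact: nth_enum_map.
Qed.

Lemma seq_formK k F s : size s = k -> form_seq (seq_form k F) s = F s.
Proof.
move=> sk; rewrite /form_seq /seq_form; congr F.
apply: (@eq_from_nth _ 0); first by rewrite size_map size_enum_ord.
move=> i; rewrite size_map size_enum_ord => ik.
by rewrite (nth_enum_map _ (Ordinal ik)).
Qed.

Lemma diagonal_form_seq k (L : ('I_k -> E) -> R[i]^o) x :
  Defs.diagonal L x = form_seq L (nseq k x).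
Proof.
rewrite /Defs.diagonal /form_seq; congr L; apply/funext => i.
by rewrite nth_nseq ltn_ord.
Qed.

Lemma diagonal_seq_form k F x : Defs.diagonal (seq_form k F) x = F (nseq k x).
Proof. by rewrite diagonal_form_seq seq_formK// size_nseq. Qed.

Lemma ptws_nbhsP k (v : 'I_k -> E) (B : set ('I_k -> E)) :
  nbhs (v : {ptws 'I_k -> E}) B <-> exists2 d : R, 0 < d &
    forall w, (forall i, rnorm (v i - w i) < d) -> B w.
Proof.
pose ball d := [set w : 'I_k -> E | forall i, rnorm (v i - w i) < d].
pose FF := filter_from [set d : R | 0 < d] ball.
have FFF : Filter FF.
  apply: filter_from_filter; first by exists (1 : R); exact: (@ltr01 R).
  move=> d d' /= d0 d'0; exists (Num.min d d'); first by rewrite /= lt_min d0.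
  by move=> w /= wP; split=> i; have := wP i; rewrite lt_min => /andP[].
split=> [vB|[d d0 dB]].
  have : {ptws, FF --> v}.
    apply/ptws_cvgP => i; apply/cvg_rnormP => e e0.
    by exists e => // w /= /(_ i).
  by move=> /(_ _ vB)[d d0 dB]; exists d.
have FN : Filter (nbhs (v : {ptws 'I_k -> E})) by exact: nbhs_filter.
have H i : nbhs (v : {ptws 'I_k -> E}) [set w | rnorm (v i - w i) < d].
  have := (@ptws_cvgP 'I_k E (nbhs (v : {ptws 'I_k -> E})) v FN).1 (fun _ h => h) i.
  by move=> /(@cvg_rnormP _ _ _ _ _)/(_ d d0).
by apply: (@filterS _ _ FN _ _ dB); exact: (@filter_forall _ _ _ _ FN H).
Qed.

Lemma ptws_continuousP k (L : ('I_k -> E) -> R[i]^o) :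
  continuous (L : {ptws 'I_k -> E} -> R[i]^o) <->
  forall v (e : R), 0 < e -> exists2 d : R, 0 < d &
    forall w, (forall i, rnorm (v i - w i) < d) -> modc (L v - L w) < e.
Proof.
have FN (v : {ptws 'I_k -> E}) : Filter (fmap (L : {ptws 'I_k -> E} -> R[i]^o) (nbhs v)).
  have FN : Filter (nbhs v) by exact: nbhs_filter.
  exact: (@fmap_filter _ _ L _ FN).
split=> [cL v e e0|cL v].
  exact: (@ptws_nbhsP k v _).1 ((@cvg_rnormP R R[i]^o _ (FN v) (L v)).1 (cL v) e e0).
apply: (@cvg_rnormP R R[i]^o _ (FN v) (L v)).2 => e e0.
exact: (@ptws_nbhsP k v _).2 (cL v e e0).
Qed.

Lemma cont_form_mlf k (L : ('I_k -> E) -> R[i]^o) : multilinear L ->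
  continuous (L : {ptws 'I_k -> E} -> R[i]^o) -> mlf k (form_seq L).
Proof.
move=> mL cL.
have lF : slotlin k (form_seq L).
  move=> s t c x y stk.
  have sk : (size s < k)%N by rewrite -stk ltnS leq_addr.
  pose v (i : 'I_k) := nth 0 (s ++ 0 :: t) i.
  have E1 z : form_seq L (s ++ z :: t) = L (fun j => if j == Ordinal sk then z else v j).
    rewrite /form_seq; congr L; apply/funext => j.
    rewrite /v !nth_cat -val_eqE /=; case: ltngtP => [js|sj|->]; last by rewrite subnn.
      by [].
    by case: (j - size s)%N (subn_gt0 (size s) j) => //; rewrite sj.
  by rewrite !E1; exact: mL.
split=> //.
have [d d0 dP] := (@ptws_continuousP k L).1 cL (fun=> 0) 1 ltr01.
pose M := modc (L (fun=> 0)) + 1.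
have d2 : 0 < d / 2 by rewrite divr_gt0.
exists (M / (d / 2) ^+ k).
  by rewrite divr_ge0 ?exprn_ge0 ?ltW// ltr_wpDl ?modc_ge0.
apply: bdd_ball => // s sk sd.
rewrite (le_trans (ler_modc_dist _ (L (fun=> 0))))// lerD2l.
rewrite modcBC; apply/ltW/dP => i; rewrite sub0r rnormN.
rewrite (@le_lt_trans _ _ (d / 2))//; last by rewrite ltr_pdivrMr// ltr_pMr// ltr1n.
by apply: sd; rewrite mem_nth// sk.
Qed.

Lemma cont_sym_form_smf k (L : ('I_k -> E) -> R[i]^o) :
  cont_sym_form L -> smf k (form_seq L).
Proof.
move=> [mL sL cL]; split; first exact: cont_form_mlf.
move=> s t sk st; have tk : size t = k by rewrite -(perm_size st).
have /(perm_iotaP 0)[Is IsP sE] := st.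
have IsS : size Is = k by rewrite (perm_size IsP) size_iota.
have Isk (i : 'I_k) : (nth 0%N Is i < k)%N.
  have : nth 0%N Is i \in Is by rewrite mem_nth// IsS.
  by rewrite (perm_mem IsP) mem_iota tk.
have inj : injective (fun i : 'I_k => Ordinal (Isk i)).
  move=> i j /(congr1 val)/= /eqP.
  by rewrite nth_uniq ?IsS// ?(perm_uniq IsP) ?iota_uniq// => /eqP/val_inj.
rewrite /form_seq -[RHS](sL (perm inj)); congr L; apply/funext => i /=.
by rewrite permE /= sE (nth_map 0%N) ?IsS.
Qed.

Lemma seq_form_multilinear k F : slotlin k F -> multilinear (seq_form k F).
Proof.
move=> lF v i; rewrite /seq_form.
pose s := [seq v j | j <- take i (enum 'I_k)].
pose t := [seq v j | j <- drop i.+1 (enum 'I_k)].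
have ik : (i < size (enum 'I_k))%N by rewrite size_enum_ord.
have sS : size s = i by rewrite size_map size_takel// ltnW.
have E1 x : [seq (if j == i then x else v j) | j <- enum 'I_k] = s ++ x :: t.
  rewrite -{1}(cat_take_drop i (enum 'I_k)) map_cat (drop_nth i ik) /=.
  rewrite nth_ord_enum eqxx; congr (_ ++ _ :: _).
    apply/eq_in_map => j /(nthP i)[m]; rewrite (size_takel (ltnW ik)) => mi.
    rewrite nth_take// => <-; rewrite -val_eqE /= nth_enum_ord ?ltn_eqF//.
    exact: ltn_trans mi _.
  apply/eq_in_map => j /(nthP i)[m]; rewrite size_drop size_enum_ord => mi.
  rewrite nth_drop => <-; rewrite -val_eqE /= nth_enum_ord.
    by rewrite gtn_eqF// ltn_addr.
  by move: mi; rewrite ltn_subRL.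
move=> c x y; rewrite !E1 lF//.
rewrite sS size_map size_drop size_enum_ord -addnS subnSK// subnKC//.
exact: ltnW.
Qed.

Lemma seq_form_continuous k F : mlf k F ->
  continuous (seq_form k F : {ptws 'I_k -> E} -> R[i]^o).
Proof.
move=> mF; apply: (@ptws_continuousP k _).2 => v e e0.
have vS : size [seq v i | i <- enum 'I_k] = k by rewrite size_map size_enum_ord.
have [d d0 dP] := mlf_cont mF vS e0; exists d => // w vw.
apply: dP => [|i ik]; first by rewrite size_map size_enum_ord.
by rewrite !(nth_enum_map _ (Ordinal ik)); exact: vw.
Qed.

Lemma smf_cont_sym_form k F : smf k F -> cont_sym_form (seq_form k F).
Proof.
move=> [mF sF]; split; last exact: seq_form_continuous.
  by apply: seq_form_multilinear; case: mF.
move=> p v; rewrite /seq_form; apply: sF.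
  by rewrite size_map size_enum_ord.
rewrite (map_comp v p).
apply: perm_map; apply: uniq_perm.
- by rewrite map_inj_uniq ?enum_uniq//; exact: perm_inj.
- exact: enum_uniq.
- move=> i; rewrite mem_enum /=; apply/mapP; exists (p^-1%g i); rewrite ?mem_enum//.
  by rewrite permKV.
Qed.

(** Symmetrization does not change the polynomial of a form; it supplies the
    symmetric forms of products of functionals and of iterated derivatives. *)
Definition symmetrize k (L : ('I_k -> E) -> R[i]^o) : ('I_k -> E) -> R[i]^o :=
  fun v => (k`!%:R : C)^-1 * \sum_(p : 'S_k) L (v \o p).

Lemma fact_neq0 k : (k`!%:R : C) != 0.
Proof. by rewrite pnatr_eq0 -lt0n fact_gt0. Qed.

Lemma diagonal_symmetrize k (L : ('I_k -> E) -> R[i]^o) :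
  Defs.diagonal (symmetrize L) = Defs.diagonal L.
Proof.
apply/funext => x; rewrite /Defs.diagonal /symmetrize.
rewrite (eq_bigr (fun=> L (fun=> x))) // sumr_const card_Sn.
by rewrite -[X in _ * X]mulr_natl mulKf// fact_neq0.
Qed.

Lemma cont_sym_form_symmetrize k (L : ('I_k -> E) -> R[i]^o) : multilinear L ->
  continuous (L : {ptws 'I_k -> E} -> R[i]^o) -> cont_sym_form (symmetrize L).
Proof.
move=> mL cL; split.
- move=> v i a x y; rewrite /symmetrize.
  have E1 (p : 'S_k) z : L ((fun j => if j == i then z else v j) \o p) =
      L (fun j => if j == (p^-1)%g i then z else (v \o p) j).
    congr L; apply/funext => j /=; congr (if _ then _ else _).
    by apply/eqP/eqP => [<-|->]; rewrite ?permK ?permKV.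
  rewrite scalerAr -mulrDr; congr (_ * _); rewrite scaler_sumr -big_split /=.
  by apply: eq_bigr => p _; rewrite !E1; exact: mL.
- move=> q v; rewrite /symmetrize; congr (_ * _).
  rewrite (reindex_inj (mulIg q^-1)%g) /=.
  apply: eq_bigr => p _; congr L; apply/funext => j /=.
  by rewrite permM permKV.
- apply: (@ptws_continuousP k _).2 => v e e0.
  pose N : R := #|'S_k|%:R + 1.
  have N0 : 0 < N by rewrite ltr_wpDl.
  have eN : 0 < e / N by rewrite divr_gt0.
  have H (p : 'S_k) : exists d : R, 0 < d /\ forall w,
      (forall i, rnorm (v i - w i) < d) -> modc (L (v \o p) - L (w \o p)) < e / N.
    have [d d0 dP] := (@ptws_continuousP k L).1 cL (v \o p) _ eN.
    by exists d; split=> // w vw; apply: dP => i /=; exact: vw.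
  have [d dP] := choice H.
  exists (\big[Num.min/1]_(p : 'S_k) d p).
    by apply: lt_bigmin => // p _; have [] := dP p.
  move=> w vw; rewrite /symmetrize -mulrBr -sumrB.
  rewrite modcM modcV modc_nat.
  have k1 : (k`!%:R : R)^-1 <= 1 by rewrite invf_le1 ?ler1n ?ltr0n fact_gt0.
  apply: (@le_lt_trans _ _ (\sum_(p : 'S_k) e / N)).
    apply: (@le_trans _ _ (modc (\sum_(p : 'S_k) (L (v \o p) - L (w \o p))))).
      by rewrite ler_piMl ?modc_ge0.
    rewrite (le_trans (ler_modc_sum _ _ _))//; apply: ler_sum => p _.
    apply/ltW; have [_ +] := dP p; apply => i; apply: lt_le_trans (vw i) _.
    exact: bigmin_le_cond.
  rewrite sumr_const -mulr_natr mulrAC -mulrA gtr_pMr// -/N.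
  by rewrite ltr_pdivrMr// mul1r /N ltrDl.
Qed.

End Forms.

Arguments seq_form {R E} k F.

(** * Homogeneous polynomials and polarization *)
Section Polarization.
Context {R : realType} {E : normedModType R[i]}.
Local Notation C := R[i].
Implicit Types (F G : seq E -> C) (s t : seq E) (x y u : E) (n k : nat).

Lemma smf_binomial n F u x : smf n F -> F (nseq n (u + x)) =
  \sum_(j < n.+1) 'C(n, j)%:R * F (nseq j x ++ nseq (n - j) u).
Proof.
elim: n F => [|n ih] F sF; first by rewrite big_ord1 bin0 mul1r.
have [[lF _] pF] := sF.
rewrite /= (slotlinD _ _ lF) ?size_nseq//.
rewrite (ih _ (smf_cons u sF)) (ih _ (smf_cons x sF)).
pose a j := F (nseq j x ++ nseq (n.+1 - j) u).
have -> : \sum_(j < n.+1) 'C(n, j)%:R * F (u :: nseq j x ++ nseq (n - j) u) =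
    \sum_(j < n.+1) 'C(n, j)%:R * a j.
  apply: eq_bigr => j _; congr (_ * _); apply: pF.
    by rewrite /= size_cat !size_nseq subnKC// -ltnS.
  rewrite (subSn (_ : (j <= n)%N)) /=; last by rewrite -ltnS.
  by rewrite perm_sym -cat1s perm_catCA.
have -> : \sum_(j < n.+1) 'C(n, j)%:R * F (x :: nseq j x ++ nseq (n - j) u) =
    \sum_(j < n.+1) 'C(n, j)%:R * a j.+1 by [].
rewrite [RHS]big_ord_recl bin0 -/(a 0%N).
rewrite [X in _ = _ + X](eq_bigr (fun j : 'I_n.+1 =>
    'C(n, j.+1)%:R * a j.+1 + 'C(n, j)%:R * a j.+1)); last first.
  by move=> j _; rewrite binS natrD mulrDl.
rewrite big_split /= addrA; congr (_ + _).
by rewrite big_ord_recl [in RHS]big_ord_recr /= bin0 bin_small// mul0r addr0.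
Qed.

Lemma slotlin_nseqZ n F (l : C) j x t : slotlin n F -> (j + size t)%N = n ->
  F (nseq j (l *: x) ++ t) = l ^+ j * F (nseq j x ++ t).
Proof.
elim: j n F => [|j ih] n F lF jn; first by rewrite expr0 mul1r.
case: n lF jn => // n lF [jn] /=.
rewrite (slotlinZ _ _ lF); last by rewrite size_cat size_nseq.
by rewrite (ih n (fun s => F (x :: s)) (slotlin_cons x lF) jn) exprS mulrA.
Qed.

Lemma cdiffD (f g : C -> C) z :
  cdiff f z -> cdiff g z -> cdiff (fun w => f w + g w) z.
Proof.
rewrite !cdiffP => df dg.
exact: (@differentiableD _ R[i]^o R[i]^o (f : R[i]^o -> R[i]^o) (g : R[i]^o -> R[i]^o)).
Qed.

Lemma cdiff_poly n (a : nat -> C) z : cdiff (fun l : C => \sum_(j < n) l ^+ j * a j) z.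
Proof.
elim: n => [|n ih].
  by under eq_fun do rewrite big_ord0; exact: cdiff_cst.
under eq_fun do rewrite big_ord_recr /=.
apply: cdiffD => //; apply: cdiffM; last exact: cdiff_cst.
apply: cdiffX; have := cdiff_lin 0 1 z; under eq_fun do rewrite add0r mul1r.
exact.
Qed.

Lemma ccoef_poly n (a : nat -> C) i :
  ccoef i (fun l : C => \sum_(j < n) l ^+ j * a j) = if (i < n)%N then a i else 0.
Proof.
elim: n i a => [|n ih] i a.
  under eq_fun do rewrite big_ord0.
  by case: i => [|i]; rewrite ?ccoef0_cst ?ccoef_cst.
have -> : (fun l : C => \sum_(j < n.+1) l ^+ j * a j) =
    (fun l => a 0%N + l * \sum_(j < n) l ^+ j * a j.+1).
  apply/funext => l; rewrite big_ord_recl expr0 mul1r mulr_sumr; congr (_ + _).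
  by apply: eq_bigr => j _; rewrite /= exprS mulrA.
have c := cdiff_ccont (cdiff_poly n (fun j => a j.+1)).
rewrite ccoefD; [|exact: ccont_cst|by apply: ccontM => //; exact: ccont_id].
case: i => [|i]; last by rewrite ccoef_cst add0r ccoef_shift (ih i (fun j => a j.+1)).
rewrite ccoef0_cst ccoef0 ?mul0r ?addr0// => z.
apply: cdiffM; last exact: (cdiff_poly n (fun j => a j.+1)).
by have := cdiff_lin 0 1 z; under eq_fun do rewrite add0r mul1r.
Qed.

Lemma smf_line n F u x (l : C) : smf n F -> F (nseq n (u + l *: x)) =
  \sum_(j < n.+1) l ^+ j * ('C(n, j)%:R * F (nseq j x ++ nseq (n - j) u)).
Proof.
move=> sF; rewrite (smf_binomial _ _ sF); apply: eq_bigr => j _.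
have [[lF _] _] := sF.
rewrite (slotlin_nseqZ l x lF) ?size_nseq ?subnKC//; last by rewrite -ltnS.
by rewrite mulrCA.
Qed.

Lemma gol_diag n F : smf n F -> gol (fun x => F (nseq n x)).
Proof.
move=> sF; split.
  move=> x y z; rewrite /line; under eq_fun do rewrite (smf_line _ _ _ sF).
  exact: (cdiff_poly _ (fun j => 'C(n, j)%:R * F (nseq j y ++ nseq (n - j) x))).
move=> r; have [[_ [M M0 bF]] _] := sF; exists (M * r ^+ n) => x xr.
by apply: (bdd_max M0 bF); rewrite ?size_nseq// => y /nseqP[->].
Qed.

Lemma homog_diag n F : smf n F -> homog n (fun x => F (nseq n x)).
Proof.
move=> [[lF _] _] l x _; have := @slotlin_nseqZ n F l n x [::] lF (addn0 n).
by rewrite !cats0.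
Qed.

Lemma dir_diag n F u x : smf n.+1 F ->
  dir (fun x => F (nseq n.+1 x)) u x = n.+1%:R * F (x :: nseq n u).
Proof.
move=> sF; rewrite /dir /line; under eq_fun do rewrite (smf_line _ _ _ sF).
rewrite (ccoef_poly _ (fun j => 'C(n.+1, j)%:R * F (nseq j x ++ nseq (n.+1 - j) u))).
by rewrite /= bin1 subn1.
Qed.

(** Polarization: a form is controlled by its restriction to the diagonal, in
    any gauge for which rotated sums satisfy the triangle inequality. Freezing
    one argument amounts to differentiating the polynomial, which is averaging
    it over circles. *)
Lemma smf_polar n F (p : E -> R) (e r : R) : smf n F ->
  p 0 = 0 -> (forall u x (l : C), modc l = 1 -> p (u + l *: x) <= p u + p x) ->
  0 <= r -> 0 <= e ->
  (forall w, p w <= n%:R * r -> modc (F (nseq n w)) <= e) ->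
  forall s, size s = n -> (forall x, x \in s -> p x <= r) -> modc (F s) <= e.
Proof.
move=> + p0 pD r0 e0; elim: n F => [|n ih] F sF Fe s sn sr.
  by move/size0nil: sn => ->; apply: (Fe 0); rewrite p0 mul0r.
case: s sn sr => // x s [sn] sr.
apply: (ih (fun s => F (x :: s))) => //; first exact: smf_cons.
  move=> w wr.
  have n1 : 1 <= n.+1%:R :> R by rewrite ler1n.
  rewrite -(ler_pM2l (_ : 0 < n.+1%:R))// -{1}(modc_nat n.+1) -modcM.
  rewrite -(dir_diag w x sF) (@le_trans _ _ e)//; last by rewrite ler_peMl.
  apply: ccoef_bound; first by apply: gol_ccont; exact: gol_diag.
  move=> l l1; apply: Fe; rewrite (le_trans (pD _ _ _ l1))// -natr1 mulrDl mul1r.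
  by rewrite lerD// sr// inE eqxx.
by move=> y ys; apply: sr; rewrite inE ys orbT.
Qed.

(** Polarization in the zero gauge. *)
Lemma smf_diag_eq0 n F : smf n F -> (forall x, F (nseq n x) = 0) ->
  forall s, size s = n -> F s = 0.
Proof.
move=> sF F0 s sn; apply: modc_eq0; apply/eqP; rewrite eq_le modc_ge0 andbT.
apply: (smf_polar (p := fun=> 0) (r := 0) sF) => // w _.
by rewrite F0 modc0.
Qed.

Lemma slotlin_sub n F G : slotlin n F -> slotlin n G ->
  slotlin n (fun s => F s - G s).
Proof. by move=> lF lG s t c x y st; rewrite lF// lG//; ring. Qed.

Lemma mlf_sub n F G : mlf n F -> mlf n G -> mlf n (fun s => F s - G s).
Proof.
move=> [lF [M M0 bF]] [lG [N N0 bG]]; split; first exact: slotlin_sub.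
exists (M + N) => [|s sn]; first by rewrite addr_ge0.
by rewrite mulrDl (le_trans (ler_modcB _ _))// lerD ?bF ?bG.
Qed.

Lemma smf_sub n F G : smf n F -> smf n G -> smf n (fun s => F s - G s).
Proof.
move=> [mF sF] [mG sG]; split; first exact: mlf_sub.
by move=> s t sn st; rewrite (sF s t)// (sG s t).
Qed.

Lemma smf_diag_inj n F G : smf n F -> smf n G ->
  (forall x, F (nseq n x) = G (nseq n x)) -> forall s, size s = n -> F s = G s.
Proof.
move=> sF sG FG s sn; apply/eqP; rewrite -subr_eq0; apply/eqP.
by apply: (smf_diag_eq0 (smf_sub sF sG)) => // x; rewrite FG subrr.
Qed.

Lemma sym_form_inj k (L L' : ('I_k -> E) -> R[i]^o) :
  cont_sym_form L -> cont_sym_form L' -> Defs.diagonal L = Defs.diagonal L' ->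
  L = L'.
Proof.
move=> cL cL' LL'; apply/funext => v; rewrite -(form_seqK L) -(form_seqK L').
apply: (smf_diag_inj (cont_sym_form_smf cL) (cont_sym_form_smf cL')).
  by move=> x; rewrite -!diagonal_form_seq LL'.
by rewrite size_map size_enum_ord.
Qed.

(** The symmetric form comes from the [k]-fold directional derivatives at the
    origin of the [k]-th Taylor term, divided by [k] factorial. *)
Lemma taylor_term_form (f : E -> C) k : gol f -> exists L : ('I_k -> E) -> R[i]^o,
  cont_sym_form L /\ Defs.diagonal L = taylor_term f k.
Proof.
move=> gf; pose P := taylor_term f k.
have gP : gol P := @gol_taylor_term _ _ f k gf.
have hP : homog k P := @homog_taylor_term _ _ f k gf.
pose F s : C := (k`!%:R)^-1 * dirs s P 0.
have lF : slotlin k F.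
  by move=> s t c x y _; rewrite /F dirs_slot//; ring.
have mF : mlf k F.
  split=> //; have [M MP] := dirs_bound k gP.
  exists (Num.max M 0); first by rewrite le_max lexx orbT.
  rewrite -[Num.max M 0]divr1 -(expr1n _ k); apply: bdd_ball => // s sk s1.
  rewrite /F modcM modcV modc_nat.
  have k1 : (k`!%:R : R)^-1 <= 1 by rewrite invf_le1 ?ler1n ?ltr0n fact_gt0.
  rewrite (le_trans (ler_piMl (modc_ge0 _) k1))// le_max.
  by rewrite MP.
exists (symmetrize (seq_form k F)); split.
  apply: cont_sym_form_symmetrize; last exact: seq_form_continuous.
  exact: seq_form_multilinear.
rewrite diagonal_symmetrize; apply/funext => x.
by rewrite diagonal_seq_form /F dirs_diag// mulrA mulVf ?mul1r// fact_neq0.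
Qed.

End Polarization.

(** * Topologies and spaces of functions in terms of real bounds *)
Section Glue.
Context {R : realType}.
Local Notation C := R[i].

Lemma bounded_nearP T (V : normedModType R[i]) (f : T -> V) (A : set T) :
  [bounded f x | x in A] <-> exists M : R, forall x, A x -> rnorm (f x) <= M.
Proof.
split=> [[M [Mr MP]]|[M MP]].
  have Mr1 : M + 1 \is Num.real by rewrite realD// real1.
  exists (complex.Re (M + 1)) => x Ax; rewrite -lecR rnormE RRe_real//.
  by apply: (MP (M + 1)) => //; rewrite ltrDl.
exists M%:C; split; first by apply/complex_realP; exists M.
by move=> N MN x Ax /=; rewrite -rnormE (le_trans _ (ltW MN))// lecR MP.
Qed.

Lemma bounded_setP (V : normedModType R[i]) (A : set V) :
  bounded_set A <-> exists M : R, forall x, A x -> rnorm x <= M.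
Proof. exact: (@bounded_nearP V V id). Qed.

Lemma entourageP (B : set (R[i]^o * R[i]^o)) :
  entourage B <-> exists2 e : R, 0 < e & forall x y, modc (x - y) < e -> B (x, y).
Proof.
rewrite -entourage_ballE; split=> [[e/= e0 eB]|[e e0 eB]].
  have er : (complex.Re e)%:C = e by rewrite RRe_real ?gtr0_real.
  exists (complex.Re e); first by rewrite -ltcR er.
  by move=> x y xy; apply: eB; rewrite /= -ball_normE/= -modcE -er ltcR.
exists e%:C; first by rewrite /= ltcR.
by move=> [x y]; rewrite /= -ball_normE/= -modcE ltcR => /eB.
Qed.

Lemma uniform_cvgP (U : choiceType) (A : set U) (F : set_system (U -> R[i]^o)) (f : U -> R[i]^o) :
  Filter F -> {uniform A, F --> f} <->
  forall e : R, 0 < e -> F [set g | forall x, A x -> modc (f x - g x) < e].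
Proof.
move=> FF; split=> [Ff e e0|Ff B].
  apply: Ff; apply/uniform_nbhs; exists [set xy | modc (xy.1 - xy.2) < e].
  by split=> //; apply/entourageP; exists e.
move=> /uniform_nbhs[E [/entourageP[e e0 eE] sE]].
by apply: filterS (Ff e e0) => g gP; apply: sE => x Ax; apply/eE/gP.
Qed.

(** The topology of uniform convergence on the members of a directed family of
    sets has the expected basis of neighbourhoods. *)
Lemma family_nbhsP (U : choiceType) (fam : set U -> Prop) (f : U -> R[i]^o)
    (B : set (U -> R[i]^o)) :
  (exists A, fam A) -> (forall A1 A2, fam A1 -> fam A2 -> fam (A1 `|` A2)) ->
  nbhs (f : {family fam, U -> R[i]^o}) B <-> exists A (e : R), [/\ fam A, 0 < e &
    forall g, (forall x, A x -> modc (f x - g x) < e) -> B g].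
Proof.
move=> [A0 fA0] famU.
pose D := [set Ae : set U * R | fam Ae.1 /\ 0 < Ae.2].
pose W (Ae : set U * R) := [set g : U -> R[i]^o | forall x, Ae.1 x -> modc (f x - g x) < Ae.2].
pose FF := filter_from D W.
have FFF : Filter FF.
  apply: filter_from_filter; first by exists (A0, 1); split => //=.
  move=> [A e] [A' e'] /= [fA e0] [fA' e'0]; exists (A `|` A', Num.min e e').
    by split=> /=; [exact: famU|rewrite lt_min e0].
  move=> g gP; split=> x Ax.
    by have := gP x (or_introl Ax); rewrite /= lt_min => /andP[].
  by have := gP x (or_intror Ax); rewrite /= lt_min => /andP[].
split.
  have : {family fam, FF --> f}.
    apply/fam_cvgP => A fA; apply/uniform_cvgP => e e0.
    by exists (A, e).
  by move=> h /h[[A e] [/= fA e0] AB]; exists A, e; split.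
move=> [A [e [fA e0 AB]]].
have entE : entourage [set xy : R[i]^o * R[i]^o | modc (xy.1 - xy.2) < e].
  by apply/entourageP; exists e.
have := @fam_nbhs U R[i]^o fam A _ f entE fA.
by apply: filterS.
Qed.

End Glue.

Section HolomorphicBoundedType.
Context {R : realType} {E : normedModType R[i]}.
Local Notation C := R[i].
Implicit Types (f : E -> R[i]^o) (x y : E) (U A : set E).

Lemma dual_predI (V : normedModType R[i]) (f : V -> R[i]^o) (M : R) : linear f ->
  (forall v, modc (f v) <= M * rnorm v) -> f \in @dual_pred R V.
Proof.
move=> lf fM; apply/dual_predP; split=> // x; apply/cvg_rnormP => e e0.
have N0 : 0 < Num.max M 0 + 1 by rewrite ltr_wpDl// le_max lexx orbT.
apply/nbhs_rnormP; exists (e / (Num.max M 0 + 1)); first by rewrite divr_gt0.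
move=> y; rewrite ltr_pdivlMr// => /(le_lt_trans _); apply.
have -> : f x - f y = f (x - y).
  by have := lf (-1) y x; rewrite scaleN1r (addrC (- y)) => ->; rewrite scaleN1r addrC.
rewrite (le_trans (fM _))// mulrC ler_wpM2l ?rnorm_ge0//.
by rewrite (@le_trans _ _ (Num.max M 0)) ?lerDl// le_max lexx.
Qed.

Lemma Hb_gol f : Hb setT f -> gol (f : E -> C).
Proof.
move=> [df bf]; split=> [x y l|r].
  apply/cdiffP.
  have d1 : differentiable (fun l : R[i]^o => x + l *: y) (l : R[i]^o).
    apply: (@differentiableD _ R[i]^o E (cst x) (fun l : R[i]^o => l *: y)) => //.
  exact: (@differentiable_comp _ R[i]^o E R[i]^o _ f _ d1 (df _ I)).
have : U_bounded setT [set x : E | rnorm x <= r].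
  split=> //; first by apply/bounded_setP; exists r.
  by exists 1 => // a y _ /(_ I).
by move=> /bf/bounded_nearP.
Qed.

(** The directional derivatives at [x] form a linear functional, bounded by
    Cauchy's estimate, and the remainder is of second order uniformly in the
    direction ([gol_deriv]). *)
Lemma gol_differentiable f x : gol (f : E -> C) -> differentiable f x.
Proof.
move=> gf.
have lin : linear (fun v : E => dir (f : E -> C) x v : R[i]^o).
  by move=> a v w; rewrite dir_add// dir_scale.
have [K K0 KP] := gol_deriv gf (rnorm x + 1).
have [M M0 MP] := gol_bound gf (rnorm x + 1).
have bd v : modc (dir (f : E -> C) x v) <= M * rnorm v.
  have [->|v0] := eqVneq v 0.
    by rewrite -(scale0r (0 : E)) dir_scale// mul0r modc0 scale0r rnorm0 mulr0.
  have vp : 0 < rnorm v by rewrite rnorm_gt0.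
  pose w := ((rnorm v)^-1)%:C *: v.
  have w1 : rnorm w = 1.
    by rewrite rnormZ modcR ger0_norm ?invr_ge0 ?(ltW vp)// mulVf ?gt_eqF.
  have -> : v = (rnorm v)%:C *: w.
    by rewrite scalerA -rmorphM mulfV ?gt_eqF// rmorph1 scale1r.
  rewrite dir_scale// modcM modcR ger0_norm ?(ltW vp)// rnormZ w1 modcR ger0_norm ?(ltW vp)//.
  rewrite mulr1 mulrC ler_wpM2r ?(ltW vp)//; apply: dir_bound => // h.
  by rewrite w1 => h1; apply: MP; rewrite (le_trans (ler_rnormD _ _))// lerD2l.
pose df := MkDual (dual_predI lin bd).
have dfE : f \o shift x = cst (f x) + (df : E -> R[i]^o) +o_ 0 id.
  apply/eqaddoP => eps eps0.
  have er : (complex.Re eps)%:C = eps by rewrite RRe_real ?gtr0_real.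
  have e0 : 0 < complex.Re eps by rewrite -ltcR er.
  pose d := Num.min (1 / 2) (complex.Re eps / (K + 1)).
  have K1 : 0 < K + 1 by rewrite ltr_wpDl.
  apply/nbhs_rnormP; exists d; first by rewrite lt_min !divr_gt0.
  move=> v; rewrite sub0r rnormN lt_min (ltr_pdivlMr _ _ K1) => /andP[v1 v2] /=.
  rewrite -er -(rnormE v) -rmorphM -modcE lecR.
  have -> : ((f \o shift x) - (cst (f x) + (df : E -> R[i]^o))) v =
      f (x + v) - f x - dir (f : E -> C) x v.
    by rewrite !fctE /= [v + x]addrC opprD addrA.
  have [->|v0] := eqVneq v 0.
    rewrite addr0 subrr sub0r modcN -(scale0r (0 : E)) dir_scale// mul0r modc0.
    by rewrite scale0r rnorm0 mulr0.
  have vp : 0 < rnorm v by rewrite rnorm_gt0.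
  pose w := ((rnorm v)^-1)%:C *: v.
  have w1 : rnorm w = 1.
    by rewrite rnormZ modcR ger0_norm ?invr_ge0 ?(ltW vp)// mulVf ?gt_eqF.
  have vE : v = (rnorm v)%:C *: w.
    by rewrite scalerA -rmorphM mulfV ?gt_eqF// rmorph1 scale1r.
  have := KP x w (rnorm v)%:C; rewrite -vE -dir_scale// -vE modcR ger0_norm ?(ltW vp)//.
  move=> H; apply: (le_trans (H _ _ _)).
  - by rewrite lerDl.
  - by rewrite w1 lerDr rnorm_ge0.
  - exact: ltW.
  rewrite expr2 mulrA ler_wpM2r ?(ltW vp)//.
  apply: le_trans (ltW v2); rewrite mulrC ler_wpM2l ?rnorm_ge0//.
  by rewrite lerDl.
have dE := diff_unique (@dual_continuous R E df) dfE.
apply/diff_locallyP; rewrite dE; split=> //.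
exact: dual_continuous.
Qed.

Lemma gol_Hb U f : gol (f : E -> C) -> Hb U f.
Proof.
move=> gf; split=> [x _|A [_ /bounded_setP[M MP] _]].
  exact: gol_differentiable.
apply/bounded_nearP; have [N _ NP] := gol_bound gf M.
by exists N => x /MP/NP.
Qed.

Lemma Hb_setT U f : Hb setT f -> Hb U f.
Proof. by move/Hb_gol/gol_Hb; exact. Qed.

Lemma Hb_dual U (g : Dual E) : Hb U g.
Proof.
apply: gol_Hb; split=> [x y l|r].
  have -> : line (g : E -> C) x y = fun l => g x + g y * l.
    by apply/funext => z; rewrite /line linearD linearZ mulrC.
  exact: cdiff_lin.
have [M gM] := dual_bounded g; exists (Num.max M 0 * r) => x xr.
have M0 : 0 <= Num.max M 0 by rewrite le_max lexx orbT.
rewrite (le_trans (gM x))// (@le_trans _ _ (Num.max M 0 * rnorm x))//.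
  by rewrite ler_wpM2r ?rnorm_ge0// le_max lexx.
by rewrite ler_wpM2l.
Qed.

(** ** Taylor expansions *)
Lemma taylor_forms_exist f : Hb setT f ->
  exists L, taylor_forms f L /\ forall k, Defs.diagonal (L k) = taylor_term (f : E -> C) k.
Proof.
move=> /Hb_gol gf; have [M M0 MP] := taylor_term_cvg gf 1.
have [L LP] : exists L : forall k, ('I_k -> E) -> R[i]^o, forall k,
    cont_sym_form (L k) /\ Defs.diagonal (L k) = taylor_term (f : E -> C) k.
  exists (fun k => projT1 (cid (taylor_term_form k gf))) => k.
  exact: (projT2 (cid (taylor_term_form k gf))).
exists L; split; last by move=> k; have [] := LP k.
split; first by move=> k; have [] := LP k.
exists 1 => //; apply/uniform_cvgP => e e0.
have [n nP] := ex_pow2_lt M e0; exists n => // m /= nm x /= x1.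
apply: le_lt_trans nP; apply: le_trans (_ : M / 2 ^+ m <= _); last first.
  by rewrite ler_wpM2l// lef_pV2 ?posrE ?exprn_gt0// ler_eXn2l// ltr1n.
rewrite (eq_bigr (fun k : 'I_m => taylor_term (f : E -> C) k x)); last first.
  by move=> k _; have [_ ->] := LP k.
by apply: MP; exact: ltW.
Qed.

Lemma diagonalZ k (L : ('I_k -> E) -> R[i]^o) (l : C) x : cont_sym_form L ->
  Defs.diagonal L (l *: x) = l ^+ k * Defs.diagonal L x.
Proof.
move=> cL; have [[lF _] _] := cont_sym_form_smf cL.
rewrite !diagonal_form_seq.
by have := @slotlin_nseqZ _ _ k _ l k x [::] lF (addn0 k); rewrite !cats0.
Qed.

(** The Taylor series at the origin is unique: the coefficients of polynomials
    that converge uniformly to [0] on the unit circle converge to [0]. *)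
Lemma taylor_forms_uniq f (L L' : forall k, ('I_k -> E) -> R[i]^o) :
  taylor_forms f L -> taylor_forms f L' -> forall k, L k = L' k.
Proof.
move=> [cL [r r0 Lf]] [cL' [r' r'0 Lf']] k.
apply: sym_form_inj => //; apply/funext => x.
pose D j y : C := Defs.diagonal (L j) y - Defs.diagonal (L' j) y.
have DZ j (l : C) y : D j (l *: y) = l ^+ j * D j y.
  by rewrite /D !diagonalZ// mulrBr.
suff Dx y : rnorm y < Num.min r r' -> D k y = 0.
  pose t := Num.min r r' / (rnorm x + 1).
  have m0 : 0 < Num.min r r' by rewrite lt_min r0.
  have x1 : 0 < rnorm x + 1 by rewrite ltr_wpDl ?rnorm_ge0.
  have t0 : 0 < t by rewrite divr_gt0.
  have := Dx (t%:C *: x); rewrite rnormZ modcR ger0_norm ?(ltW t0)// => /(_ _)/wrap[|].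
    by rewrite /t mulrAC ltr_pdivrMr// ltr_pM2l// ltrDl.
  rewrite DZ => /eqP; rewrite mulf_eq0 expf_eq0 (negbTE (_ : t%:C != 0)) ?andbF/=.
    by rewrite subr_eq0 => /eqP.
  by rewrite -modc_gt0 modcR normr_gt0 gt_eqF.
rewrite lt_min => /andP[yr yr'].
apply: modc_eq0; apply/eqP; rewrite eq_le modc_ge0 andbT.
apply/ler_addgt0Pr => e e0; rewrite add0r.
have e2 : 0 < e / 2 by rewrite divr_gt0.
move: Lf => /uniform_cvgP/(_ _ e2)[n1 _ n1P].
move: Lf' => /uniform_cvgP/(_ _ e2)[n2 _ n2P].
pose n := (n1 + n2 + k.+1)%N.
have nk : (k < n)%N by rewrite /n ltn_addl.
have := ccoef_poly n (fun j => D j y) k; rewrite nk => <-.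
apply: ccoef_bound; first by apply: cdiff_ccont; exact: (cdiff_poly n (fun j => D j y)).
move=> l l1.
have -> : \sum_(j < n) l ^+ j * D j y =
    (f (l *: y) - \sum_(j < n) Defs.diagonal (L' j) (l *: y)) -
    (f (l *: y) - \sum_(j < n) Defs.diagonal (L j) (l *: y)).
  rewrite opprB [RHS]addrC addrA subrK -sumrB.
  by apply: eq_bigr => j _; rewrite -DZ.
have lyr : rnorm (l *: y) < r by rewrite rnormZ l1 mul1r.
have lyr' : rnorm (l *: y) < r' by rewrite rnormZ l1 mul1r.
have n1n : (n1 <= n)%N by rewrite /n -addnA leq_addr.
have n2n : (n2 <= n)%N by rewrite /n addnAC leq_addl.
have := n1P n n1n _ lyr; have := n2P n n2n _ lyr' => /= h1 h2.
by rewrite (le_trans (ler_modcB _ _))// [e]splitr lerD// ltW.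
Qed.

End HolomorphicBoundedType.

(** * The Aron-Berner extension *)
Section AronBernerExtension.
Context {R : realType} {E : normedModType R[i]}.
Local Notation C := R[i].
Implicit Types (F G : seq E -> R[i]^o) (x y : E) (z : Dual (Dual E)).

Lemma dual_sumE (I : Type) (r : seq I) (g : I -> Dual E) x :
  (\sum_(i <- r) g i) x = \sum_(i <- r) g i x.
Proof. by elim/big_ind2: _ => // f1 f2 g1 g2 <- <-. Qed.

Lemma dual_eq_fun (f g : Dual E) : (forall x, f x = g x) -> f = g.
Proof. by move=> fg; apply: val_inj; apply/funext. Qed.

(** Finitely many functionals have coordinates given by evaluation at points,
    as in Gaussian elimination. *)
Lemma dual_coordinates (fs : seq (Dual E)) : exists ps : seq (E * Dual E),
  forall f, f \in fs -> f = \sum_(p <- ps) f p.1 *: p.2.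
Proof.
elim: fs => [|f fs [ps psP]]; first by exists [::].
pose w := f - \sum_(p <- ps) f p.1 *: p.2.
have [w0|w0] := eqVneq w 0.
  exists ps => g; rewrite inE => /orP[/eqP->|/psP//].
  by apply/eqP; rewrite -subr_eq0; apply/eqP.
have [e we] : exists e, w e != 0.
  apply: contrapT => ne; move/eqP: w0; apply; apply: dual_eq_fun => x.
  by apply/eqP/negPn/negP => wx; apply: ne; exists x.
pose e1 := (w e)^-1 *: e.
have we1 : w e1 = 1 by rewrite linearZ /= -[_ *: _]/(_ * _) mulVf.
pose e2 := e1 - \sum_(p <- ps) p.2 e1 *: p.1.
exists ((e2, w) :: ps) => g gf; rewrite big_cons /=.
have ge2 : g e2 = (g - \sum_(p <- ps) g p.1 *: p.2) e1.
  rewrite /e2 linearB linear_sum /= -[RHS]/(g e1 - (\sum_(p <- ps) g p.1 *: p.2) e1).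
  rewrite dual_sumE; congr (_ - _); apply: eq_bigr => p _.
  by rewrite linearZ /= -[_ *: _]/(_ * _) mulrC.
rewrite ge2; move: gf; rewrite inE => /orP[/eqP->|gf].
  by rewrite -/w we1 scale1r subrK.
by rewrite -(psP g gf) subrr -[(0 : Dual E) e1]/(0 : R[i]^o) scale0r add0r.
Qed.

(** Hence the weak-star filters are proper, and the iterated limits unique. *)
Lemma weak_star_dense z (fs : seq (Dual E)) :
  exists x, forall f, f \in fs -> f x = z f.
Proof.
have [ps psP] := dual_coordinates fs.
exists (\sum_(p <- ps) z p.2 *: p.1) => f /psP fE.
rewrite [in RHS]fE !linear_sum; apply: eq_bigr => p _.
by rewrite !linearZ /= -![_ *: _]/(_ * _) mulrC.
Qed.

Lemma weak_star_nbhs_dense z B :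
  nbhs ((z : Dual E -> R[i]^o) : {ptws Dual E -> R[i]^o}) B ->
  exists fs : seq (Dual E), forall h : Dual E -> R[i]^o,
    (forall f, f \in fs -> h f = z f) -> B h.
Proof.
pose W (fs : seq (Dual E)) :=
  [set h : Dual E -> R[i]^o | forall f, f \in fs -> h f = z f].
pose FF := filter_from setT W.
have FFF : Filter FF.
  apply: filter_from_filter; first by exists [::].
  move=> s t _ _; exists (s ++ t) => // h hP; split=> f ff; apply: hP.
    by rewrite mem_cat ff.
  by rewrite mem_cat ff orbT.
have Fz : FF --> ((z : Dual E -> R[i]^o) : {ptws Dual E -> R[i]^o}).
  apply: (@ptws_cvgP (Dual E) R[i]^o FF z FFF).2 => f.
  apply/cvg_rnormP => e e0; exists [:: f] => // h /= hP.
  by rewrite hP ?inE// subrr rnorm0.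
by move=> zB; have [fs _ fsB] := Fz B zB; exists fs.
Qed.

Lemma weak_star_filter z : ProperFilter (weak_star_nbhs z).
Proof.
have FN : Filter (nbhs ((z : Dual E -> R[i]^o) : {ptws Dual E -> R[i]^o})).
  exact: nbhs_filter.
apply: filter_from_proper.
  apply: filter_from_filter; first by exists setT; exact: (@filterT _ _ FN).
  by move=> A B nA nB; exists (A `&` B) => //; exact: (@filterI _ _ FN).
move=> B /weak_star_nbhs_dense[fs fsB].
by have [x xP] := weak_star_dense z fs; exists x; apply: fsB.
Qed.

Lemma weak_star_cvg z (g : Dual E) :
  ((fun x => g x) @ weak_star_nbhs z) --> (z g : R[i]^o).
Proof.
have FN : Filter (nbhs ((z : Dual E -> R[i]^o) : {ptws Dual E -> R[i]^o})).
  exact: nbhs_filter.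
have FW := weak_star_filter z.
apply/cvg_rnormP => e e0.
have /(_ g) Fg := (@ptws_cvgP (Dual E) R[i]^o _ z FN).1 (fun _ h => h).
have := (@cvg_rnormP R R[i]^o _ _ (z g)).1 Fg e e0.
move=> zB; exists [set h : Dual E -> R[i]^o | rnorm (z g - h g) < e].
  exact: zB.
by move=> x.
Qed.

Lemma rnorm_dual (V : normedModType R[i]) (f : Dual V) : rnorm f = dual_norm f.
Proof. by []. Qed.

Lemma iterated_lim_ext F G zs : (forall s, size s = size zs -> F s = G s) ->
  iterated_lim F zs = iterated_lim G zs.
Proof.
elim: zs F G => [|z zs ih] F G FG /=; first exact: FG.
have -> // : (fun x => iterated_lim (fun s => F (x :: s)) zs) =
    (fun x => iterated_lim (fun s => G (x :: s)) zs).
by apply/funext => x; apply: ih => s ss; apply: FG; rewrite /= ss.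
Qed.

Definition zprod (zs : seq (Dual (Dual E))) : R := \prod_(z <- zs) dual_norm z.

Lemma zprod_ge0 zs : 0 <= zprod zs.
Proof. by rewrite /zprod; apply: prodr_ge0 => z _; exact: dual_norm_ge0. Qed.

Lemma slotlin_lin n (a : C) F G : slotlin n (F : seq E -> C) -> slotlin n (G : seq E -> C) ->
  slotlin n (fun s => a * F s + G s : C).
Proof. by move=> lF lG s t c x y st; rewrite lF// lG//; ring. Qed.

Lemma mlf_lin n (a : C) F G : mlf n (F : seq E -> C) -> mlf n (G : seq E -> C) ->
  mlf n (fun s => a * F s + G s : C).
Proof.
move=> [lF [M M0 bF]] [lG [N N0 bG]]; split; first exact: slotlin_lin.
exists (modc a * M + N) => [|s sn]; first by rewrite addr_ge0 ?mulr_ge0 ?modc_ge0.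
rewrite mulrDl (le_trans (ler_modcD _ _))// lerD ?bG// modcM -mulrA.
by rewrite ler_wpM2l ?modc_ge0 ?bF.
Qed.

Lemma mlf0 n : mlf n ((fun=> 0) : seq E -> C).
Proof.
split; first by move=> s t c x y _; rewrite mulr0 addr0.
by exists 0 => // s _; rewrite modc0 mul0r.
Qed.

Definition iter_bounded zs := forall F (M : R), 0 <= M ->
  slotlin (size zs) (F : seq E -> C) -> bdd (size zs) (F : seq E -> C) M ->
  modc (iterated_lim F zs) <= M * zprod zs.

Definition iter_linear zs := forall (a : C) F G,
  mlf (size zs) (F : seq E -> C) -> mlf (size zs) (G : seq E -> C) ->
  iterated_lim (fun s => a * F s + G s) zs = a * iterated_lim F zs + iterated_lim G zs.

(** The innermost limit of a multilinear form is a value of a bounded functional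
    on the dual, so by induction all the iterated limits exist. *)
Lemma iterated_lim_step z zs F (M : R) : iter_bounded zs -> iter_linear zs ->
  0 <= M -> slotlin (size zs).+1 (F : seq E -> C) -> bdd (size zs).+1 (F : seq E -> C) M ->
  exists g : Dual E, [/\ forall x, g x = iterated_lim (fun s => F (x :: s)) zs,
    dual_norm g <= M * zprod zs & iterated_lim F (z :: zs) = z g].
Proof.
move=> bz lz M0 lF bF.
have mF : mlf (size zs).+1 (F : seq E -> C) by split=> //; exists M.
have lin : linear (fun x => iterated_lim (fun s => F (x :: s)) zs : R[i]^o).
  move=> a x y; rewrite -[RHS]/(a * iterated_lim (fun s => F (x :: s)) zs +
    iterated_lim (fun s => F (y :: s)) zs) -lz; do ?exact: mlf_cons.
  apply: iterated_lim_ext => s sz.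
  by rewrite (slotlinD _ _ lF)// (slotlinZ _ _ lF).
have bd x : modc (iterated_lim (fun s => F (x :: s)) zs) <= M * zprod zs * rnorm x.
  rewrite mulrAC; apply: bz; first by rewrite mulr_ge0 ?rnorm_ge0.
    exact: slotlin_cons.
  move=> s sz; rewrite -mulrA -(big_cons _ _ _ _ xpredT).
  by apply: bF; rewrite /= sz.
pose g := MkDual (dual_predI lin bd).
exists g; split=> //.
  by apply: dual_norm_le => //; rewrite mulr_ge0 ?zprod_ge0.
have FW := weak_star_filter z.
have -> : iterated_lim F (z :: zs) = lim ((fun x => g x) @ weak_star_nbhs z) by [].
exact: (@cvg_lim R[i]^o (@norm_hausdorff _ R[i]^o) E (weak_star_nbhs z) FW
  (g : E -> R[i]^o) (z g) (@weak_star_cvg z g)).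
Qed.

Lemma iterated_lim_bounded_linear zs : iter_bounded zs /\ iter_linear zs.
Proof.
elim: zs => [|z zs [bz lz]].
  split=> [F M M0 _ /(_ [::] erefl)|//]; first by rewrite /zprod !big_nil.
split=> [F M M0 lF bF|a F G mF mG].
  have [g [_ gM ->]] := iterated_lim_step z bz lz M0 lF bF.
  rewrite (le_trans (dual_normP z g))// rnorm_dual /zprod big_cons.
  by rewrite mulrCA ler_wpM2l ?dual_norm_ge0.
have [lF [M M0 bF]] := mF; have [lG [N N0 bG]] := mG.
have [lH [K K0 bH]] := mlf_lin a mF mG.
have [f [fE _ ->]] := iterated_lim_step z bz lz M0 lF bF.
have [g [gE _ ->]] := iterated_lim_step z bz lz N0 lG bG.
have [h [hE _ ->]] := iterated_lim_step z bz lz K0 lH bH.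
suff -> : h = a *: f + g by rewrite linearP.
apply: dual_eq_fun => x; rewrite hE -[RHS]/(a * f x + g x) fE gE.
by rewrite lz//; exact: mlf_cons.
Qed.

Lemma iterated_lim_cons z zs F : mlf (size zs).+1 (F : seq E -> C) ->
  exists2 g : Dual E, forall x, g x = iterated_lim (fun s => F (x :: s)) zs &
    iterated_lim F (z :: zs) = z g.
Proof.
move=> [lF [M M0 bF]]; have [bz lz] := iterated_lim_bounded_linear zs.
by have [g [gE _ zE]] := iterated_lim_step z bz lz M0 lF bF; exists g.
Qed.

Lemma iterated_lim_emb F s : mlf (size s) (F : seq E -> C) ->
  iterated_lim F [seq bidual_emb x | x <- s] = F s.
Proof.
elim: s F => [|x s ih] F mF //=; rewrite -[size (x :: s)]/(size s).+1 in mF.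
have mF' : mlf (size [seq bidual_emb x | x <- s]).+1 (F : seq E -> C) by rewrite size_map.
have [g gE] := iterated_lim_cons (bidual_emb x) mF'; rewrite /= => ->.
by rewrite /= gE ih//; exact: mlf_cons.
Qed.

(** The product of finitely many functionals in independent variables. *)
Fixpoint tens (hs : seq (Dual E)) (s : seq E) : R[i]^o :=
  if hs is h :: hs' then if s is x :: s' then h x * tens hs' s' else 1 else 1.

Lemma mlf_tens hs : mlf (size hs) (tens hs : seq E -> C).
Proof.
elim: hs => [|h hs [lF [M M0 bF]]].
  by split; [by move=> s t c x y|exists 1 => // s /size0nil->; rewrite big_nil modc1 mulr1].
split=> [[|w s] t c x y /= [st]|].
- by rewrite linearP /= -[_ *: _]/(_ * _); ring.
- by rewrite lF//; ring.
- exists (dual_norm h * M) => [|[|x s]//= [sn]]; first by rewrite mulr_ge0 ?dual_norm_ge0.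
  rewrite modcM big_cons mulrACA ler_pM ?modc_ge0//; first exact: dual_normP.
  exact: bF.
Qed.

Lemma iterated_lim_tens z hs :
  iterated_lim (tens hs) (nseq (size hs) z) = \prod_(h <- hs) z h.
Proof.
elim: hs => [|h hs ih]; first by rewrite big_nil.
have mT : mlf (size (nseq (size hs) z)).+1 (tens (h :: hs) : seq E -> C).
  by rewrite size_nseq; exact: (mlf_tens (h :: hs)).
have [g gE] := iterated_lim_cons z mT; rewrite /= => ->.
have [_ lz] := iterated_lim_bounded_linear (nseq (size hs) z).
have mh : mlf (size (nseq (size hs) z)) (tens hs : seq E -> C).
  by rewrite size_nseq; exact: mlf_tens.
have m0 : mlf (size (nseq (size hs) z)) (fun=> 0 : C) := mlf0 _.
have -> : g = (\prod_(h <- hs) z h : C) *: h.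
  apply: dual_eq_fun => x; rewrite gE -[RHS]/(_ * h x) -ih.
  have := lz (h x) _ _ mh m0; rewrite (_ : iterated_lim (fun=> 0) _ = 0); last first.
    have := lz 0 _ _ m0 m0; rewrite mul0r add0r.
    have := lz 1 _ _ m0 m0; under eq_fun do rewrite mulr0 addr0.
    by rewrite mul1r => /eqP; rewrite -subr_eq0 opprD addrA subrr sub0r oppr_eq0 => /eqP.
  rewrite addr0 mulrC => <-; apply: iterated_lim_ext => s _ /=.
  by rewrite addr0.
by rewrite linearZ big_cons /= -[_ *: _]/(_ * _) mulrC.
Qed.

(** ** The extension of forms and polynomials *)
Lemma bidual_formE k (L : ('I_k -> E) -> R[i]^o) z :
  bidual_form L (fun=> z) = iterated_lim (form_seq L) (nseq k z).
Proof.
rewrite /bidual_form; congr iterated_lim.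
by rewrite -[in RHS](size_enum_ord k); elim: (enum 'I_k) => //= i s ->.
Qed.

Lemma bidual_form_emb k (L : ('I_k -> E) -> R[i]^o) x : cont_sym_form L ->
  bidual_form L (fun=> bidual_emb x) = Defs.diagonal L x.
Proof.
move=> cL; rewrite bidual_formE diagonal_form_seq.
have [mF _] := cont_sym_form_smf cL.
rewrite -(iterated_lim_emb (s := nseq k x)); last by rewrite size_nseq.
by rewrite map_nseq.
Qed.

Lemma bidual_form_bound k (L : ('I_k -> E) -> R[i]^o) z (M : R) :
  cont_sym_form L -> 0 <= M -> bdd k (form_seq L) M ->
  modc (bidual_form L (fun=> z)) <= M * dual_norm z ^+ k.
Proof.
move=> cL M0 bL; have [[lF _] _] := cont_sym_form_smf cL.
have [bz _] := iterated_lim_bounded_linear (nseq k z).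
rewrite bidual_formE.
have -> : dual_norm z ^+ k = zprod (nseq k z).
  by rewrite /zprod; elim: (k) => [|j ih]; rewrite ?big_nil// exprS ih big_cons.
by apply: bz; rewrite ?size_nseq.
Qed.

Lemma iterated_lim_sum (I : finType) zs (F : I -> seq E -> R[i]^o) :
  (forall i, mlf (size zs) (F i : seq E -> C)) ->
  iterated_lim (fun s => \sum_i F i s) zs = \sum_i iterated_lim (F i) zs.
Proof.
move=> mF; have [_ lz] := iterated_lim_bounded_linear zs.
have m0 : mlf (size zs) (fun=> 0 : C) := mlf0 _.
suff [] : mlf (size zs) (fun s => \sum_i F i s : C) /\
  iterated_lim (fun s => \sum_i F i s) zs = \sum_i iterated_lim (F i) zs by [].
rewrite -big_enum /=; under eq_fun do rewrite -big_enum /=.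
elim: (enum I) => [|i r [ih1 ih2]].
  under eq_fun do rewrite big_nil; split=> //; rewrite big_nil.
  have := lz 1 _ _ m0 m0; under eq_fun do rewrite mulr0 addr0.
  by rewrite mul1r => /eqP; rewrite -subr_eq0 opprD addrA subrr sub0r oppr_eq0 => /eqP.
under eq_fun do rewrite big_cons -[X in X + _]mul1r.
split; first exact: mlf_lin.
by rewrite lz// big_cons mul1r ih2.
Qed.

End AronBernerExtension.

(** * Continuous homomorphisms *)
Section Homomorphisms.
Context {R : realType} {E : normedModType R[i]}.
Local Notation C := R[i].
Implicit Types (f g : E -> R[i]^o) (x y : E) (z : Dual (Dual E)) (U A : set E).

Lemma U_bounded0 U : U_bounded U set0.
Proof.
split=> //; first by apply/bounded_setP; exists 0.
by exists 1.
Qed.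

Lemma U_boundedU U A B : U_bounded U A -> U_bounded U B -> U_bounded U (A `|` B).
Proof.
move=> [AU /bounded_setP[M MP] [r r0 rP]] [BU /bounded_setP[N NP] [s s0 sP]].
split; first by move=> x [/AU|/BU].
  apply/bounded_setP; exists (Num.max M N) => x [/MP h|/NP h].
    by rewrite le_max h.
  by rewrite le_max h orbT.
exists (Num.min r s); first by rewrite lt_min r0.
move=> a y [aA|aB] Uy; first by rewrite (le_trans _ (rP a y aA Uy))// ge_min lexx.
by rewrite (le_trans _ (sP a y aB Uy))// ge_min lexx orbT.
Qed.

Lemma Hb_cst U (c : C) : Hb U (fun=> c : R[i]^o).
Proof.
apply: gol_Hb; split=> [x y l|r]; first exact: cdiff_cst.
by exists (modc c).
Qed.

Lemma golM (f g : E -> C) : gol f -> gol g -> gol (fun x => f x * g x).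
Proof.
move=> gf gg; split=> [x y l|r].
  by apply: cdiffM; exact: gol_line.
have [M M0 MP] := gol_bound gf r; have [N N0 NP] := gol_bound gg r.
by exists (M * N) => x xr; rewrite modcM ler_pM ?modc_ge0 ?MP ?NP.
Qed.

Lemma Mb_lin U phi (c : C) f g : Mb U phi -> Hb U f -> Hb U g ->
  phi (fun x => c * f x + g x) = c * phi f + phi g.
Proof. by move=> [lin _ _ _]; exact: lin. Qed.

Lemma Mb0 U phi : Mb U phi -> phi (fun=> 0) = 0.
Proof.
move=> Mphi; have H0 := Hb_cst U 0.
have := Mb_lin 1 Mphi H0 H0; under eq_fun do rewrite mulr0 addr0.
by rewrite mul1r => /eqP; rewrite -subr_eq0 opprD addrA subrr sub0r oppr_eq0 => /eqP.
Qed.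

(** Homogeneity turns a neighbourhood of the zero function on which [phi] stays
    below [1] into an estimate. *)
Lemma Mb_bound U phi : Mb U phi -> exists A (K : R), [/\ U_bounded U A, 0 < K &
  forall f (e : R), Hb U f -> 0 < e -> (forall x, A x -> modc (f x) <= e) ->
    modc (phi f) <= K * e].
Proof.
move=> Mphi; have [_ _ _ cont] := Mphi.
have H0 := Hb_cst U 0; have phi0 := Mb0 Mphi.
move: cont => /subspace_continuousP/(_ _ H0).
have FW : Filter (within (Hb U : set {family U_bounded U, E -> R[i]^o})
    (nbhs ((fun=> 0) : {family U_bounded U, E -> R[i]^o}))).
  exact: within_filter.
move=> /(@cvg_rnormP R R[i]^o _ (@fmap_filter _ _ phi _ FW) _)/(_ 1 ltr01).
move=> /(@family_nbhsP R E (U_bounded U) (fun=> 0)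
  [set f | Hb U f -> modc (phi (fun=> 0) - phi f) < 1]) [].
- by exists set0; exact: U_bounded0.
- by move=> *; exact: U_boundedU.
move=> A [d [bA d0 dP]].
exists A, (2 / d); split=> //; first by rewrite divr_gt0.
move=> f e Hf e0 fe.
pose c : C := (d / (2 * e))%:C.
have de : 0 < d / (2 * e) by rewrite divr_gt0// mulr_gt0.
have mc : modc c = d / (2 * e) by rewrite modcR gtr0_norm.
have Hcf : Hb U (fun x => c * f x + 0 : R[i]^o).
  have [df bf] := Hf; split=> [x Ux|B /bf/bounded_nearP[M MP]].
    under eq_fun do rewrite addr0.
    exact: (@differentiableM _ E (cst c) f x (differentiable_cst _ _) (df x Ux)).
  apply/bounded_nearP; exists (modc c * M) => x Bx.
  by rewrite addr0 modcM ler_wpM2l ?modc_ge0 ?MP.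
have phic : phi (fun x => c * f x + 0) = c * phi f.
  by rewrite (Mb_lin _ Mphi Hf H0) phi0 addr0.
have := dP (fun x => c * f x + 0) _ Hcf; rewrite phi0 phic sub0r modcN modcM mc.
move=> /(_ _)/wrap[|].
  move=> x /fe fx; rewrite addr0 sub0r modcN modcM mc.
  rewrite (le_lt_trans (ler_wpM2l (ltW de) fx))//.
  by rewrite invfM mulrA divfK ?gt_eqF// ltr_pdivrMr// ltr_pMr// ltr1n.
have -> : 2 / d * e = (d / (2 * e))^-1 by field; rewrite !gt_eqF.
by rewrite mulrC -ltr_pdivlMr// div1r => /ltW.
Qed.

Lemma Mb1 U phi : Mb U phi -> phi (fun=> 1) = 1.
Proof.
move=> [_ mul [f Hf f0] _].
have := mul f (fun=> 1) Hf (Hb_cst U 1); under eq_fun do rewrite mulr1.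
by move=> /eqP; rewrite -{1}[phi f]mulr1 (inj_eq (mulfI f0)) => /eqP <-.
Qed.

Lemma MbZ U phi (c : C) f : Mb U phi -> Hb U f -> phi (fun x => c * f x) = c * phi f.
Proof.
move=> Mphi Hf; have := Mb_lin c Mphi Hf (Hb_cst U 0).
by under eq_fun do rewrite addr0; rewrite (Mb0 Mphi) addr0.
Qed.

Lemma MbD U phi f g : Mb U phi -> Hb U f -> Hb U g ->
  phi (fun x => f x + g x) = phi f + phi g.
Proof.
move=> Mphi Hf Hg; have := Mb_lin 1 Mphi Hf Hg.
by under eq_fun do rewrite mul1r; rewrite mul1r.
Qed.

Lemma MbM U phi f g : Mb U phi -> Hb U f -> Hb U g ->
  phi (fun x => f x * g x) = phi f * phi g.
Proof. by move=> [_ mul _ _]; exact: mul. Qed.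

Lemma gol_taylor_sum f n : gol (f : E -> C) ->
  gol (fun x => \sum_(k < n) taylor_term (f : E -> C) k x).
Proof.
move=> gf; elim: n => [|n ih].
  under eq_fun do rewrite big_ord0.
  by split=> [x y l|r]; [exact: cdiff_cst|exists 0 => x _; rewrite modc0].
under eq_fun do rewrite big_ord_recr /=.
by apply: golD => //; exact: gol_taylor_term.
Qed.

(** The Taylor series converges uniformly on the bounded set that controls [phi]. *)
Lemma Mb_taylor U phi f : Mb U phi -> Hb setT f ->
  series (fun k => phi (taylor_term (f : E -> C) k) : R[i]^o) @ \oo --> phi f.
Proof.
move=> Mphi Hf; have gf := Hb_gol Hf.
have [A [K [[_ /bounded_setP[r rP] _] K0 KP]]] := Mb_bound Mphi.
have [M M0 MP] := taylor_term_cvg gf r.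
have gS n := gol_taylor_sum n gf.
have sE n : series (fun k => phi (taylor_term (f : E -> C) k) : R[i]^o) n =
    phi (fun x => \sum_(k < n) taylor_term (f : E -> C) k x).
  rewrite /series /= big_mkord; elim: n => [|n ih].
    by rewrite big_ord0; under eq_fun do rewrite big_ord0; rewrite (Mb0 Mphi).
  rewrite big_ord_recr ih /=; under [in RHS]eq_fun do rewrite big_ord_recr /=.
  rewrite (MbD Mphi)//; apply: gol_Hb; [exact: gS|exact: gol_taylor_term].
apply/cvg_rnormP => e e0.
have [n nP] := ex_pow2_lt (K * (M + 1)) e0; exists n => // m /= nm.
rewrite sE.
have -> : phi f - phi (fun x => \sum_(k < m) taylor_term (f : E -> C) k x) =
    phi (fun x => f x + -1 * \sum_(k < m) taylor_term (f : E -> C) k x).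
  rewrite (MbD Mphi) ?(MbZ _ Mphi) ?mulN1r//; try exact: Hb_setT; try exact: gol_Hb.
  by apply: gol_Hb; exact: golZ.
have p2 j : 0 < 2 ^+ j :> R by rewrite exprn_gt0.
apply: le_lt_trans nP.
apply: (@le_trans _ _ (K * ((M + 1) / 2 ^+ m))); last first.
  rewrite mulrA ler_wpM2l ?mulr_ge0 ?addr_ge0 ?(ltW K0)//.
  by rewrite lef_pV2 ?posrE// ler_eXn2l// ltr1n.
apply: KP => [| |x /rP xr].
- by apply: gol_Hb; apply: golD => //; exact: golZ.
- by rewrite divr_gt0// ltr_wpDl.
- rewrite mulN1r (le_trans (MP x m xr))// ler_wpM2r ?invr_ge0 ?(ltW (p2 _))//.
  by rewrite lerDl.
Qed.

(** ** Finite type polynomials *)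
Definition mono (m : C * seq (Dual E)) x : R[i]^o := m.1 * \prod_(h <- m.2) h x.

Lemma finite_type_monos Q : finite_type_polynomial Q ->
  exists ms : seq (C * seq (Dual E)), Q = (fun x => \sum_(m <- ms) mono m x).
Proof.
elim=> {Q} [c|g|P Q _ [ms ->] _ [ns ->]|P Q _ [ms ->] _ [ns ->]].
- exists [:: (c, [::])]; apply/funext => x.
  by rewrite big_seq1 /mono big_nil mulr1.
- exists [:: (1, [:: g])]; apply/funext => x.
  by rewrite big_seq1 /mono big_seq1 mul1r.
- by exists (ms ++ ns); apply/funext => x; rewrite big_cat.
- exists [seq (m.1 * n.1, m.2 ++ n.2) | m <- ms, n <- ns].
  apply/funext => x; rewrite big_allpairs_dep /= mulr_suml.
  apply: eq_bigr => m _; rewrite mulr_sumr; apply: eq_bigr => n _.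
  by rewrite /mono /= big_cat /=; ring.
Qed.

Lemma gol_prod (hs : seq (Dual E)) : gol (fun x => \prod_(h <- hs) h x : C).
Proof.
elim: hs => [|h hs ih].
  under eq_fun do rewrite big_nil; exact: (Hb_gol (Hb_cst setT 1)).
under eq_fun do rewrite big_cons.
by apply: golM => //; exact: (Hb_gol (Hb_dual setT h)).
Qed.

Lemma gol_mono m : gol (mono m : E -> C).
Proof. exact: (golZ m.1 (gol_prod m.2)). Qed.

Lemma gol_sum (I : Type) (r : seq I) (P : pred I) (F : I -> E -> C) :
  (forall i, gol (F i)) -> gol (fun x => \sum_(i <- r | P i) F i x).
Proof.
move=> gF; elim: r => [|i r ih].
  under eq_fun do rewrite big_nil; exact: (Hb_gol (Hb_cst setT 0)).
under eq_fun do rewrite big_cons; case: (P i) => //.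
exact: golD.
Qed.

Lemma Mb_mono U phi z m : Mb U phi -> (forall g : Dual E, z g = phi g) ->
  phi (mono m) = m.1 * \prod_(h <- m.2) z h.
Proof.
move=> Mphi zphi; rewrite /mono (MbZ _ Mphi)//; last by apply: gol_Hb; exact: gol_prod.
congr (_ * _); elim: (m.2) => [|h hs ih].
  by under eq_fun do rewrite big_nil; rewrite big_nil (Mb1 Mphi).
under eq_fun do rewrite big_cons.
rewrite (MbM Mphi)// ?big_cons ?zphi ?ih//; first exact: Hb_dual.
by apply: gol_Hb; exact: gol_prod.
Qed.

Lemma ccoef_monomial i j (a : C) :
  ccoef i (fun l : C => l ^+ j * a) = if i == j then a else 0.
Proof.
pose b k := if k == j then a else 0.
have -> : (fun l : C => l ^+ j * a) = (fun l => \sum_(k < j.+1) l ^+ k * b k).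
  apply/funext => l; rewrite big_ord_recr /= big1 ?add0r ?/b ?eqxx//.
  by move=> k _; rewrite ltn_eqF// mulr0.
rewrite ccoef_poly /b ltnS; case: eqVneq => [->|ij]; first by rewrite leqnn.
by case: ifP.
Qed.

Lemma line_mono m x (l : C) : line (mono m : E -> C) 0 x l = l ^+ size m.2 * mono m x.
Proof.
rewrite /line /mono add0r mulrCA; congr (_ * _).
elim: (m.2) => [|h hs ih]; first by rewrite !big_nil mulr1.
by rewrite !big_cons ih linearZ /= exprS -[_ *: _]/(_ * _); ring.
Qed.

Lemma taylor_term_monos k (ms : seq (C * seq (Dual E))) x :
  taylor_term (fun x => \sum_(m <- ms) mono m x : C) k x =
  \sum_(m <- ms | size m.2 == k) mono m x.
Proof.
rewrite /taylor_term; elim: ms => [|m ms ih].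
  rewrite big_nil /line; under eq_fun do rewrite big_nil.
  by case: (k) => [|j]; rewrite ?ccoef0_cst ?ccoef_cst.
have -> : line (fun x => \sum_(m0 <- m :: ms) mono m0 x) 0 x =
    fun l => line (mono m : E -> C) 0 x l + line (fun x => \sum_(m <- ms) mono m x : C) 0 x l.
  by apply/funext => l; rewrite /line big_cons.
rewrite ccoefD; last 2 first.
- by apply: gol_ccont; exact: gol_mono.
- by apply: gol_ccont; apply: gol_sum => i; exact: gol_mono.
have -> : line (mono m : E -> C) 0 x = fun l => l ^+ size m.2 * mono m x.
  by apply/funext => l; exact: line_mono.
rewrite ih big_cons.
by rewrite ccoef_monomial eq_sym; case: eqP => // _; rewrite add0r.
Qed.

Lemma tens_prod (hs : seq (Dual E)) s : size s = size hs ->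
  tens hs s = \prod_(i < size hs) (nth 0 hs i) (nth 0 s i).
Proof.
elim: hs s => [|h hs ih] [|x s]//= => [_|[sh]]; first by rewrite big_ord0.
by rewrite big_ord_recl /= ih.
Qed.

Lemma smf_lin n (a : C) (F G : seq E -> C) : smf n F -> smf n G ->
  smf n (fun s => a * F s + G s).
Proof.
move=> [mF sF] [mG sG]; split; first exact: mlf_lin.
by move=> s t sn st; rewrite (sF s t)// (sG s t).
Qed.

Lemma cont_sym_form_lin k (a : C) (L L' : ('I_k -> E) -> R[i]^o) :
  cont_sym_form L -> cont_sym_form L' ->
  cont_sym_form (fun v => a * L v + L' v : R[i]^o).
Proof.
move=> cL cL'.
have := smf_cont_sym_form (smf_lin a (cont_sym_form_smf cL) (cont_sym_form_smf cL')).
suff -> : seq_form k (fun s => a * form_seq L s + form_seq L' s) =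
    (fun v => a * L v + L' v : R[i]^o) by [].
by apply/funext => v; rewrite -{2}(form_seqK L) -{2}(form_seqK L').
Qed.

Lemma bidual_form_lin k (a : C) (L L' : ('I_k -> E) -> R[i]^o) z :
  cont_sym_form L -> cont_sym_form L' ->
  bidual_form (fun v => a * L v + L' v : R[i]^o) (fun=> z) =
  a * bidual_form L (fun=> z) + bidual_form L' (fun=> z).
Proof.
move=> cL cL'; rewrite !bidual_formE.
have [_ lz] := iterated_lim_bounded_linear (nseq k z).
rewrite -lz ?size_nseq//.
  by case: (cont_sym_form_smf cL).
by case: (cont_sym_form_smf cL').
Qed.

Lemma mlfZ n (a : C) (F : seq E -> C) : mlf n F -> mlf n (fun s => a * F s).
Proof.
move=> mF; have := mlf_lin a mF (mlf0 n).
by under eq_fun do rewrite addr0.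
Qed.

(** The symmetric form whose polynomial is a product of functionals; its
    extension is the product of the extensions. *)
Lemma product_form (hs : seq (Dual E)) : exists L : ('I_(size hs) -> E) -> R[i]^o,
  [/\ cont_sym_form L, Defs.diagonal L = (fun x => \prod_(h <- hs) h x)
    & forall z, bidual_form L (fun=> z) = \prod_(h <- hs) z h].
Proof.
set k := size hs; pose L0 := seq_form k (tens hs).
have mT : mlf k (tens hs : seq E -> C) by exact: mlf_tens.
have [lT _] := mT.
exists (symmetrize L0); split.
- apply: cont_sym_form_symmetrize; [exact: seq_form_multilinear|exact: seq_form_continuous].
- rewrite diagonal_symmetrize; apply/funext => x; rewrite diagonal_seq_form.
  rewrite tens_prod ?size_nseq// (big_nth 0) big_mkord; apply: eq_bigr => i _.
  by rewrite nth_nseq ltn_ord.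
- move=> z; rewrite bidual_formE.
  pose G (p : 'S_k) := [seq nth 0 hs ((p^-1)%g i) | i <- enum 'I_k].
  have Gs p : size (G p) = k by rewrite size_map size_enum_ord.
  have E1 (p : 'S_k) s : size s = k -> L0 ((fun i : 'I_k => nth 0 s i) \o p) = tens (G p) s.
    move=> sk; rewrite /L0 /seq_form !tens_prod ?Gs//; last first.
      by rewrite size_map size_enum_ord.
    rewrite (reindex_inj (@perm_inj _ p^-1)%g) /=; apply: eq_bigr => i _.
    rewrite (nth_map i) ?size_enum_ord// nth_ord_enum /=.
    rewrite (nth_map i) ?size_enum_ord// nth_ord_enum /=.
    by rewrite permKV.
  have mG p : mlf (size (nseq k z)) (tens (G p) : seq E -> C).
    by rewrite size_nseq -{1}(Gs p); exact: mlf_tens.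
  have EG p : iterated_lim (tens (G p)) (nseq k z) = \prod_(h <- hs) z h.
    rewrite -{1}(Gs p) iterated_lim_tens /G big_map big_enum /=.
    rewrite (reindex_inj (@perm_inj _ p)) /=.
    rewrite (big_nth 0) big_mkord; apply: eq_bigr => i _.
    by rewrite permK.
  rewrite (iterated_lim_ext (G := fun s => \sum_p ((k`!%:R)^-1 * tens (G p) s))); last first.
    move=> s; rewrite size_nseq => sk; rewrite /form_seq /symmetrize mulr_sumr.
    by apply: eq_bigr => p _; rewrite E1.
  rewrite iterated_lim_sum; last by move=> p; exact: mlfZ.
  rewrite (eq_bigr (fun=> (k`!%:R)^-1 * \prod_(h <- hs) z h)); last first.
    move=> p _; have [_ lz] := iterated_lim_bounded_linear (nseq k z).
    have := lz (k`!%:R)^-1 _ _ (mG p) (mlf0 _).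
    have -> : iterated_lim (fun=> 0) (nseq k z) = 0 :> C.
      have := lz 1 _ _ (mlf0 _) (mlf0 _); under eq_fun do rewrite mulr0 addr0.
      by rewrite mul1r => /eqP; rewrite -subr_eq0 opprD addrA subrr sub0r oppr_eq0 => /eqP.
    by under eq_fun do rewrite addr0; rewrite addr0 EG.
  by rewrite sumr_const card_Sn -[LHS]mulr_natl mulrA mulfV ?mul1r// fact_neq0.
Qed.

Lemma monos_form k z (ms : seq (C * seq (Dual E))) : exists L : ('I_k -> E) -> R[i]^o,
  [/\ cont_sym_form L,
      Defs.diagonal L = (fun x => \sum_(m <- ms | size m.2 == k) mono m x)
    & bidual_form L (fun=> z) =
      \sum_(m <- ms | size m.2 == k) m.1 * \prod_(h <- m.2) z h].
Proof.
elim: ms => [|m ms [L [cL dL bL]]].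
  exists (seq_form k (fun=> 0 : C)); split.
  - apply: smf_cont_sym_form; split=> //; exact: mlf0.
  - by apply/funext => x; rewrite big_nil diagonal_seq_form.
  - rewrite big_nil; apply: modc_eq0; apply/eqP; rewrite eq_le modc_ge0 andbT.
    have := @bidual_form_bound R E k (seq_form k (fun=> 0 : C)) z 0.
    rewrite mul0r; apply => //.
      apply: smf_cont_sym_form; split=> //; exact: mlf0.
    by move=> s sk; rewrite seq_formK// modc0 mul0r.
case: (eqVneq (size m.2) k) => mk; last first.
  exists L; split=> //; first by rewrite dL; apply/funext => x; rewrite big_cons (negbTE mk).
  by rewrite big_cons (negbTE mk).
case: k / mk L cL dL bL => L cL dL bL.
have [L' [cL' dL' bL']] := product_form m.2.
exists (fun v => m.1 * L' v + L v : R[i]^o); split.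
- exact: cont_sym_form_lin.
- apply/funext => x; rewrite big_cons eqxx -[LHS]/(m.1 * Defs.diagonal L' x + Defs.diagonal L x).
  by rewrite dL dL'.
- by rewrite bidual_form_lin// bL bL' big_cons eqxx.
Qed.

(** A homomorphism on [Hb U] is determined on an approximable homogeneous
    polynomial by its restriction to the dual. The approximating polynomial may
    be taken homogeneous too, because the homogeneous parts of a polynomial are
    averages of it over circles. *)
Lemma Mb_form U phi z k (L : ('I_k -> E) -> R[i]^o) :
  finite_type_polynomials_dense E -> Mb U phi -> (forall g : Dual E, z g = phi g) ->
  cont_sym_form L -> phi (Defs.diagonal L) = bidual_form L (fun=> z).
Proof.
move=> dense Mphi zphi cL.
have [A [K [[_ /bounded_setP[r rP] _] K0 KP]]] := Mb_bound Mphi.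
pose r1 : R := Num.max r 0.
have r10 : 0 <= r1 by rewrite le_max lexx orbT.
(* the constant of polarization *)
pose N : R := k.+1%:R ^+ k.
have N0 : 0 < N by rewrite exprn_gt0.
pose B : R := K * (N * r1 ^+ k + 1) + N * dual_norm z ^+ k + 1.
have B0 : 0 < B.
  rewrite ltr_wpDl// addr_ge0 ?mulr_ge0 ?addr_ge0 ?mulr_ge0 ?exprn_ge0 ?dual_norm_ge0 ?(ltW N0)//.
  exact: ltW.
apply/eqP; rewrite -subr_eq0; apply/eqP/modc_eq0/eqP.
rewrite eq_le modc_ge0 andbT; apply/ler_addgt0Pr => e e0; rewrite add0r.
pose d := e / B; have d0 : 0 < d by rewrite divr_gt0.
have sL := cont_sym_form_smf cL.
pose P : E -> C := Defs.diagonal L.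
have PE : P = fun x => form_seq L (nseq k x) by apply/funext => x; exact: diagonal_form_seq.
have gP : gol P by rewrite PE; exact: gol_diag.
have pP : continuous_polynomial (P : E -> R[i]^o).
  exists k.+1, (fun j x => if j == k then P x else 0); split.
    move=> j; case: (eqVneq j k) => [->|jk]; first by exists L.
    exists (seq_form j (fun=> 0 : C)).
      apply: smf_cont_sym_form; split=> //; exact: mlf0.
    by apply/funext => x; rewrite diagonal_seq_form.
  apply/funext => x; rewrite big_ord_recr /= eqxx big1 ?add0r//.
  by move=> j _; rewrite ltn_eqF.
have [Q [Qf PQ]] : exists Q, finite_type_polynomial Q /\
    forall x, rnorm x <= 1 -> modc (P x - Q x) < d.
  have := dense _ pP [set Q | forall x, rnorm x <= 1 -> modc (P x - Q x) < d].
  move=> /(_ _)/wrap[|]; last by move=> [Q [Qf PQ]]; exists Q.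
  apply: (@family_nbhsP R E bounded_set P _ _ _).2.
  - by exists set0; apply/bounded_setP; exists 0.
  - move=> A1 A2 /bounded_setP[M MP] /bounded_setP[M' MP'].
    apply/bounded_setP; exists (Num.max M M') => x [/MP h|/MP' h].
      by rewrite le_max h.
    by rewrite le_max h orbT.
  - exists [set x | rnorm x <= 1], d; split=> //.
    by apply/bounded_setP; exists 1.
have [ms QE] := finite_type_monos Qf.
have [L' [cL' dL' bL']] := monos_form k z ms.
have sL' := cont_sym_form_smf cL'.
have gQ : gol (Q : E -> C) by rewrite QE; apply: gol_sum => m; exact: gol_mono.
pose D x : C := P x - Defs.diagonal L' x.
have gm : gol (fun x => \sum_(m <- ms | size m.2 == k) mono m x : C).
  by apply: gol_sum => m; exact: gol_mono.
have gD : gol D.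
  have -> : D = fun x => P x + -1 * (\sum_(m <- ms | size m.2 == k) mono m x : C).
    by apply/funext => x; rewrite /D dL' mulN1r.
  by apply: golD => //; exact: golZ.
(* [D] is the homogeneous part of degree [k] of [P - Q], hence as small as it *)
have DE x : D x = taylor_term (fun x => P x + -1 * Q x) k x.
  have -> : taylor_term (fun x => P x + -1 * Q x) k x =
      ccoef k (fun l => line P 0 x l + -1 * line (Q : E -> C) 0 x l) by [].
  have cP : ccont (line P 0 x) by exact: gol_ccont.
  have cQ : ccont (line (Q : E -> C) 0 x) by exact: gol_ccont.
  rewrite ccoefD//; last exact: ccontZ.
  rewrite ccoefZ// mulN1r -[ccoef k (line (Q : E -> C) 0 x)]/(taylor_term (Q : E -> C) k x).
  rewrite QE taylor_term_monos /D dL'; congr (_ - _).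
  have -> : line P 0 x = fun l => l ^+ k * P x.
    by apply/funext => l; rewrite /line add0r /P diagonalZ.
  by rewrite ccoef_monomial eqxx.
have Dd x : rnorm x <= 1 -> modc (D x) <= d.
  move=> x1; rewrite DE; apply: ccoef_bound.
    by apply: gol_ccont; apply: golD => //; exact: golZ.
  move=> l l1; rewrite /line mulN1r add0r; apply/ltW/PQ.
  by rewrite rnormZ l1 mul1r.
pose F s : C := form_seq L s - form_seq L' s.
have sF : smf k F by exact: smf_sub.
have FD x : F (nseq k x) = D x by rewrite /F -!diagonal_form_seq.
have bF : bdd k F (d * N).
  have -> : d * N = d / (k.+1%:R^-1) ^+ k by rewrite exprVn invrK.
  have [[lF _] _] := sF.
  apply: bdd_ball => //.
  apply: (smf_polar (p := @rnorm R E) sF) => //.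
  - exact: rnorm0.
  - by move=> u x l l1; rewrite (le_trans (ler_rnormD _ _))// rnormZ l1 mul1r.
  - exact: ltW.
  - move=> w wk; rewrite FD; apply: Dd; rewrite (le_trans wk)//.
    by rewrite ler_pdivrMr// mul1r ler_nat.
have h1 : modc (phi D) <= K * (d * (N * r1 ^+ k + 1)).
  apply: KP.
  - exact: gol_Hb.
  - by rewrite mulr_gt0// ltr_wpDl// mulr_ge0 ?exprn_ge0 ?(ltW N0).
  - move=> x /rP xr; rewrite -FD.
    have dN0 : 0 <= d * N by rewrite mulr_ge0 ?(ltW d0) ?(ltW N0).
    have h : modc (F (nseq k x)) <= d * N * r1 ^+ k.
      apply: (bdd_max dN0 bF); first exact: size_nseq.
      by move=> y /nseqP[-> _]; rewrite (le_trans xr)// le_max lexx.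
    rewrite (le_trans h)// -mulrA ler_wpM2l ?(ltW d0)//.
    by rewrite lerDl.
have h2 : modc (bidual_form L (fun=> z) - bidual_form L' (fun=> z)) <= d * N * dual_norm z ^+ k.
  have -> : bidual_form L (fun=> z) - bidual_form L' (fun=> z) =
      bidual_form (fun v => -1 * L' v + L v : R[i]^o) (fun=> z).
    by rewrite bidual_form_lin// mulN1r addrC.
  apply: bidual_form_bound; first exact: cont_sym_form_lin.
    by rewrite mulr_ge0 ?(ltW d0) ?(ltW N0).
  by move=> s sk; have := bF s sk; rewrite /F /form_seq mulN1r addrC.
have h3 : phi (Defs.diagonal L') = bidual_form L' (fun=> z).
  rewrite dL' bL'; elim: (ms) => [|m ms' ih].
    by under eq_fun do rewrite big_nil; rewrite big_nil (Mb0 Mphi).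
  under eq_fun do rewrite big_cons; rewrite big_cons; case: ifP => // _.
  rewrite (MbD Mphi) ?ih ?(Mb_mono m Mphi zphi)//; apply: gol_Hb; first exact: gol_mono.
  by apply: gol_sum => i; exact: gol_mono.
have h4 : phi (Defs.diagonal L) = phi D + phi (Defs.diagonal L').
  have -> : phi (Defs.diagonal L) = phi (fun x => D x + Defs.diagonal L' x).
    by congr phi; apply/funext => x; rewrite /D subrK.
  rewrite (MbD Mphi)//; last by rewrite dL'; exact: gol_Hb.
  exact: gol_Hb.
rewrite h4 h3.
have -> : phi D + bidual_form L' (fun=> z) - bidual_form L (fun=> z) =
    phi D - (bidual_form L (fun=> z) - bidual_form L' (fun=> z)) by ring.
apply: (le_trans (ler_modcB _ _)).
have -> : e = d * B by rewrite /d divfK ?gt_eqF.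
have -> : d * B = K * (d * (N * r1 ^+ k + 1)) + d * N * dual_norm z ^+ k + d.
  by rewrite /B; ring.
by rewrite ler_wpDr ?lerD// ltW.
Qed.

Lemma pi_Mb_sub_U_check U : finite_type_polynomials_dense E ->
  pi_Mb U `<=` U_check U.
Proof.
move=> dense z [phi Mphi zphi]; exists phi => // f Hf.
have [L [tL dL]] := taylor_forms_exist Hf; exists L => //.
have -> : (fun k => bidual_form (L k) (fun=> z)) =
    (fun k => phi (taylor_term (f : E -> C) k) : R[i]^o).
  apply/funext => k; rewrite -dL (Mb_form dense Mphi zphi)//.
  by have [cL _] := tL; exact: cL.
exact: (Mb_taylor Mphi Hf).
Qed.

(** By uniqueness the Taylor series of a functional has a linear term only. *)
Lemma aron_berner_dual (g : Dual E) z (w : R[i]^o) : aron_berner_value g z w -> w = z g.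
Proof.
move=> [L tL Lw].
have [L' [tL' dL']] := taylor_forms_exist (Hb_dual setT g).
have [cL _] := tL.
have dL k x : Defs.diagonal (L k) x = if k == 1%N then g x else 0.
  rewrite (taylor_forms_uniq tL tL') dL' /taylor_term.
  have -> : line (g : E -> C) 0 x = fun l => l ^+ 1 * g x.
    by apply/funext => l; rewrite /line add0r linearZ.
  by rewrite ccoef_monomial.
have L0 k : k != 1%N -> bidual_form (L k) (fun=> z) = 0.
  move=> k1; apply: modc_eq0; apply/eqP; rewrite eq_le modc_ge0 andbT.
  rewrite -(mul0r (dual_norm z ^+ k)); apply: bidual_form_bound => // s sk.
  rewrite mul0r (smf_diag_eq0 (cont_sym_form_smf (cL k)))// ?modc0// => x.
  by rewrite -diagonal_form_seq dL (negbTE k1).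
have L1 : bidual_form (L 1%N) (fun=> z) = z g.
  rewrite bidual_formE.
  have [mF _] := cont_sym_form_smf (cL 1%N).
  have [h hE ->] := iterated_lim_cons (zs := [::]) z mF.
  congr (z _); apply: dual_eq_fun => x; rewrite hE /=.
  by rewrite -(diagonal_form_seq (L 1%N) x) dL.
apply: (cvg_unique _ Lw); first exact: norm_hausdorff.
apply/cvg_rnormP => e e0; exists 2%N => // n /= n2.
rewrite /series /= big_mkord (bigD1 (Ordinal n2)) //= L1 big1 ?addr0 ?subrr ?rnorm0//.
by move=> i i1; rewrite L0.
Qed.

Lemma U_check_sub_pi_Mb U : U_check U `<=` pi_Mb U.
Proof.
move=> z [phi Mphi zphi]; exists phi => // g.
by rewrite (aron_berner_dual (zphi g (Hb_dual setT g))).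
Qed.

Lemma aron_berner_emb f x (w : R[i]^o) : Hb setT f ->
  aron_berner_value f (bidual_emb x) w -> w = f x.
Proof.
move=> Hf [L tL Lw].
have [L' [tL' dL']] := taylor_forms_exist Hf.
have [cL _] := tL.
apply: (cvg_unique _ Lw); first exact: norm_hausdorff.
have [M M0 MP] := taylor_term_cvg (Hb_gol Hf) (rnorm x).
apply/cvg_rnormP => e e0; have [n nP] := ex_pow2_lt M e0.
exists n => // m /= nm; rewrite /series /= big_mkord.
apply: le_lt_trans nP; apply: (@le_trans _ _ (M / 2 ^+ m)).
  rewrite (eq_bigr (fun k : 'I_m => taylor_term (f : E -> C) k x)).
    exact: MP.
  by move=> k _; rewrite bidual_form_emb// (taylor_forms_uniq tL tL') dL'.
by rewrite ler_wpM2l// lef_pV2 ?posrE ?exprn_gt0// ler_eXn2l// ltr1n.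
Qed.

Lemma HbX U f n : Hb setT f -> Hb U (fun x => f x ^+ n : R[i]^o).
Proof.
move=> /Hb_gol gf; apply: gol_Hb; elim: n => [|n ih].
  under eq_fun do rewrite expr0; exact: (Hb_gol (Hb_cst setT 1)).
by under eq_fun do rewrite exprS; exact: golM.
Qed.

(** A homomorphism that evaluates at [x] is bounded by a multiple of the supremum
    over a [U]-bounded set; applied to high powers of [f] this bound holds
    without the factor, so [x] lies in the hull of that set. *)
Lemma U_check_emb U x : Hb_convex U -> U_check U (bidual_emb x) -> U x.
Proof.
move=> cU [phi Mphi xphi].
have phiE f : Hb setT f -> phi f = f x.
  by move=> Hf; exact: aron_berner_emb Hf (xphi f Hf).
have [A [K [bA K0 KP]]] := Mb_bound Mphi.
have [HU _ _] := cU A bA; apply: HU => f Hf.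
have [_ bdA _] := bA.
have [M MP] : exists M : R, forall a, A a -> modc (f a) <= M.
  have [_ bf] := Hf; apply/bounded_nearP; apply: bf; split=> //.
  by exists 1 => // a y _ /(_ I).
have MS a : A a -> modc (f a) <= sup [set rnorm (f a) | a in A].
  move=> Aa; apply: sup_upper_bound; last by exists a.
  by split; [exists (rnorm (f a)), a|exists M => _ [b Ab <-]; exact: MP].
set S := sup _ in MS *.
have S0 : 0 <= S.
  have [A0|/set0P[a Aa]] := eqVneq A set0; last by apply: le_trans (MS a Aa); exact: modc_ge0.
  by rewrite /S A0 image_set0 sup0.
rewrite leNgt; apply/negP => Sx.
have fx0 : 0 < modc (f x) by apply: le_lt_trans Sx.
pose q := S / modc (f x).
have q1 : q < 1 by rewrite ltr_pdivrMr// mul1r.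
have q0 : 0 <= q by rewrite /q divr_ge0 ?modc_ge0.
have [n nP] : exists n, K * (q ^+ n) < 1 / 2.
  have : (fun n => q ^+ n) @ \oo --> (0 : R).
    by apply: cvg_expr; rewrite ger0_norm.
  have e0 : 0 < 1 / (2 * K) by rewrite divr_gt0// mulr_gt0.
  move=> /cvgrPdist_lt/(_ _ e0)[n _ /(_ n (leqnn n))/=].
  rewrite sub0r normrN ger0_norm ?exprn_ge0// => h; exists n.
  by rewrite mulrC -ltr_pdivlMr// -mulrA -invfM.
have q2 : 0 < q ^+ n + 1 / (2 * K) by rewrite ltr_wpDl ?exprn_ge0// divr_gt0// mulr_gt0.
have := KP (fun y => f y ^+ n) ((S ^+ n + modc (f x) ^+ n / (2 * K))) (HbX U n Hf).
rewrite (phiE (fun y => f y ^+ n)) ?modcX; last exact: HbX.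
have fn0 : 0 < modc (f x) ^+ n by rewrite exprn_gt0.
have t0 : 0 < modc (f x) ^+ n / (2 * K) by rewrite divr_gt0// mulr_gt0.
move=> /(_ _)/wrap[|]; first by rewrite ltr_wpDl ?exprn_ge0.
move=> /(_ _)/wrap[|].
  move=> y Ay; rewrite modcX (@le_trans _ _ (S ^+ n))// ?lerDl ?(ltW t0)//.
  by rewrite lerXn2r ?nnegrE ?modc_ge0// MS.
have -> : K * (S ^+ n + modc (f x) ^+ n / (2 * K)) = K * S ^+ n + modc (f x) ^+ n / 2.
  by field; rewrite gt_eqF.
rewrite leNgt => /negP; apply.
move: nP; rewrite /q expr_div_n mulrA ltr_pdivrMr// => h.
by move: h fn0; rewrite div1r; lra.
Qed.

End Homomorphisms.

(** * Weak continuity and approximation by finite type polynomials *)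
Section WeakContinuity.
Context {R : realType} {E : normedModType R[i]}.
Local Notation C := R[i].
Implicit Types (F G : seq E -> C) (x y : E) (gs hs : seq (Dual E)) (n m : nat).

(** The basic weak neighbourhoods of the origin; radii other than [1] are
    absorbed in the functionals. *)
Definition small gs x := forall g, g \in gs -> modc (g x) < 1.

Lemma small_cat gs hs x : small (gs ++ hs) x -> small gs x /\ small hs x.
Proof.
by move=> s; split=> g gg; apply: s; rewrite mem_cat gg ?orbT.
Qed.

Lemma small_scale gs (c : R) x : 0 < c -> small [seq c%:C *: g | g <- gs] x ->
  forall g, g \in gs -> modc (g x) < c^-1.
Proof.
move=> c0 s g gg; have := s (c%:C *: g) (map_f _ gg).
rewrite -[(c%:C *: g) x]/(c%:C * g x) modcM modcR ger0_norm ?(ltW c0)//.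
by rewrite -ltr_pdivlMl// mulr1.
Qed.

Lemma dual_bound (g : Dual E) x (r : R) : rnorm x <= r -> modc (g x) <= dual_norm g * r.
Proof.
by move=> xr; rewrite (le_trans (dual_normP g x))// ler_wpM2l ?dual_norm_ge0.
Qed.

(** Balls are totally bounded for the weak topology. *)
Lemma weak_colouring (r : R) gs : exists (T : finType) (c : E -> T),
  forall x y, rnorm x <= r -> rnorm y <= r -> c x = c y -> small gs (x - y).
Proof.
elim: gs => [|g gs [T [c cP]]]; first by exists unit, (fun=> tt).
pose K := dual_norm g * r.
pose cell (a : R) := Num.truncn ((a + K) * 4).
pose m := Num.truncn ((K + K) * 4).
have cellm a : `|a| <= K -> (cell a < m.+1)%N.
  rewrite ler_norml => /andP[_ aK]; rewrite ltnS; apply: le_truncn.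
  by rewrite ler_wpM2r// lerD2r.
have cellE a b : `|a| <= K -> `|b| <= K -> cell a = cell b -> `|a - b| < 1 / 2.
  move=> aK bK ab.
  have pos t : `|t| <= K -> 0 <= (t + K) * 4.
    by rewrite ler_norml => /andP[Kt _]; rewrite mulr_ge0// -lerBlDr sub0r.
  have := truncn_itv (pos a aK); have := truncn_itv (pos b bK).
  rewrite -/(cell a) -/(cell b) ab -natr1 => /andP[b1 b2] /andP[a1 a2].
  by rewrite ltr_norml; apply/andP; split; lra.
pose q x : 'I_m.+1 * 'I_m.+1 :=
  (inord (cell (complex.Re (g x))), inord (cell (complex.Im (g x)))).
exists (T * ('I_m.+1 * 'I_m.+1))%type, (fun x => (c x, q x)).
move=> x y xr yr [cxy qxy1 qxy2] h; rewrite inE => /orP[/eqP->|]; last exact: cP.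
have gx := dual_bound g xr; have gy := dual_bound g yr.
have rx := le_trans (Re_le_modc _) gx; have ry := le_trans (Re_le_modc _) gy.
have ix := le_trans (Im_le_modc _) gx; have iy := le_trans (Im_le_modc _) gy.
have eqv a b : `|a| <= K -> `|b| <= K ->
    @inord m (cell a) = @inord m (cell b) -> cell a = cell b.
  by move=> aK bK /(congr1 val); rewrite /= !inordK ?cellm.
have h1 := cellE _ _ rx ry (eqv _ _ rx ry qxy1).
have h2 := cellE _ _ ix iy (eqv _ _ ix iy qxy2).
rewrite linearB (le_lt_trans (modc_le _))//.
have reB (u v : C) : complex.Re (u - v) = complex.Re u - complex.Re v.
  by case: u; case: v.
have imB (u v : C) : complex.Im (u - v) = complex.Im u - complex.Im v.
  by case: u; case: v.
by rewrite [ltRHS]splitr ltrD ?reB ?imB.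
Qed.

(** Weak continuity at the origin, on bounded sets, of the polynomial of [F]. *)
Definition wsc n F := forall r e : R, 0 < e -> exists gs,
  forall x, rnorm x <= r -> small gs x -> modc (F (nseq n x)) <= e.

(** Joint weak smallness in [m] of the [n] variables, uniformly in the others. *)
Definition unif m n F := forall r e : R, 0 <= r -> 0 < e -> exists gs,
  forall s t, size s = m -> (size s + size t)%N = n ->
    (forall x, x \in s -> rnorm x <= r /\ small gs x) ->
    (forall x, x \in t -> rnorm x <= r) -> modc (F (s ++ t)) <= e.

(** Polarization in the gauge [p], a norm that is small on a set of points that
    are weakly small and of bounded norm. *)
Lemma unif_full n F : smf n F -> wsc n F -> unif n n F.
Proof.
move=> sF wF r e r0 e0.
pose d : R := n.+1%:R^-1.
have d0 : 0 < d by rewrite invr_gt0.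
have nd : n%:R * d < 1 by rewrite ltr_pdivrMr// mul1r ltr_nat.
pose c := d / (2 * (r + 1)).
have r1 : 0 < r + 1 by rewrite ltr_wpDl.
have c0 : 0 < c by rewrite divr_gt0// mulr_gt0.
have [gs gsP] := wF c^-1 e e0.
pose p x : R := c * rnorm x + \sum_(g <- gs) modc (g x).
have sge0 x : 0 <= \sum_(g <- gs) modc (g x) by apply: sumr_ge0 => *; exact: modc_ge0.
pose b : R := 2 * (size gs).+1%:R / d.
have b0 : 0 < b by rewrite divr_gt0// mulr_gt0.
exists [seq b%:C *: g | g <- gs] => s t sn st ss tr.
have t0 : t = [::] by apply/size0nil/eqP; rewrite -(eqn_add2l (size s)) st sn addn0.
rewrite t0 cats0; apply: (smf_polar (p := p) (r := d) sF) => //.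
- rewrite /p rnorm0 mulr0 add0r big1// => g _; by rewrite linear0 modc0.
- move=> u x l l1; rewrite /p addrACA -mulrDr -big_split /= lerD//.
    by rewrite ler_wpM2l ?(ltW c0)// (le_trans (ler_rnormD _ _))// rnormZ l1 mul1r.
  apply: ler_sum => g _; rewrite linearD linearZ (le_trans (ler_modcD _ _))//.
  by rewrite lerD2l modcM l1 mul1r.
- exact: ltW.
- exact: ltW.
- move=> w wd; apply: gsP => [|g gg].
    rewrite -(ler_pM2l c0) divff ?gt_eqF//.
    by rewrite (le_trans _ (ltW nd))// (le_trans _ wd)// /p lerDl.
  apply: le_lt_trans nd; apply: le_trans wd; rewrite /p (big_rem g)//=.
  have h1 : 0 <= c * rnorm w by rewrite mulr_ge0 ?(ltW c0) ?rnorm_ge0.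
  have h2 : 0 <= \sum_(y <- rem g gs) modc (y w) by apply: sumr_ge0 => y _; exact: modc_ge0.
  by rewrite addrCA lerDl addr_ge0.
- move=> x xs; have [xr sx] := ss x xs; rewrite /p [d]splitr lerD//.
    have -> : c * rnorm x = d / 2 * (rnorm x / (r + 1)) by rewrite /c; field; rewrite gt_eqF.
    rewrite ler_piMr ?divr_ge0 ?(ltW d0)// ler_pdivrMr// mul1r.
    by rewrite (le_trans xr)// lerDl.
  apply: (@le_trans _ _ (\sum_(g <- gs) b^-1)).
    rewrite big_seq [leRHS]big_seq; apply: ler_sum => g gg.
    exact/ltW/(small_scale b0 sx gg).
  rewrite big_const_seq count_predT iter_addr_0 -(mulr_natr b^-1).
  have -> : b^-1 * (size gs)%:R = d / 2 * ((size gs)%:R / (size gs).+1%:R).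
    have := ltr0Sn R (size gs); rewrite /b; move: (size gs).+1%:R => N N0.
    by field; rewrite !gt_eqF.
  rewrite ler_piMr ?divr_ge0 ?(ltW d0)//.
  by rewrite ler_pdivrMr// mul1r ler_nat.
Qed.

(** If one more argument were needed to be weakly small, two bad tuples whose
    next arguments have the same colour could be subtracted: the difference of
    the arguments is weakly small, and the frozen argument leaves a form of
    lower degree. *)
Lemma unif_step m n F : smf n.+1 F -> (m < n.+1)%N ->
  (forall y, unif m n (fun s => F (y :: s))) -> unif m.+1 n.+1 F -> unif m n.+1 F.
Proof.
move=> sF mn lowF uF r e r0 e0.
have e2 : 0 < e / 2 by rewrite divr_gt0.
have [gs gsP] := uF (r + r) (e / 2) (addr_ge0 r0 r0) e2.
have [T [c cP]] := weak_colouring r gs.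
pose bad gs' s y t := [/\ size s = m, (size s + (size t).+1)%N = n.+1,
  (forall x, x \in s -> rnorm x <= r /\ small gs' x), (forall x, x \in y :: t -> rnorm x <= r)
  & e < modc (F (s ++ y :: t))].
apply: contrapT => nu.
have ex gs' : exists s y t, bad gs' s y t.
  apply: contrapT => nb; apply: nu; exists gs' => s t sm st ss ts.
  rewrite leNgt; apply/negP => h; case: t st ts h => [|y t] st ts h.
    by move: mn; rewrite -sm -st addn0 ltnn.
  by apply: nb; exists s, y, t; split.
have [a aP] : exists a, forall gs', exists s y t, bad gs' s y t /\ c y = a.
  apply: contrapT => na.
  have {}na a : exists gs', forall s y t, bad gs' s y t -> c y <> a.
    apply: contrapT => nb; apply: na; exists a => gs'.
    apply: contrapT => nc; apply: nb; exists gs' => s y t bs ca.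
    by apply: nc; exists s, y, t.
  have [H HP] := choice na.
  have [s [y [t [h1 h2 h3 h4 h5]]]] := ex (flatten [seq H a | a <- enum T]).
  apply: (HP (c y) s y t) => //; split=> // x xs; have [xr sx] := h3 x xs.
  split=> // g gg; apply: sx; apply/flattenP; exists (H (c y)) => //.
  by apply: map_f; rewrite mem_enum.
have [s0 [y0 [t0 [[_ _ _ y0r _] cy0]]]] := aP [::].
have [gs1 gs1P] := lowF y0 r (e / 2) r0 e2.
have [s1 [y1 [t1 [[s1m s1n s1P t1P h] cy1]]]] := aP (gs ++ gs1).
have y0r' : rnorm y0 <= r by apply: y0r; rewrite inE eqxx.
have y1r' : rnorm y1 <= r by apply: t1P; rewrite inE eqxx.
have rr : r <= r + r by rewrite lerDl.
have [[lF _] pF] := sF.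
move: h; apply/negP; rewrite -leNgt.
have sn : (size s1 + size t1)%N = n by move: s1n; rewrite addnS => -[].
have -> : F (s1 ++ y1 :: t1) = F (s1 ++ (y1 - y0) :: t1) + F (s1 ++ y0 :: t1).
  have := lF s1 t1 1 (y1 - y0) y0 (congr1 S sn).
  by rewrite scale1r mul1r subrK.
rewrite (le_trans (ler_modcD _ _))// [e]splitr lerD//.
  rewrite -cat_rcons; apply: gsP.
  - by rewrite size_rcons s1m.
  - by rewrite size_rcons addSn sn.
  - move=> x; rewrite mem_rcons inE => /orP[/eqP->|/s1P[xr /small_cat[sx _]]].
      split; first by rewrite (le_trans (ler_rnormB _ _))// lerD.
      by apply: cP => //; rewrite cy1 cy0.
    by split=> //; rewrite (le_trans xr).
  - by move=> x xt; rewrite (le_trans (t1P x _))// inE xt orbT.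
rewrite (pF _ (y0 :: s1 ++ t1)).
- apply: gs1P => //.
    by move=> x /s1P[xr /small_cat[_ sx]].
  by move=> x xt; apply: t1P; rewrite inE xt orbT.
- by rewrite size_cat /= addnS sn.
- by rewrite -cat1s perm_catCA.
Qed.

(** [unif n n F] is weak continuity of the polynomial, by polarization; going
    down, [unif_step] makes a single weakly small argument suffice. *)
Lemma unif_all n : (forall j G, (0 < j <= n)%N -> smf j G -> wsc j G) ->
  forall F, smf n F -> forall m, (0 < m <= n)%N -> unif m n F.
Proof.
elim: n => [|n ih] wn F sF m /andP[m0 mn]; first by case: m m0 mn.
have wn' j G : (0 < j <= n)%N -> smf j G -> wsc j G.
  by move=> /andP[j0 jn]; apply: wn; rewrite j0 ltnW.
have [k kE] : exists k, (m + k)%N = n.+1 by exists (n.+1 - m)%N; rewrite subnKC.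
elim: k m m0 mn kE => [|k ihk] m m0 mn kE.
  rewrite addn0 in kE; rewrite kE; apply: unif_full => //.
  by apply: wn => //; rewrite ltnS leqnn.
have mn' : (m < n.+1)%N by rewrite -kE -addSnnS leq_addr.
apply: unif_step => // [y|]; last by apply: ihk => //; rewrite addSnnS.
by apply: ih => //; [exact: smf_cons|rewrite m0].
Qed.

(** ** A compact set of functionals *)
(** Bounded functionals that are weakly continuous at the origin on a ball, with
    moduli of continuity prescribed by [H]. The radius [r + r] accommodates
    differences of points in the ball of radius [r]. *)
Definition equi (r c : R) (H : nat -> seq (Dual E)) : set (Dual E) :=
  [set h | (forall x, modc (h x) <= c * rnorm x) /\
    forall j x, rnorm x <= r + r -> small (H j) x -> modc (h x) <= j.+1%:R^-1].

Lemma dual_norm_ball (g : Dual E) (r c : R) : 0 < r ->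
  (forall x, rnorm x <= r -> modc (g x) <= c) -> dual_norm g <= c / r.
Proof.
move=> r0 gc; have c0 : 0 <= c.
  by apply: le_trans (gc 0 _); rewrite ?modc_ge0 ?rnorm0 ?(ltW r0).
apply: dual_norm_le => [|x]; first by rewrite divr_ge0 ?(ltW r0).
have [->|x0] := eqVneq x 0; first by rewrite linear0 !rnorm0 mulr0.
have xp : 0 < rnorm x by rewrite rnorm_gt0.
have mE : modc ((r / rnorm x)%:C : C) = r / rnorm x.
  by rewrite modcR gtr0_norm// divr_gt0.
have := gc ((r / rnorm x)%:C *: x); rewrite linearZ rnormZ mE divfK ?gt_eqF// lexx.
move=> /(_ isT); rewrite modcM mE.
by rewrite mulrAC ler_pdivrMr// mulrAC ler_pdivlMr// mulrC.
Qed.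

(** A pointwise limit along an ultrafilter stays in the set. It is a limit in
    norm, because the ball is covered by finitely many sets on which all
    functionals of the set are nearly constant, as in the Arzela-Ascoli
    theorem. *)
Lemma equi_compact (r c : R) H : 0 < r -> compact (equi r c H).
Proof.
move=> r0; rewrite compact_ultra => U UU Ueq.
have UP : ProperFilter U by exact: ultra_proper.
have ex x : exists l : C, forall e : R, 0 < e -> U [set h | modc (h x - l) < e].
  apply: (@ultra_lim _ _ _ UU (fun h : Dual E => h x) (c * rnorm x)).
  by apply: filterS Ueq => h [hc _] /=; exact: hc.
have [l lP] := choice ex.
have lin : linear (l : E -> R[i]^o).
  move=> a x y; apply/eqP; rewrite -subr_eq0; apply/eqP/modc_eq0/eqP.
  rewrite eq_le modc_ge0 andbT; apply/ler_addgt0Pr => e e0; rewrite add0r.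
  pose d := e / (modc a + 2).
  have a2 : 0 < modc a + 2 by rewrite ltr_wpDl ?modc_ge0.
  have d0 : 0 < d by rewrite divr_gt0.
  have [h [[/= h1 h2] h3]] := filter_ex (filterI (filterI (lP x d d0) (lP y d d0)) (lP (a *: x + y) d d0)).
  rewrite -[a *: l x]/(a * l x).
  have -> : l (a *: x + y) - (a * l x + l y) =
      a * (h x - l x) + (h y - l y) - (h (a *: x + y) - l (a *: x + y)).
    have hl : h (a *: x + y) = a * h x + h y by exact: linearP.
    by rewrite hl; ring.
  apply: (le_trans (ler_modcB _ _)).
  have -> : e = modc a * d + d + d by rewrite /d; field; rewrite gt_eqF.
  rewrite lerD//; last exact: ltW.
  rewrite (le_trans (ler_modcD _ _))// lerD//; last exact: ltW.
  by rewrite modcM ler_wpM2l ?modc_ge0// ltW.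
have near x (M : R) : U [set h | modc (h x) <= M] -> modc (l x) <= M.
  move=> UM; apply/ler_addgt0Pr => e e0.
  have [h [/= h1 h2]] := filter_ex (filterI UM (lP x e e0)).
  by rewrite (le_trans (ler_modc_dist _ (h x)))// modcBC lerD// ltW.
have lc x : modc (l x) <= c * rnorm x.
  by apply: near; apply: filterS Ueq => h [hc _] /=; exact: hc.
pose L := MkDual (dual_predI lin lc).
have Leq : equi r c H L.
  by split=> // j x xr sx; apply: near; apply: filterS Ueq => h [_ hc] /=; exact: hc.
exists L; split=> //; apply/cvg_rnormP => e e0.
have er : 0 < e * r by rewrite mulr_gt0.
have [j jP] : exists j : nat, (j.+1%:R^-1 : R) < e * r / 8.
  have e8 : 0 < e * r / 8 by rewrite divr_gt0.
  exists (Num.truncn (e * r / 8)^-1).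
  rewrite -[ltRHS]invrK ltf_pV2 ?posrE ?invr_gt0//; exact: truncnS_gt.
have [T [col colP]] := weak_colouring r (H j).
have [q qP] : exists q : T -> E, forall x, rnorm x <= r ->
    rnorm (q (col x)) <= r /\ col (q (col x)) = col x.
  have exq (t : T) : exists y : E, forall x, rnorm x <= r -> col x = t ->
      rnorm y <= r /\ col y = t.
    have [[x [xr xt]]|n] := pselect (exists x, rnorm x <= r /\ col x = t).
      by exists x.
    by exists 0 => x xr xt; exfalso; apply: n; exists x.
  have [q qP] := choice exq; exists q => x xr; exact: (qP (col x) x xr erefl).
have e8 : 0 < e * r / 8 by rewrite divr_gt0.
have UT : U [set h | forall t : T, modc (h (q t) - l (q t)) < e * r / 8].
  exact: (@filter_forall _ _ _ _ _ (fun t => lP (q t) _ e8)).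
apply: filterS (filterI Ueq UT) => h [[_ hs] hT].
rewrite rnorm_dual; apply: (@le_lt_trans _ _ (e * r / 2 / r)); last first.
  by rewrite mulrAC mulfK ?gt_eqF// ltr_pdivrMr// ltr_pMr// ltr1n.
apply: dual_norm_ball => // x xr.
have [yr yc] := qP x xr; set y := q (col x) in yr yc.
have sxy : small (H j) (x - y) by apply: colP.
have xyr : rnorm (x - y) <= r + r by rewrite (le_trans (ler_rnormB _ _))// lerD.
have [_ ls] := Leq.
have h1 := ls j _ xyr sxy; have h2 := hs j _ xyr sxy; have h3 := hT (col x).
have -> : (L - h) x = L (x - y) - h (x - y) - (h y - l y).
  have LB : L (x - y) = L x - L y by exact: linearB.
  have hB : h (x - y) = h x - h y by exact: linearB.
  by rewrite LB hB -[l y]/(L y) -[LHS]/(L x - h x); ring.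
have h12 : modc (L (x - y) - h (x - y)) <= e * r / 8 + e * r / 8.
  apply: (le_trans (ler_modcB _ _)); apply: lerD.
    exact: le_trans h1 (ltW jP).
  exact: le_trans h2 (ltW jP).
apply: (le_trans (ler_modcB _ _)); apply: (le_trans (lerD h12 (ltW h3))).
lra.
Qed.

(** ** Approximation *)
Definition approximable (P : E -> C) := forall r e : R, 0 < r -> 0 < e ->
  exists2 Q, finite_type_polynomial Q & forall x, rnorm x <= r -> modc (P x - Q x) <= e.

Lemma finite_type_sum (I : Type) (s : seq I) (Q : I -> E -> R[i]^o) :
  (forall i, finite_type_polynomial (Q i)) ->
  finite_type_polynomial (fun x => \sum_(i <- s) Q i x).
Proof.
move=> fQ; elim: s => [|i s ih].
  under eq_fun do rewrite big_nil; exact: finite_type_cst.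
under eq_fun do rewrite big_cons.
by apply: finite_type_add.
Qed.

Lemma approximable_sum n (P : nat -> E -> C) : (forall k, approximable (P k)) ->
  approximable (fun x => \sum_(k < n) P k x).
Proof.
move=> aP r e r0 e0.
have en : 0 < e / n.+1%:R by rewrite divr_gt0.
have ex k : exists Q, finite_type_polynomial Q /\
    forall x, rnorm x <= r -> modc (P k x - Q x) <= e / n.+1%:R.
  by have [Q Qf QP] := aP k r _ r0 en; exists Q.
have [Q QP] := choice ex.
exists (fun x => \sum_(k < n) Q k x).
  by apply: finite_type_sum => k; have [] := QP k.
move=> x xr; rewrite -sumrB (le_trans (ler_modc_sum _ _ _))//.
apply: (@le_trans _ _ (\sum_(k < n) e / n.+1%:R)).
  by apply: ler_sum => k _; have [_] := QP k; apply.
rewrite sumr_const card_ord -[X in X <= _]mulr_natr mulrAC -mulrA ler_piMr ?(ltW e0)//.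
by rewrite ler_pdivrMr// mul1r ler_nat.
Qed.

(** The functionals [F (., s)] with [s] in a ball form a relatively compact set,
    so an operator of finite rank on the dual moves them only a little; what it
    produces is a sum of products of functionals with polynomials of lower
    degree. *)
Lemma form_approximable n : approximation_property (Dual E) ->
  (forall j G, (0 < j <= n)%N -> smf j G -> wsc j G) ->
  forall F, smf n F -> approximable (fun x => F (nseq n x)).
Proof.
move=> AP; elim: n => [|n ih] wn F sF r e r0 e0.
  by exists (fun=> F [::]) => [|x _]; [exact: finite_type_cst|rewrite subrr modc0 (ltW e0)].
have wn' j G : (0 < j <= n)%N -> smf j G -> wsc j G.
  by move=> /andP[j0 jn]; apply: wn; rewrite j0 ltnW.
have u1 : unif 1 n.+1 F by apply: unif_all.
have [[lF [M M0 bF]] pF] := sF.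
have exh s : exists h : Dual E, size s = n -> forall x, h x = F (x :: s).
  have [sn|sn] := eqVneq (size s) n; last by exists 0 => /eqP; rewrite (negbTE sn).
  have lin : linear (fun x => F (x :: s) : R[i]^o).
    move=> a x y; rewrite (slotlinD _ _ lF)// (slotlinZ _ _ lF)//.
  have bd x : modc (F (x :: s)) <= (M * \prod_(y <- s) rnorm y) * rnorm x.
    by rewrite -mulrA [_ * rnorm x]mulrC -(big_cons _ _ _ _ xpredT) bF//= sn.
  by exists (MkDual (dual_predI lin bd)).
have [h hP] := choice exh.
have exg (j : nat) : exists gs, forall x s, size s = n -> rnorm x <= r + r -> small gs x ->
    (forall y, y \in s -> rnorm y <= r + r) -> modc (F (x :: s)) <= j.+1%:R^-1.
  have j0 : 0 < j.+1%:R^-1 :> R by rewrite invr_gt0.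
  have [gs gsP] := u1 (r + r) _ (addr_ge0 (ltW r0) (ltW r0)) j0.
  exists gs => x s sn xr sx sr; apply: (gsP [:: x] s) => //; first by rewrite sn.
  by move=> y; rewrite inE => /eqP->.
have [H HP] := choice exg.
have Keq s : size s = n -> (forall y, y \in s -> rnorm y <= r) -> equi r (M * r ^+ n) H (h s).
  move=> sn sr; have sr' y : y \in s -> rnorm y <= r + r.
    by move=> /sr yr; rewrite (le_trans yr)// lerDl ltW.
  split=> [x|j x xr sx]; last by rewrite hP//; apply: HP.
  rewrite hP// mulrAC.
  have Mx0 : 0 <= M * rnorm x by rewrite mulr_ge0 ?rnorm_ge0.
  apply: (bdd_max (F := fun s => F (x :: s)) Mx0 _ sn sr) => t tn.
  by rewrite -mulrA -(big_cons _ _ _ _ xpredT) bF//= tn.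
have e'0 : 0 < e / (2 * r) by rewrite divr_gt0// mulr_gt0.
have [T [cT [m [v vP]] TP]] := AP _ (@equi_compact r (M * r ^+ n) H r0) _ e'0.
have [ps psP] := dual_coordinates [seq v i | i <- enum 'I_m].
(* finite rank: [T g] is recovered from its values at finitely many points *)
have TE g : T g = \sum_(p <- ps) (T g) p.1 *: p.2.
  have [a ->] := vP g.
  rewrite [RHS](eq_bigr (fun p => \sum_(i < m) (a i * (v i) p.1) *: p.2)); last first.
    move=> p _; rewrite dual_sumE scaler_suml; apply: eq_bigr => i _.
    by [].
  rewrite exchange_big /=; apply: eq_bigr => i _.
  rewrite {1}(psP (v i)); last by apply: map_f; rewrite mem_enum.
  by rewrite scaler_sumr; apply: eq_bigr => p _; rewrite scalerA.
have [K K0 KP] : exists2 K : R, 0 <= K & forall g, dual_norm (T g) <= K * dual_norm g.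
  have := (linear_bounded_continuous T).2 cT.
  move=> /linear_boundedP/pinfty_ex_gt0[K K0 TK].
  exists (complex.Re K) => [|g].
    by rewrite -ler0c RRe_real ?gtr0_real// ltW.
  rewrite -!rnorm_dual -lecR rmorphM/= !rnormE RRe_real ?gtr0_real//; exact: TK.
(* the forms of lower degree in what [T] produces *)
pose G (p : E * Dual E) s : C := (T (h s)) p.1.
have hbd s : size s = n -> dual_norm (h s) <= M * \prod_(y <- s) rnorm y.
  move=> sn; apply: dual_norm_le.
    by rewrite mulr_ge0// prodr_ge0// => y _; exact: rnorm_ge0.
  move=> x; rewrite hP// -mulrA [_ * rnorm x]mulrC -(big_cons _ _ _ _ xpredT) bF//=.
  by rewrite sn.
have sG p : smf n (G p).
  split; first split.
  - move=> s t a x y st; rewrite /G.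
    have sz w : size (s ++ w :: t) = n by rewrite size_cat /= addnS st.
    have -> : h (s ++ (a *: x + y) :: t) = a *: h (s ++ x :: t) + h (s ++ y :: t).
      apply: dual_eq_fun => w.
      rewrite -[RHS]/(a * h (s ++ x :: t) w + h (s ++ y :: t) w) !hP//.
      by rewrite -!cat_cons lF//= addSn st.
    by rewrite linearP.
  - exists (K * M * rnorm p.1) => [|s sn]; first by rewrite !mulr_ge0 ?rnorm_ge0.
    rewrite /G (le_trans (dual_normP _ _))// mulrAC ler_wpM2r ?rnorm_ge0//.
    by rewrite (le_trans (KP _))// -mulrA ler_wpM2l ?hbd.
  - move=> s t sn st; rewrite /G; congr (T _ _); apply: dual_eq_fun => w.
    by rewrite !hP -?(perm_size st)//; apply: pF; rewrite /= ?sn// perm_cons.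
pose S : R := \sum_(p <- ps) dual_norm p.2 * r.
have S0 : 0 <= S by apply: sumr_ge0 => p _; rewrite mulr_ge0 ?dual_norm_ge0 ?(ltW r0).
have S1 : 0 < 2 * (S + 1) by rewrite mulr_gt0// ltr_wpDl.
have e''0 : 0 < e / (2 * (S + 1)) by rewrite divr_gt0.
have exQ p : exists Q, finite_type_polynomial Q /\
    forall x, rnorm x <= r -> modc (G p (nseq n x) - Q x) <= e / (2 * (S + 1)).
  by have [Q Qf QP] := ih wn' _ (sG p) r _ r0 e''0; exists Q.
have [Q QP] := choice exQ.
exists (fun x => \sum_(p <- ps) Q p x * p.2 x).
  apply: finite_type_sum => p; apply: finite_type_mul; first by have [] := QP p.
  exact: finite_type_dual.
move=> x xr; set s := nseq n x.
have sn : size s = n by rewrite size_nseq.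
have sr y : y \in s -> rnorm y <= r by move=> /nseqP[->].
rewrite -[nseq n.+1 x]/(x :: s) -hP//.
have -> : h s x - \sum_(p <- ps) Q p x * p.2 x =
    - ((T (h s) - h s) x) + \sum_(p <- ps) (G p s - Q p x) * p.2 x.
  rewrite -[(T (h s) - h s) x]/(T (h s) x - h s x) opprB.
  have -> : T (h s) x = \sum_(p <- ps) G p s * p.2 x.
    rewrite [LHS](congr1 (fun g : Dual E => g x) (TE (h s))) dual_sumE.
    by apply: eq_bigr.
  rewrite [X in _ = _ + X](eq_bigr (fun p : E * Dual E => G p s * p.2 x - Q p x * p.2 x)).
    by rewrite sumrB; ring.
  by move=> p _; rewrite mulrBl.
rewrite (le_trans (ler_modcD _ _))// modcN [e]splitr lerD//.
  rewrite (le_trans (dual_bound _ xr))// -ler_pdivlMr// -mulrA -invfM.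
  by rewrite -rnorm_dual; apply/ltW/TP/Keq.
rewrite (le_trans (ler_modc_sum _ _ _))//.
apply: (@le_trans _ _ (\sum_(p <- ps) e / (2 * (S + 1)) * (dual_norm p.2 * r))).
  apply: ler_sum => p _; rewrite modcM ler_pM ?modc_ge0//; last exact: dual_bound.
  by have [_] := QP p; apply.
rewrite -mulr_sumr -/S invfM mulrA -mulrA ler_piMr ?divr_ge0 ?(ltW e0)//.
by rewrite mulrC ler_pdivrMr ?mul1r ?lerDl// ltr_wpDl.
Qed.

Lemma dense_of_wsc : approximation_property (Dual E) ->
  (forall n F, (0 < n)%N -> smf n F -> wsc n F) ->
  finite_type_polynomials_dense E.
Proof.
move=> AP wn P [n [Q [hQ ->]]] B.
have aQ : approximable (fun x => \sum_(k < n) Q k x).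
  apply: approximable_sum => k; have [L cL <-] := hQ k.
  have sL := cont_sym_form_smf cL.
  have := form_approximable AP (fun j G jk => wn j G (proj1 (andP jk))) sL.
  suff -> : (fun x => form_seq L (nseq k x)) = Defs.diagonal L by [].
  by apply/funext => x; rewrite diagonal_form_seq.
move=> /(@family_nbhsP R E bounded_set (fun x => \sum_(k < n) Q k x) B _ _).1 [].
- by exists set0; apply/bounded_setP; exists 0.
- move=> A1 A2 /bounded_setP[M MP] /bounded_setP[M' MP'].
  apply/bounded_setP; exists (Num.max M M') => x [/MP h|/MP' h].
    by rewrite le_max h.
  by rewrite le_max h orbT.
move=> A [d [/bounded_setP[r rP] d0 dB]].
have r0 : 0 < Num.max r 1 by rewrite lt_max ltr01 orbT.
have d2 : 0 < d / 2 by rewrite divr_gt0.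
have [q qf qP] := aQ _ _ r0 d2.
exists q; split=> //; apply: dB => x Ax.
rewrite (le_lt_trans (qP x _))// ?le_max ?rP//.
by rewrite ltr_pdivrMr// ltr_pMr// ltr1n.
Qed.

End WeakContinuity.

(** * The Hahn-Banach theorem *)
Section HahnBanach.
Context {R : realType} {E : normedModType R[i]}.
Local Notation C := R[i].
Implicit Types (x y : E) (A B : set (E * R)).

(** Graphs of real linear forms on real subspaces that are dominated by the
    norm; domination makes a linear relation single-valued. *)
Definition dominated B := (forall p, B p -> p.2 <= rnorm p.1) /\
  forall p q (t : R), B p -> B q -> B (p.1 + t%:C *: q.1, p.2 + t * q.2).

Lemma dominated_uniq B x (a b : R) : dominated B -> B (x, a) -> B (x, b) -> a = b.
Proof.
move=> [nB lB]; wlog ab : a b / a <= b => [H|Ba Bb].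
  have [/H|/ltW/H h Ba Bb] := leP a b; first exact.
  by rewrite h.
apply/eqP; rewrite eq_le ab /= -subr_le0.
have := nB _ (lB _ _ (-1) Bb Ba); rewrite /= rmorphN rmorph1 scaleN1r subrr rnorm0.
by rewrite mulN1r.
Qed.

(** The value at [y] is chosen between the lower bounds [u x - rnorm (x - y)] and
    the upper bounds [rnorm (x + y) - u x]. *)
Lemma dominated_extend B y : dominated B -> B (0, 0) ->
  exists B', [/\ dominated B', B `<=` B' & exists c, B' (y, c)].
Proof.
move=> [nB lB] B0.
pose S := [set p.2 - rnorm (p.1 - y) | p in B].
have Sle p q : B p -> B q -> p.2 - rnorm (p.1 - y) <= rnorm (q.1 + y) - q.2.
  move=> Bp Bq; have := nB _ (lB p q 1 Bp Bq); rewrite /= rmorph1 scale1r mul1r => h.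
  have := ler_rnormD (p.1 - y) (q.1 + y).
  by rewrite addrACA addNr addr0; move: h; lra.
have Sub : has_sup S.
  split; first by exists (0 - rnorm (0 - y)), (0, 0).
  exists (rnorm (0 + y) - 0) => _ [p Bp <-].
  exact: (Sle p (0, 0)).
pose c := sup S.
have c1 p : B p -> p.2 - rnorm (p.1 - y) <= c.
  by move=> Bp; apply: sup_upper_bound => //; exists p.
have c2 q : B q -> c <= rnorm (q.1 + y) - q.2.
  move=> Bq; apply: ge_sup; first by have [] := Sub.
  by move=> _ [p Bp <-]; exact: Sle.
pose B' := [set p : E * R | exists q (t : R),
  B q /\ p = (q.1 + t%:C *: y, q.2 + t * c)].
have sc q (t : R) : B q -> B (t%:C *: q.1, t * q.2).
  by move=> Bq; have := lB _ _ t B0 Bq; rewrite /= !add0r.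
exists B'; split.
- split=> [_ [q [t [Bq ->]]] /=|_ _ s [q [t [Bq ->]]] [q' [t' [Bq' ->]]] /=].
    have [t0|t0|->] := ltgtP t 0; last by rewrite mul0r addr0 scale0r addr0 nB.
      have s0 : 0 < - t by rewrite oppr_gt0.
      have := c1 _ (sc q (- t)^-1 Bq); rewrite /= => h.
      have tC : t%:C != 0 :> C by rewrite -modc_gt0 modcR normr_gt0 lt_eqF.
      have e1 : rnorm (q.1 + t%:C *: y) = - t * rnorm (((- t)^-1)%:C *: q.1 - y).
        have -> : q.1 + t%:C *: y = (- t)%:C *: (((- t)^-1)%:C *: q.1 - y).
          rewrite scalerBr scalerA -rmorphM mulfV ?gt_eqF// rmorph1 scale1r.
          by rewrite rmorphN scaleNr opprK.
        by rewrite rnormZ modcR gtr0_norm.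
      rewrite e1; move: h; rewrite -(ler_pM2l s0) mulrBr mulrA mulfV ?gt_eqF// mul1r.
      lra.
    have := c2 _ (sc q t^-1 Bq); rewrite /= => h.
    have e1 : rnorm (q.1 + t%:C *: y) = t * rnorm ((t^-1)%:C *: q.1 + y).
      have -> : q.1 + t%:C *: y = t%:C *: ((t^-1)%:C *: q.1 + y).
        by rewrite scalerDr scalerA -rmorphM mulfV ?gt_eqF// rmorph1 scale1r.
      by rewrite rnormZ modcR gtr0_norm.
    rewrite e1; move: h; rewrite -(ler_pM2l t0) mulrBr mulrA mulfV ?gt_eqF// mul1r.
    lra.
  exists (q.1 + s%:C *: q'.1, q.2 + s * q'.2), (t + s * t'); split; first exact: lB.
  congr (_, _) => /=; last by ring.
  by rewrite scalerDr scalerA rmorphD rmorphM scalerDl addrACA.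
- by move=> [x a] Bx; exists (x, a), 0; split=> //=; rewrite scale0r mul0r !addr0.
- exists c, (0, 0), 1; split=> //=.
  by rewrite rmorph1 scale1r mul1r !add0r.
Qed.

(** Zorn's lemma is applied to the sets whose union with the graph of the form
    on the line through [x0] is dominated. *)
Lemma real_hahn_banach x0 : exists u : E -> R, [/\ forall x, u x <= rnorm x,
  forall x y (t : R), u (x + t%:C *: y) = u x + t * u y & u x0 = rnorm x0].
Proof.
pose G0 := [set p : E * R | exists t : R, p = (t%:C *: x0, t * rnorm x0)].
have dG0 : dominated G0.
  split=> [_ [t ->] /=|_ _ s [t ->] [t' ->] /=].
    by rewrite rnormZ modcR ler_wpM2r ?rnorm_ge0 ?ler_norm.
  exists (t + s * t'); rewrite scalerA -scalerDl rmorphD rmorphM; congr (_, _).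
  by ring.
have [|A [PA Amax]] := @Zorn_bigcup _ [set A | dominated (G0 `|` A)].
  move=> F FP Ftot; split.
    move=> p [Gp|[X FX Xp]]; first by have [h _] := dG0; exact: h.
    by have [h _] := FP X FX; apply: h; right.
  have both p q : (G0 `|` \bigcup_(X in F) X) p -> (G0 `|` \bigcup_(X in F) X) q ->
      (G0 p /\ G0 q) \/ exists X, [/\ F X, (G0 `|` X) p & (G0 `|` X) q].
    move=> [Gp|[X FX Xp]] [Gq|[Y FY Yq]].
    - by left.
    - by right; exists Y; split=> //; [left|right].
    - by right; exists X; split=> //; [right|left].
    - right; have [XY|YX] := Ftot X Y FX FY.
        by exists Y; split=> //; right=> //; exact: XY.
      by exists X; split=> //; right=> //; exact: YX.
  move=> p q t Bp Bq; have [[Gp Gq]|[X [FX Xp Xq]]] := both p q Bp Bq.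
    by left; have [_ h] := dG0; exact: h.
  have [_ h] := FP X FX; have [G|X'] := h p q t Xp Xq; first by left.
  by right; exists X.
pose B := G0 `|` A; have dB : dominated B by [].
have B0 : B (0, 0) by left; exists 0; rewrite scale0r mul0r.
have tot y : exists c, B (y, c).
  apply: contrapT => nc.
  have [B' [dB' BB' [c B'y]]] := dominated_extend y dB B0.
  have AB' : A `<` B'.
    split; last by move=> B'A; apply: nc; exists c; right; exact: B'A.
    by move=> p Ap; apply: BB'; right.
  apply: (Amax B' AB'); rewrite /=.
  suff -> : G0 `|` B' = B' by [].
  by apply/seteqP; split=> [p [Gp|//]|p B'p]; [apply: BB'; left|right].
have [u uP] := choice tot; have [nB lB] := dB.
exists u; split.
- by move=> x; exact: (nB _ (uP x)).
- move=> x y t; apply: (dominated_uniq dB (uP _)).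
  exact: (lB _ _ t (uP x) (uP y)).
- apply: (dominated_uniq dB (uP x0)); left; exists 1.
  by rewrite rmorph1 scale1r mul1r.
Qed.

(** The complex functional whose real part is a given real one; rotating the
    argument shows that its norm is no larger. *)
Lemma hahn_banach x0 : exists g : Dual E, dual_norm g <= 1 /\ rnorm x0 <= modc (g x0).
Proof.
have [u [un ul ux0]] := real_hahn_banach x0.
have u0 : u 0 = 0.
  by have := ul 0 0 1; rewrite scaler0 addr0 mul1r => /eqP; rewrite -subr_eq0 opprD addrA subrr sub0r oppr_eq0 => /eqP.
have uD x y : u (x + y) = u x + u y.
  by have := ul x y 1; rewrite rmorph1 scale1r mul1r.
have uZ (t : R) x : u (t%:C *: x) = t * u x by have := ul 0 x t; rewrite add0r u0 add0r.
have uN x : u (- x) = - u x.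
  by have := uZ (-1) x; rewrite rmorphN rmorph1 scaleN1r mulN1r.
pose I : C := 0 +i* 1.
pose g x : R[i]^o := u x +i* (- u (I *: x)).
have gD x y : g (x + y) = g x + g y.
  by rewrite /g scalerDr !uD opprD.
have gZ (a : C) x : g (a *: x) = a * g x.
  case: a => a b.
  have -> : (a +i* b) *: x = a%:C *: x + b%:C *: (I *: x).
    rewrite scalerA -scalerDl; congr (_ *: _).
    by rewrite /I; simpc.
  rewrite gD /g !scalerA.
  have -> : I * a%:C = a%:C * I by rewrite mulrC.
  have -> : I * (b%:C * I) = (- b)%:C by rewrite /I; simpc.
  rewrite -!scalerA !uZ.
  rewrite -[_ * _ in RHS]/((a +i* b) * (u x +i* (- u (I *: x)))); simpc.
  by congr (_ +i* _); ring.
have lin : linear g by move=> a x y; rewrite gD gZ.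
have gb x : modc (g x) <= 1 * rnorm x.
  rewrite mul1r; have [->|gx] := eqVneq (g x) 0; first by rewrite modc0 rnorm_ge0.
  have mp : 0 < modc (g x) by rewrite modc_gt0.
  pose a : C := (modc (g x))%:C / g x.
  have ma : modc a = 1.
    by rewrite modc_div modcR ger0_norm ?modc_ge0// divff ?gt_eqF.
  have := un (a *: x); rewrite rnormZ ma mul1r.
  have : g (a *: x) = (modc (g x))%:C by rewrite gZ /a divfK.
  by move=> /(congr1 (@complex.Re R)) /= ->.
exists (MkDual (dual_predI lin gb)); split.
  by apply: dual_norm_le.
by rewrite -ux0 (le_trans (ler_norm _))//; exact: (Re_le_modc (g x0)).
Qed.

End HahnBanach.

(** * Sublevel sets of homogeneous polynomials *)
Section Sublevel.
Context {R : realType} {E : normedModType R[i]}.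
Local Notation C := R[i].
Implicit Types (F : seq E -> C) (x : E) (A U : set E).

Definition sublevel (P : E -> C) : set E := [set x | modc (P x) < 1].

Lemma gol_open (P : E -> C) : gol P -> open (sublevel P).
Proof.
move=> gP; rewrite openE => x /= Px; apply/nbhs_rnormP.
have [K K0 KP] := gol_lip gP (rnorm x).
have K1 : 0 < K + 1 by rewrite ltr_wpDl.
have d0 : 0 < 1 - modc (P x) by rewrite subr_gt0.
exists (Num.min 1 ((1 - modc (P x)) / (K + 1))); first by rewrite lt_min ltr01 divr_gt0.
move=> y; rewrite rnormBC lt_min (ltr_pdivlMr _ _ K1) => /andP[h1 h2].
have := KP x (y - x) (lexx _) (ltW h1); rewrite (addrC x) subrK => h3.
have := ler_modc_dist (P y) (P x); have := rnorm_ge0 (y - x).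
rewrite /sublevel /=; nra.
Qed.

Lemma sublevel_bounded (P : E -> C) (c M : R) : gol P -> c < 1 ->
  U_bounded (sublevel P) [set y | rnorm y <= M /\ modc (P y) <= c].
Proof.
move=> gP c1; split.
- by move=> y [_ yc]; exact: le_lt_trans yc c1.
- by apply/bounded_setP; exists M => y [].
have [K K0 KP] := gol_lip gP M.
have K1 : 0 < K + 1 by rewrite ltr_wpDl.
have d0 : 0 < 1 - c by rewrite subr_gt0.
exists (Num.min 1 ((1 - c) / (K + 1))); first by rewrite lt_min ltr01 divr_gt0.
move=> a y [aM ac] yU; rewrite leNgt; apply/negP => h; apply: yU.
move: h; rewrite rnormBC lt_min (ltr_pdivlMr _ _ K1) => /andP[h1 h2].
have := KP a (y - a) aM (ltW h1); rewrite (addrC a) subrK => h3.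
have := ler_modc_dist (P y) (P a); have := rnorm_ge0 (y - a).
rewrite /sublevel /=; nra.
Qed.

Lemma U_bounded_sub U A A' : A `<=` A' -> U_bounded U A' -> U_bounded U A.
Proof.
move=> AA [AU /bounded_setP[M MP] [r r0 rP]]; split.
- exact: subset_trans AU.
- by apply/bounded_setP; exists M => x /AA/MP.
- by exists r => // a y /AA; exact: rP.
Qed.

Lemma sup_le (S : set R) (c : R) : 0 <= c -> (forall a, S a -> a <= c) -> sup S <= c.
Proof.
move=> c0 Sc; have [->|/set0P S0] := eqVneq S set0; first by rewrite sup0.
exact: ge_sup.
Qed.

(** On a set at positive distance from the complement the modulus of [P] stays
    away from [1], since a fixed small dilation keeps the set in the sublevel
    set; this bound passes to the hull, which is bounded by the Hahn-Banach
    theorem. *)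
Lemma sublevel_convex n (P : E -> C) : gol P -> (0 < n)%N -> homog n P ->
  Hb_convex (sublevel P).
Proof.
move=> gP n0 hP A [AU /bounded_setP[M0 M0P] [d d0 dP]].
pose M := Num.max M0 0.
have M00 : 0 <= M by rewrite le_max lexx orbT.
have MP a : A a -> rnorm a <= M by move=> /M0P h; rewrite le_max h.
have M1 : 0 < 2 * (M + 1) by rewrite mulr_gt0// ltr_wpDl.
pose s := d / (2 * (M + 1)).
have s0 : 0 < s by rewrite divr_gt0.
pose c := (1 + s)^-1.
have s1 : 0 < 1 + s by rewrite ltr_wpDl.
have c1 : c < 1 by rewrite invf_lt1// ltrDl.
have c0 : 0 <= c by rewrite invr_ge0 ltW.
have Pc a : A a -> modc (P a) <= c.
  move=> Aa.
  have aU : sublevel P ((1 + s)%:C *: a).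
    apply: contrapT => /(dP _ _ Aa); rewrite rnormBC.
    rewrite rmorphD rmorph1 scalerDl scale1r [a + _]addrC addrK rnormZ modcR gtr0_norm//.
    apply/negP; rewrite -ltNge (@le_lt_trans _ _ (s * M))//; first by rewrite ler_wpM2l ?(ltW s0) ?MP.
    rewrite /s mulrAC ltr_pdivrMr// ltr_pM2l//; lra.
  move: aU; rewrite /sublevel /= hP; last by rewrite -modc_gt0 modcR normr_gt0 gt_eqF.
  rewrite modcM modcX modcR gtr0_norm// => h.
  rewrite /c -div1r ler_pdivlMr//; apply: le_trans (ltW h).
  rewrite mulrC ler_wpM2r ?modc_ge0//.
  by rewrite ler_eXnr// lerDl ltW.
apply: (@U_bounded_sub _ _ [set y | rnorm y <= M /\ modc (P y) <= c]).
  move=> y yA; split.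
    have [g [g1 gy]] := hahn_banach y.
    apply: (le_trans gy); apply: (le_trans (yA g (Hb_dual setT g))).
    apply: sup_le => // _ [a Aa <-].
    rewrite (le_trans (dual_normP g a))// (le_trans _ (MP a Aa))//.
    by rewrite ler_piMl ?rnorm_ge0.
  apply: (le_trans (yA P (gol_Hb _ gP))).
  by apply: sup_le => // _ [a Aa <-]; exact: Pc.
exact: sublevel_bounded.
Qed.

(** An ultrafilter along which [y] runs in a [U]-bounded set defines a
    homomorphism. *)
Lemma ultra_Mb T (G : set_system T) (GU : UltraFilter G) (y : T -> E) U A x :
  U_bounded U A -> G [set w | A (y w)] ->
  (forall g : Dual E, forall e : R, 0 < e -> G [set w | modc (g (y w) - g x) < e]) ->
  pi_Mb U (bidual_emb x).
Proof.
move=> bA GA Gx; have GP : ProperFilter G by exact: ultra_proper.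
pose phi (f : E -> R[i]^o) : R[i]^o := lim ((fun w => f (y w)) @ G).
have FF (f : E -> R[i]^o) : ProperFilter ((fun w => f (y w)) @ G).
  exact: fmap_proper_filter.
have phiP f : Hb U f -> (fun w => f (y w)) @ G --> phi f.
  move=> [_ /(_ A bA)/bounded_nearP[M MP]].
  have [|l lP] := @ultra_lim _ _ _ GU (fun w => f (y w)) M.
    by apply: filterS GA => w /= /MP.
  have fl : (fun w => f (y w)) @ G --> (l : R[i]^o).
    apply/cvg_rnormP => e e0; apply: filterS (lP e e0) => w h.
    by rewrite rnormBC; exact: h.
  by move: fl => /cvgP.
have phi_eq f (l : R[i]^o) : (fun w => f (y w)) @ G --> l -> phi f = l.
  by move=> fl; apply: cvg_lim fl; exact: norm_hausdorff.
exists phi; last first.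
  move=> g; rewrite (phi_eq (g : E -> R[i]^o) (g x))//.
  apply/cvg_rnormP => e e0; apply: filterS (Gx g e e0) => w h.
  by rewrite rnormBC; exact: h.
split.
- move=> c f g Hf Hg; apply: phi_eq; apply: (@cvgD _ R[i]^o); last exact: phiP.
  by apply: (@cvgZr _ R[i]^o); exact: phiP.
- move=> f g Hf Hg; apply: phi_eq.
  by apply: (@cvgZ _ R[i]^o); exact: phiP.
- exists (fun=> 1); first exact: Hb_cst.
  rewrite (phi_eq _ 1) ?oner_eq0//; exact: cvg_cst.
apply/subspace_continuousP => f Hf.
have FW : Filter (within (Hb U : set {family U_bounded U, E -> R[i]^o})
    (nbhs (f : {family U_bounded U, E -> R[i]^o}))).
  exact: within_filter.
apply: (@cvg_rnormP R R[i]^o _ (@fmap_filter _ _ phi _ FW) _).2 => e e0.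
apply: (@family_nbhsP R E (U_bounded U) f
  [set g | Hb U g -> modc (phi f - phi g) < e] _ _).2.
- by exists set0; exact: U_bounded0.
- by move=> *; exact: U_boundedU.
exists A, (e / 4); split=> //; first by rewrite divr_gt0.
move=> g gP Hg.
have e4 : 0 < e / 4 by rewrite divr_gt0.
have near_phi h : Hb U h -> G [set w | modc (phi h - h (y w)) < e / 4].
  by move=> Hh; exact: ((@cvg_rnormP R R[i]^o _ (@FF h) _).1 (phiP h Hh) _ e4).
have [w [[/= h1 h2] h3]] := filter_ex (filterI (filterI (near_phi g Hg) (near_phi f Hf)) GA).
have h4 := gP _ h3.
have := ler_modc_distD (f (y w)) (phi f) (phi g).
have := ler_modc_distD (g (y w)) (f (y w)) (phi g).
rewrite (modcBC (g (y w)) (phi g)).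
move: h1 h2 => h1 h2; lra.
Qed.

Lemma smf_freeze k j F x : smf (k + j) F -> smf j (fun s => F (nseq k x ++ s)).
Proof. by elim: k F => //= k ih F sF; apply: ih (smf_cons x sF). Qed.

(** The perturbation [x + t w], with [t] chosen so that the terms of highest
    and lowest degree of [P (x + t w)] cancel in the limit, leads weakly to [x]
    while [P (x + t w)] tends to [0]: the terms of intermediate degree vanish
    in the limit by the minimality of [n]. *)
Lemma sublevel_all n F (r e : R) : (0 < n)%N -> smf n F ->
  (forall j G, (0 < j < n)%N -> smf j G -> @wsc R E j G) -> 0 < e ->
  (forall gs, exists w, [/\ rnorm w <= r, small gs w & e < modc (F (nseq n w))]) ->
  range (@bidual_emb R E) `<=` pi_Mb (sublevel (fun x => F (nseq n x))).
Proof.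
move=> n0 sF lowF e0 bad _ [x _ <-].
pose P x : C := F (nseq n x); have gP : gol P := gol_diag sF.
pose W gs := [set w | [/\ rnorm w <= r, small gs w & e < modc (P w)]].
pose FF := filter_from setT W.
have FFP : ProperFilter FF.
  apply: filter_from_proper; last by move=> gs _; have [w wP] := bad gs; exists w.
  apply: filter_from_filter; first by exists [::].
  move=> gs hs _ _; exists (gs ++ hs) => // w [wr /small_cat[wg wh] we].
  by split; split.
have [G [GU sG]] := ultraFilterLemma FFP.
have GP : ProperFilter G by exact: ultra_proper.
have GW gs : G (W gs) by apply: sG; exists gs.
have [M M0 MP] := gol_bound gP r.
have [p pP] : exists p, forall d : R, 0 < d -> G [set w | modc (P w - p) < d].
  apply: (@ultra_lim _ _ _ GU P M); apply: filterS (GW [::]) => w [wr _ _].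
  exact: MP.
have p0 : p != 0.
  rewrite -modc_gt0; have e2 : 0 < e / 2 by rewrite divr_gt0.
  have [w [/= h1 [_ _ h2]]] := filter_ex (filterI (pP _ e2) (GW [::])).
  by have := ler_modc_dist (P w) p; lra.
pose t : C := n.-root (- P x / p).
have tn : t ^+ n = - P x / p by rewrite rootCK.
have lim0 (d : R) : 0 < d -> G [set w | modc (P (x + t *: w)) < d].
  move=> d0.
  pose b : R := n.+1%:R * (\sum_(j < n.+1) (modc t ^+ j * 'C(n, j)%:R) + 1).
  have S0 : 0 <= \sum_(j < n.+1) (modc t ^+ j * 'C(n, j)%:R : R).
    by apply: sumr_ge0 => j _; rewrite mulr_ge0 ?exprn_ge0 ?modc_ge0.
  have b0 : 0 < b by rewrite mulr_gt0// ltr_wpDl.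
  have db : 0 < d / b by rewrite divr_gt0.
  (* the limit of the factor of [t ^+ j] in the expansion of [P (x + t w)] *)
  pose a (j : nat) : C := if j == 0%N then P x else if j == n then p else 0.
  have Ga (j : 'I_n.+1) : G [set w | modc (F (nseq j w ++ nseq (n - j) x) - a j) <= d / b].
    rewrite /a; case: eqVneq => [->|j0].
      rewrite subn0; apply: filterE => w; rewrite /= -/(P x) subrr modc0.
      exact: ltW.
    case: eqVneq => [->|jn].
      rewrite subnn; apply: filterS (pP _ db) => w /=.
      by rewrite cats0; exact: ltW.
    have jn' : (j < n)%N by rewrite ltn_neqAle jn /= -ltnS.
    have sFj : smf ((n - j) + j) F by rewrite subnK// ltnW.
    have sG' := smf_freeze x sFj.
    have j0' : (0 < j < n)%N by rewrite lt0n j0.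
    have [gs gsP] := lowF j _ j0' sG' r _ db.
    apply: filterS (GW gs) => w [wr ws _] /=; rewrite subr0.
    have [_ pF] := sF; rewrite (pF _ (nseq (n - j) x ++ nseq j w)).
    - exact: gsP.
    - by rewrite size_cat !size_nseq subnKC// ltnW.
    - by rewrite perm_catC.
  apply: filterS (@filter_forall _ _ _ _ _ Ga) => w wP /=.
  have a0 : \sum_(j < n.+1) t ^+ j * ('C(n, j)%:R * a j) = 0.
    rewrite (bigD1 ord0)//= (bigD1 (@ord_max n))/=; last first.
      by rewrite -val_eqE /= -lt0n.
    rewrite big1 => [|j /andP[j0 jn]]; last first.
      by rewrite /a -[j == 0%N :> nat]/(j == ord0) (negbTE j0)
        -[j == n :> nat]/(j == ord_max) (negbTE jn) !mulr0.
    rewrite /a /= eqxx (gtn_eqF n0) bin0 binn expr0 tn !mul1r addr0.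
    by rewrite divfK// subrr.
  have -> : P (x + t *: w) =
      \sum_(j < n.+1) t ^+ j * ('C(n, j)%:R * F (nseq j w ++ nseq (n - j) x)) -
      \sum_(j < n.+1) t ^+ j * ('C(n, j)%:R * a j).
    by rewrite a0 subr0 /P (smf_line _ _ _ sF).
  rewrite -sumrB.
  apply: (le_lt_trans (ler_modc_sum _ _ _)).
  apply: (@le_lt_trans _ _ (\sum_(j < n.+1) modc t ^+ j * 'C(n, j)%:R * (d / b))).
    apply: ler_sum => j _; rewrite -!mulrBr !modcM modcX modc_nat -!mulrA.
    apply: ler_wpM2l; first by rewrite exprn_ge0 ?modc_ge0.
    by apply: ler_wpM2l; [exact: ler0n|exact: wP].
  rewrite -mulr_suml mulrA ltr_pdivrMr// mulrC ltr_pM2l// /b.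
  have n1 : 1 <= n.+1%:R :> R by rewrite ler1n.
  by rewrite (@lt_le_trans _ _ (1 * (\sum_(j < n.+1) (modc t ^+ j * 'C(n, j)%:R) + 1)))//
    ?mul1r ?ltrDl ?ltr01// ler_peMl// addr_ge0.
pose A := [set y | rnorm y <= rnorm x + modc t * r /\ modc (P y) <= 1 / 2].
have h2 : (1 / 2 : R) < 1 by rewrite ltr_pdivrMr// mul1r ltr1n.
apply: (@ultra_Mb E G GU (fun w => x + t *: w) _ A x).
- exact: sublevel_bounded.
- have d2 : 0 < (1 / 2 : R) by rewrite divr_gt0.
  apply: filterS (filterI (lim0 _ d2) (GW [::])) => w [/= h [wr _ _]]; split.
    rewrite (le_trans (ler_rnormD _ _))// lerD2l rnormZ.
    by rewrite ler_wpM2l ?modc_ge0.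
  exact: ltW.
- move=> g d d0.
  have t1 : 0 < modc t + 1 by rewrite ltr_wpDl ?modc_ge0.
  have c0 : 0 < (modc t + 1) / d by rewrite divr_gt0.
  apply: filterS (GW [:: ((modc t + 1) / d)%:C *: g]) => w [_ ws _] /=.
  have := small_scale (gs := [:: g]) c0 ws (mem_head _ _); rewrite invf_div => gw.
  have -> : g (x + t *: w) - g x = t * g w.
    by rewrite linearD linearZ /= -[_ *: _]/(_ * _) addrC addKr.
  rewrite modcM (@le_lt_trans _ _ (modc t * (d / (modc t + 1))))//.
    by rewrite ler_wpM2l ?modc_ge0// ltW.
  by rewrite mulrCA gtr_pMr// ltr_pdivrMr// mul1r ltrDl.
Qed.

(** The set is the sublevel set of a homogeneous polynomial of minimal degree
    among those that are not weakly continuous at the origin on bounded sets. *)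
Lemma exists_sublevel : approximation_property (Dual E) ->
  ~ finite_type_polynomials_dense E ->
  exists U : set E, [/\ open U, U <> setT, Hb_convex U
                      & range (@bidual_emb R E) `<=` pi_Mb U].
Proof.
move=> AP nd.
pose bad n := exists F, [/\ (0 < n)%N, @smf R E n F & ~ wsc n F].
have [n [badn minn]] : exists n, bad n /\ forall j, (j < n)%N -> ~ bad j.
  have [n0 bn0] : exists n, bad n.
    apply: contrapT => nb; apply: nd; apply: dense_of_wsc => // n F n0 sF.
    by apply: contrapT => nw; apply: nb; exists n, F.
  have ex : exists n, `[< bad n >] by exists n0; apply/asboolP.
  exists (ex_minn ex); case: ex_minnP => m /asboolP bm mP; split=> // j jm bj.
  by have := mP j (asboolT bj); rewrite leqNgt jm.
have [F [n0 sF nw]] := badn.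
have lowF j G : (0 < j < n)%N -> smf j G -> @wsc R E j G.
  move=> /andP[j0 jn] sG; apply: contrapT => nG; apply: (minn j jn).
  by exists G.
have [r [e [e0 rP]]] : exists r e : R, 0 < e /\ forall gs, exists w,
    [/\ rnorm w <= r, small gs w & e < modc (F (nseq n w))].
  apply: contrapT => nb; apply: nw => r e e0.
  apply: contrapT => ngs; apply: nb; exists r, e; split=> // gs.
  apply: contrapT => nx; apply: ngs; exists gs => x xr sx.
  by rewrite leNgt; apply/negP => h; apply: nx; exists x.
have gP := gol_diag sF; have hP := homog_diag sF.
exists (sublevel (fun x => F (nseq n x))); split.
- exact: gol_open.
- move=> UT; have [w [_ _ we]] := rP [::].
  pose s : R := Num.max 1 e^-1.
  have s1 : 1 <= s by rewrite le_max lexx.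
  have s0 : 0 < s by rewrite (lt_le_trans ltr01).
  have : sublevel (fun x => F (nseq n x)) (s%:C *: w) by rewrite UT.
  rewrite /sublevel /= (hP s%:C w); last by rewrite -modc_gt0 modcR normr_gt0 gt_eqF.
  rewrite modcM modcX modcR gtr0_norm//; apply/negP; rewrite -leNgt.
  have -> : 1 = e^-1 * e by rewrite mulVf ?gt_eqF.
  apply: ler_pM; rewrite ?invr_ge0 ?(ltW e0) ?(ltW we)//.
  apply: (@le_trans _ _ s); first by rewrite le_max lexx orbT.
  by rewrite ler_eXnr.
- exact: (sublevel_convex gP n0 hP).
- exact: (sublevel_all n0 sF lowF e0 rP).
Qed.

End Sublevel.

Theorem proposition4p3 (R : realType) (E : completeNormedModType R[i])
    (hE : approximation_property (Dual E)) :
  [<-> finite_type_polynomials_dense E;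
       forall U : set E, open U -> U_check U = pi_Mb U;
       forall U : set E, open U -> Hb_convex U -> U_check U = pi_Mb U] /\
  (~ finite_type_polynomials_dense E ->
    exists U : set E, [/\ open U, U <> setT, Hb_convex U
                        & range (@bidual_emb R E) `<=` pi_Mb U]).
Proof.
split; last exact: exists_sublevel hE.
tfae.
- move=> dense U _; apply/seteqP.
  by split; [exact: U_check_sub_pi_Mb|exact: pi_Mb_sub_U_check].
- by move=> h U oU _; exact: h.
- move=> h; apply: contrapT => nd.
  have [U [oU UT cU pU]] := exists_sublevel hE nd.
  apply: UT; apply/seteqP; split=> // x _; apply: (U_check_emb cU).
  by rewrite (h U oU cU); apply: pU; exists x.
Qed.
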